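(* There is a universal constant $C$ such that the following holds for all $n,m\ge1$, $\epsilon\in(0,1/2)$ and $\delta\in(0,1)$. If $k\ge\frac{C}{\epsilon^2}\left(m^2+m\log n+\log(1/\delta)\right)$, then there is a (possibly randomized) procedure that maps $k$ valuation profiles (of $n$ valuations on $[m]$ each) to a pair consisting of a price vector $\mathbf{p}\in\mathbb{R}_{\ge0}^m$ and a choice rule profile $\mathbf{A}$ such that, for every (not necessarily generic) distribution $D$ over profiles of $n$ valuations on $[m]$, when the input profiles are $k$ independent samples from $D$, with probability at least $1-\delta$ the output $\mathbf{p}$ is a vector of $(\frac12-\epsilon)$-median prices for $D$ witnessed by $\mathbf{A}$.
   Context: Valuations are functions $v:2^{[m]}\to\mathbb{R}_{\ge0}$ with $v(\emptyset)=0$ that are monotone ($v(S)\le v(T)$ for $S\subseteq T$). Demand: for $\mathbf{p}\in\mathbb{R}_{\ge0}^m$ and $M\subseteq[m]$, the demand correspondence $\mathcal{D}(v,\mathbf{p},M)$ is the set of all $B\subseteq M$ maximizing $v(B)-\sum_{j\in B}p_j$ over subsets of $M$. Choice rule: a choice rule $A_i$ for agent $i$ maps each nonempty collection $\mathcal{D}\subseteq2^{[m]}$ to a probability distribution over elements of $\mathcal{D}$. Given a choice rule profile $\mathbf{A}=(A_1,\dots,A_n)$, agents $1,\dots,n$ arrive in this order, and each agent $i$ receives a set drawn (with fresh independent randomness) from $A_i(\mathcal{D}(v_i,\mathbf{p},M_i))$, where $M_i$ is the set of items not yet allocated. $\alpha$-median prices (general distributions): $\mathbf{p}$ are $\alpha$-median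 prices for $D$ witnessed by $\mathbf{A}$ if, for $\mathbf{v}\sim D$ and allocation according to $\mathbf{A}$ at prices $\mathbf{p}$, the probability that item $j$ is allocated lies in $[\alpha,1-\alpha]$ for every $j\in[m]$. *)

(* Defs.v *)
From HB Require Import structures.
From mathcomp Require Import all_boot all_order all_algebra.
From mathcomp Require Import all_classical all_reals all_analysis.
From mathcomp Require Import measurable_realfun.

Set Implicit Arguments.
Unset Strict Implicit.
Unset Printing Implicit Defensive.

Import Order.TTheory GRing.Theory Num.Theory.

Local Open Scope ring_scope.

Section Market.
Context {R : realType}.

Record valuation (m : nat) := Valuation {
  value :> {set 'I_m} -> R;
  value_ge0 : forall S, 0 <= value S;
  value_set0 : value finset.set0 = 0;
  value_mono : forall S T : {set 'I_m}, S \subset T -> value S <= value T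
}.

Record prices (m : nat) := Prices {
  price :> 'I_m -> R;
  price_ge0 : forall j, 0 <= price j
}.

(* The values a choice rule takes at the empty collection are unconstrained:
   they are never used, since a demand correspondence is nonempty. *)
Record choice_rule (m : nat) := ChoiceRule {
  choice :> {set {set 'I_m}} -> {set 'I_m} -> R;
  choice_ge0 : forall (DD : {set {set 'I_m}}) (B : {set 'I_m}),
    DD != finset.set0 -> 0 <= choice DD B;
  choice_sum1 : forall DD : {set {set 'I_m}},
    DD != finset.set0 -> \sum_(B in DD) choice DD B = 1;
  choice_supp : forall (DD : {set {set 'I_m}}) (B : {set 'I_m}),
    DD != finset.set0 -> B \notin DD -> choice DD B = 0
}.

Definition utility m (v : valuation m) (p : prices m) (B : {set 'I_m}) : R :=
  v B - \sum_(j in B) p j.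

Definition demand m (v : valuation m) (p : prices m) (M : {set 'I_m}) :
    {set {set 'I_m}} :=
  [set B in powerset M |
    [forall B' in powerset M, utility v p B' <= utility v p B]]%SET.

Lemma demand_neq0 m (v : valuation m) (p : prices m) (M : {set 'I_m}) :
  demand v p M != finset.set0.
Proof.
have M0 : M \in powerset M by rewrite powersetE.
apply/set0Pn; case: (@arg_maxP _ R _ M (mem (powerset M)) (utility v p) M0).
move=> B BM max_B; exists B; rewrite inE [B \in _]BM /=.
by apply/forall_inP => B' /max_B.
Qed.

Definition remaining n m (x : {ffun 'I_n -> {set 'I_m}}) (i : 'I_n) :
    {set 'I_m} :=
  [set j | [forall l : 'I_n, (l < i)%N ==> (j \notin x l)]]%SET.

(* The probability that, at fixed valuations, agent [i] receives [x i] for all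
   [i]: a product of conditional probabilities given the earlier agents. *)
Definition outcome_prob n m (v : 'I_n -> valuation m) (p : prices m)
    (A : 'I_n -> choice_rule m) (x : {ffun 'I_n -> {set 'I_m}}) : R :=
  \prod_(i < n) A i (demand (v i) p (remaining x i)) (x i).

Definition alloc_prob n m (v : 'I_n -> valuation m) (p : prices m)
    (A : 'I_n -> choice_rule m) (j : 'I_m) : R :=
  \sum_(x : {ffun 'I_n -> {set 'I_m}} | [exists i, j \in x i])
    outcome_prob v p A x.

End Market.

Arguments valuation R m : clear implicits.
Arguments prices R m : clear implicits.
Arguments choice_rule R m : clear implicits.

HB.instance Definition _ (R : realType) m := gen_eqMixin (valuation R m).
HB.instance Definition _ (R : realType) m := gen_choiceMixin (valuation R m).
HB.instance Definition _ (R : realType) m := isPointed.Build (valuation R m)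
  (@Valuation R m (fun=> 0) (fun=> lexx 0) erefl (fun _ _ _ => lexx 0)).

HB.instance Definition _ (R : realType) m := gen_eqMixin (prices R m).
HB.instance Definition _ (R : realType) m := gen_choiceMixin (prices R m).
HB.instance Definition _ (R : realType) m := isPointed.Build (prices R m)
  (@Prices R m (fun=> 0) (fun=> lexx 0)).

Section UniformRule.
Context (R : realType) (m : nat).
Implicit Types (DD : {set {set 'I_m}}) (B : {set 'I_m}).

Let unif DD B : R := (B \in DD)%:R / #|DD|%:R.

Let unif_ge0 DD B : DD != finset.set0 -> 0 <= unif DD B.
Proof. by move=> _; rewrite divr_ge0. Qed.

Let unif_sum1 DD : DD != finset.set0 -> \sum_(B in DD) unif DD B = 1.
Proof.
move=> DD0; rewrite (eq_bigr (fun=> #|DD|%:R^-1)); last first.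
  by move=> B BDD; rewrite /unif BDD mul1r.
by rewrite sumr_const -[LHS]mulr_natl divff// pnatr_eq0 cards_eq0.
Qed.

Let unif_supp DD B : DD != finset.set0 -> B \notin DD -> unif DD B = 0.
Proof. by move=> _ /negbTE BDD; rewrite /unif BDD mul0r. Qed.

Definition uniform_rule : choice_rule R m :=
  ChoiceRule unif_ge0 unif_sum1 unif_supp.

End UniformRule.

HB.instance Definition _ (R : realType) m := gen_eqMixin (choice_rule R m).
HB.instance Definition _ (R : realType) m := gen_choiceMixin (choice_rule R m).
HB.instance Definition _ (R : realType) m :=
  isPointed.Build (choice_rule R m) (uniform_rule R m).

Local Open Scope classical_set_scope.

(* Profiles, prices and choice rule profiles carry the sigma-algebra generated
   by their real coordinates, i.e. the Borel sigma-algebra inherited from the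
   finite-dimensional Euclidean space in which they live. *)
Definition coord_sets {R : realType} {T I : Type} (c : I -> T -> R) :
    set (set T) :=
  [set c i @^-1` B | i in [set: I] & B in [set B : set R | measurable B]].

Definition profile_coord (R : realType) n m (iS : 'I_n * {set 'I_m})
  (v : 'I_n -> valuation R m) : R := v iS.1 iS.2.

Definition price_coord (R : realType) m (j : 'I_m) (p : prices R m) : R := p j.

Definition rules_coord (R : realType) n m
  (iDB : 'I_n * {set {set 'I_m}} * {set 'I_m})
  (A : 'I_n -> choice_rule R m) : R := A iDB.1.1 iDB.1.2 iDB.2.

Notation profileType R n m :=
  (g_sigma_algebraType (coord_sets (@profile_coord R n m))).

Notation pricesType R m :=
  (g_sigma_algebraType (coord_sets (@price_coord R m))).

Notation rulesType R n m :=
  (g_sigma_algebraType (coord_sets (@rules_coord R n m))).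

Notation outputType R n m := (pricesType R m * rulesType R n m)%type.

Definition median_prices {R : realType} n m (alpha : R)
    (D : probability (profileType R n m) R)
    (p : prices R m) (A : 'I_n -> choice_rule R m) : Prop :=
  forall j : 'I_m,
    (alpha%:E <= \int[D]_v (alloc_prob v p A j)%:E <= (1 - alpha)%:E)%E.

Lemma measurable_coord (R : realType) (T : pointedType) (I : Type)
    (c : I -> T -> R) (i : I) :
  measurable_fun [set: g_sigma_algebraType (coord_sets c)] (c i).
Proof.
move=> _ B mB; rewrite setTI; apply: sub_sigma_algebra.
by exists i => //; exists B.
Qed.

Lemma measurable_forall (d : measure_display) (T : measurableType d)
    (I : finType) (P : I -> T -> Prop) :
  (forall i, measurable [set t | P i t]) ->
  measurable [set t | forall i, P i t].
Proof.
move=> mP; have -> : [set t | forall i, P i t] =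
    \bigcap_(i in [set: I]) [set t | P i t].
  by apply/seteqP; split => t /= Pt i; [move=> _; exact: Pt|exact: (Pt i)].
by apply: fin_bigcap_measurable => //; exact: finite_finset.
Qed.

Section MedianMeasurable.
Context (R : realType) (n m : nat).
Let Y := outputType R n m.
Let V := profileType R n m.

Let mprice (j : 'I_m) : measurable_fun [set: Y * V]
  (fun w => (w.1.1 : prices R m) j).
Proof.
have mf : measurable_fun [set: Y * V] (fun w => w.1.1).
  by apply: (measurableT_comp measurable_fst).
exact: (measurableT_comp (measurable_coord (c := @price_coord R m) j) mf).
Qed.

Let mrule i DD B : measurable_fun [set: Y * V]
  (fun w => (w.1.2 : 'I_n -> choice_rule R m) i DD B).
Proof.
have mf : measurable_fun [set: Y * V] (fun w => w.1.2).
  by apply: (measurableT_comp measurable_snd).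
exact: (measurableT_comp
  (measurable_coord (c := @rules_coord R n m) (i, DD, B)) mf).
Qed.

Let mval i S : measurable_fun [set: Y * V]
  (fun w => (w.2 : 'I_n -> valuation R m) i S).
Proof.
have mf : measurable_fun [set: Y * V] (fun w => w.2).
  by exact: measurable_snd.
exact: (measurableT_comp
  (measurable_coord (c := @profile_coord R n m) (i, S)) mf).
Qed.

Let mutil i B : measurable_fun [set: Y * V]
  (fun w => utility ((w.2 : 'I_n -> valuation R m) i) w.1.1 B).
Proof.
apply: measurable_funB; first exact: mval.
have -> : (fun w : Y * V => \sum_(j in B) (w.1.1 : prices R m) j) =
   (fun w => \sum_(j <- enum B) (w.1.1 : prices R m) j).
  by apply/funext => w; rewrite big_enum.
by apply: measurable_sum => j; exact: mprice.
Qed.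

Let mdemand i M (DD : {set {set 'I_m}}) : measurable [set w : Y * V |
  demand ((w.2 : 'I_n -> valuation R m) i) w.1.1 M = DD].
Proof.
have mB B : measurable [set w : Y * V |
    B \in demand ((w.2 : 'I_n -> valuation R m) i) w.1.1 M].
  have -> : [set w : Y * V |
    B \in demand ((w.2 : 'I_n -> valuation R m) i) w.1.1 M] =
    (if B \in powerset M then
     [set w | forall B' : {set 'I_m}, B' \in powerset M ->
     utility ((w.2 : 'I_n -> valuation R m) i) w.1.1 B' <=
     utility ((w.2 : 'I_n -> valuation R m) i) w.1.1 B] else set0).
    case: ifPn => BM; apply/seteqP; split => w //=; rewrite inE ?BM //=.
    - by move/forall_inP.
    - by move=> H; apply/forall_inP.
    - by rewrite (negbTE BM).
  case: ifP => // _; apply: measurable_forall => B'.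
  case: (boolP (B' \in powerset M)) => BM; last first.
    by rewrite (_ : [set _ | _] = setT)//; apply/seteqP; split.
  rewrite (_ : [set _ | _] = setT `&` [set w : Y * V |
     utility ((w.2 : 'I_n -> valuation R m) i) w.1.1 B' <=
     utility ((w.2 : 'I_n -> valuation R m) i) w.1.1 B]).
    by apply: measurable_fun_le => //; exact: mutil.
  by rewrite setTI; apply/seteqP; split => w /= H; [exact: H|move=> _].
rewrite (_ : [set _ | _] = [set w : Y * V | forall B,
    (B \in demand ((w.2 : 'I_n -> valuation R m) i) w.1.1 M) = (B \in DD)]).
  apply: measurable_forall => B; case: (B \in DD); first exact: mB.
  rewrite (_ : [set _ | _] = ~` [set w : Y * V |
    B \in demand ((w.2 : 'I_n -> valuation R m) i) w.1.1 M]).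
    by apply: measurableC; exact: mB.
  by apply/seteqP; split => w /= => [->|/negP/negbTE].
by apply/seteqP; split => w /= H; [rewrite H|apply/finset.setP].
Qed.

Lemma measurable_alloc_prob j : measurable_fun [set: Y * V]
  (fun w => alloc_prob (w.2 : 'I_n -> valuation R m) w.1.1 w.1.2 j).
Proof.
rewrite /alloc_prob.
have -> : (fun w : Y * V =>
    \sum_(x : {ffun 'I_n -> {set 'I_m}} | [exists i, j \in x i])
    outcome_prob (w.2 : 'I_n -> valuation R m) w.1.1 w.1.2 x) =
   (fun w => \sum_(x <- seq.filter
      (fun x : {ffun 'I_n -> {set 'I_m}} => [exists i, j \in x i])
      (index_enum _))
    outcome_prob (w.2 : 'I_n -> valuation R m) w.1.1 w.1.2 x).
  by apply/funext => w; rewrite big_filter.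
apply: measurable_sum => x; apply: measurable_prod => i _.
rewrite (_ : (fun w : Y * V => _) = (fun w => \sum_(DD : {set {set 'I_m}})
   \1_[set w : Y * V | demand ((w.2 : 'I_n -> valuation R m) i) w.1.1
       (remaining x i) = DD] w *
       (w.1.2 : 'I_n -> choice_rule R m) i DD (x i))).
  apply: measurable_sum => DD; apply: measurable_funM; last exact: mrule.
  exact: (measurable_indicP R _).1 (mdemand i _ DD).
apply/funext => w.
rewrite (bigD1
  (demand ((w.2 : 'I_n -> valuation R m) i) w.1.1 (remaining x i)))//=.
rewrite big1 ?addr0 => [|DD neq]; rewrite indicE.
  by rewrite mem_set// mul1r.
by rewrite memNset ?mul0r//= => E; rewrite E eqxx in neq.
Qed.

Lemma alloc_prob_ge0 (v : 'I_n -> valuation R m) p A j :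
  0 <= alloc_prob v p A j.
Proof.
apply: sumr_ge0 => x _; apply: prodr_ge0 => i _; apply: choice_ge0.
exact: demand_neq0.
Qed.

Lemma measurable_median_prices (alpha : R) (D : probability V R) :
  measurable [set pA : Y | median_prices alpha D pA.1 pA.2].
Proof.
apply: measurable_forall => j.
pose g (w : Y * V) :=
  (alloc_prob (w.2 : 'I_n -> valuation R m) w.1.1 w.1.2 j)%:E.
have mF : measurable_fun [set: Y] (fun y => \int[D]_v g (y, v))%E.
  apply: (@measurable_fun_fubini_tonelli_F _ _ _ _ _ D g).
    apply/measurable_EFinP; exact: measurable_alloc_prob.
  by move=> w; rewrite lee_fin alloc_prob_ge0.
have := mF measurableT `[alpha%:E, (1 - alpha)%:E]%classic
  (emeasurable_itv _).
rewrite setTI; congr (measurable (_ : set Y)); apply/seteqP; split => w /=;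
by rewrite in_itv /=.
Qed.

End MedianMeasurable.

Definition independent_samples {R : realType} d d' (Omega : measurableType d)
    (T : measurableType d') (P : probability Omega R) (D : probability T R)
    (k : nat) (X : 'I_k -> {RV P >-> T}) : Prop :=
  (forall i B, measurable B -> distribution P (X i) B = D B) /\
  (forall B : 'I_k -> set T, (forall i, measurable (B i)) ->
    P (\bigcap_(i in [set: 'I_k]) (X i @^-1` B i)) =
    (\prod_(i < k) P (X i @^-1` B i))%E).

(* A randomized procedure is a probability kernel [K] from sample tuples to
   outputs; the integral averages over the samples the probability, over the
   internal randomness of [K], that the output lies in [E]. *)
Definition output_prob {R : realType} d d1 d2 (Omega : measurableType d)
    (T : measurableType d1) (Y : measurableType d2) (P : probability Omega R)
    (k : nat) (X : 'I_k -> {RV P >-> T}) (K : R.-pker (k.-tuple T) ~> Y)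
    (E : set Y) : \bar R :=
  \int[P]_w K [tuple X i w | i < k] E.

(* Main.v *)
(* Choice rules are taken from a family indexed by w in R^m: from a demand set,
   pick the bundle B maximizing the sum over j in B of (noise_j - w_j), the noise
   being uniform on a large finite grid. An agent facing (p, w) thus compares
   bundles lexicographically, by utility at p and then by noisy score; this is
   the limit, as eta -> 0, of adding eta * noise to the values and pricing at
   p + eta * w.

   Existence of (p, w) that is approximately median for the sample: for the
   noisy valuations the allocation probabilities vary slowly with the prices, and
   Scarf's combinatorial lemma on a price grid (label j if item j is allocated
   with probability > 1/2, label 0 if there is no such item) gives approximately
   median prices; let eta -> 0 along a convergent subsequence. For measurability,
   p is replaced by a solution of the linear equations expressing its ties that
   depends linearly on the sample and on rational parameters, so that a countable
   family of measurable candidates suffices.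

   Generalization: lexicographic comparisons of m-dimensional linear functionals
   have VC dimension at most m, so s sampled runs take at most
   (s n 4^m + 1)^m allocation patterns. This bounds the packing numbers of the
   class, and chaining over the scales 4^-l bounds the deviation between a sample
   and a ghost sample under random swaps without a log(1/eps) loss. *)

Require Import Defs.
From HB Require Import structures.
From mathcomp Require Import all_boot all_order all_algebra.
From mathcomp Require Import all_classical all_reals all_analysis.
From mathcomp Require Import ring lra zify.
From mathcomp Require Import measurable_realfun.

Set Implicit Arguments.
Unset Strict Implicit.
Unset Printing Implicit Defensive.

Import Order.TTheory GRing.Theory Num.Theory.
Import numFieldNormedType.Exports.

(** * Scarf's lemma *)

Section Rooms.
Import fintype finset.
Local Open Scope set_scope.
Local Open Scope nat_scope.
Variables (I T : finType) (rk : I -> T -> nat).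
Hypothesis rk_inj : forall i, injective (rk i).
Implicit Types (s t : {set T}).

(** A choice rule profile has a number of parameters that is doubly exponential in [m], far too many
    for the sample size. Sharing one vector [w] among all agents leaves the pair [(p, w)]. Both act
    on a bundle through the same coefficients, one on each level of the lexicographic comparison, so
    the dimension that counts is [m] rather than [2 * m]. The logarithm of the growth function is
    about [m * ln (n * 4 ^ m)], the origin of [m ^ 2 + m log n].

    The noise serves existence: without it an arbitrarily small price change can flip the allocation
    of a whole profile. Its grid must be fine compared with [n * 4 ^ m / eps], but this costs no
    samples, because a noise vector counts as part of the data point and enters only the constants
    of the comparisons.

    Existence rests on parity and compactness, neither of which yields a measurable choice; hence
    the countable family of candidates.

    The error [eps] is split into [eps / 2] for the empirical median and [eps / 2] for
    generalization; the latter is halved again between sample and ghost sample. *)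

Definition dominating s :=
  [forall y, exists i, [forall x in s, rk i y <= rk i x]].

Lemma dominatingS s t : s \subset t -> dominating t -> dominating s.
Proof.
move=> st /forallP D; apply/forallP => y; have /existsP[i /forall_inP H] := D y.
by apply/existsP; exists i; apply/forall_inP => x xs; apply: H;
  apply: (subsetP st).
Qed.

(* [above t a]: the points that could replace the minimum of [t] in order
   [a]; adding to [t] the greatest of them in order [a] gives the room of [t]
   on that side. *)
Definition above t a :=
  [set y | [forall i, (i != a) ==> [exists x in t, rk i x < rk i y]]].

Definition rooms t := [set y | (y \notin t) && dominating (y |: t)].

Section Door.
Variables (t : {set T}) (t0 : T).
Hypotheses (t0t : t0 \in t) (domt : dominating t) (cardt : #|t|.+1 = #|I|).

Let mn i := [arg min_(x < t0 in t) rk i x].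

Let mnP i : mn i \in t /\ forall x, x \in t -> rk i (mn i) <= rk i x.
Proof. by rewrite /mn; case: arg_minnP => // x xt H; split. Qed.

Let mn_surj x : x \in t -> exists i, mn i = x.
Proof.
move=> xt; have /forallP/(_ x)/existsP[i /forall_inP H] := domt.
exists i; have [mt ml] := mnP i.
by apply: (@rk_inj i); apply/eqP; rewrite eqn_leq ml // H.
Qed.

(** Domination applied to the points of [t] themselves makes each of them a minimum in some order.
    There is one point fewer than there are orders, so two orders share a minimum. *)
Let twin_mins : exists a b, a != b /\ mn a = mn b.
Proof.
have imE : mn @: [set: I] = t.
  apply/setP => x; apply/imsetP/idP => [[i _ ->]|/mn_surj[i <-]];
    last by exists i.
  by case: (mnP i).
have : ~~ injectiveb mn.
  apply/negP => /injectiveP inj; have := card_imset [set: I] inj.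
  by rewrite imE cardsT -cardt; lia.
by move=> /injectivePn[a [b ab mab]]; exists a, b.
Qed.

Let aboveP a y : reflect (forall i, i != a ->
  rk i (mn i) < rk i y) (y \in above t a).
Proof.
rewrite inE; apply: (iffP forall_inP) => H i /H.
  by move=> /exists_inP[x xt]; apply: leq_ltn_trans; case: (mnP i) => _; apply.
by move=> lt; apply/exists_inP; exists (mn i) => //; case: (mnP i).
Qed.

Let room_above a b y : a != b -> mn a = mn b ->
    y \in above t a -> (forall z, z \in above t a -> rk a z <= rk a y) ->
      y \in rooms t.
Proof.
move=> ab mab /aboveP ya ymax; have yt : y \notin t.
  apply/negP => /[dup] yt /mn_surj[i Ei].
  have [ia|ia] := eqVneq i a; last by have := ya _ ia; rewrite Ei ltnn.
  by have := ya b; rewrite eq_sym ab -mab -ia Ei ltnn => /(_ isT).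
have ya_lt : rk a y <= rk a (mn a).
  have /forallP/(_ y)/existsP[i /forall_inP H] := domt.
  have [<-|ia] := eqVneq i a; first by apply: H; case: (mnP i).
  by have := ya _ ia; rewrite ltnNge H //; case: (mnP i).
rewrite inE yt /=; apply/forallP => z; apply/existsP.
have [/[dup] zA /aboveP za|] := boolP (z \in above t a).
  exists a; apply/forall_inP => x; rewrite !inE => /orP[/eqP->|xt].
    exact: ymax.
  apply: leq_trans (ymax _ zA) _.
  by apply: leq_trans ya_lt _; case: (mnP a) => _; apply.
rewrite inE negb_forall => /existsP[i]; rewrite negb_imply => /andP[ia].
move=> /exists_inPn zi; have {}zi : rk i z <= rk i (mn i).
  by rewrite leqNgt zi //; case: (mnP i).
exists i; apply/forall_inP => x; rewrite !inE => /orP[/eqP->|xt].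
  by apply: leq_trans zi _; apply: ltnW; apply: ya.
by apply: leq_trans zi _; case: (mnP i) => _; apply.
Qed.

Let above_room a b y : a != b -> mn a = mn b ->
    y \in rooms t ->
    (y \in above t a /\ forall z, z \in above t a -> rk a z <= rk a y) \/
    (y \in above t b /\ forall z, z \in above t b -> rk b z <= rk b y).
Proof.
move=> ab mab; rewrite inE => /andP[yt domy].
pose mn' i := if rk i y < rk i (mn i) then y else mn i.
have mn'P i x : x \in y |: t -> rk i (mn' i) <= rk i x.
  rewrite !inE /mn'; case: (ltnP (rk i y)) => H /orP[/eqP->//|xt].
    by apply: leq_trans (ltnW H) _; case: (mnP i) => _; apply.
  by case: (mnP i) => _; apply.
have mn't i : mn' i \in y |: t.
  by rewrite !inE /mn'; case: ifP; rewrite ?eqxx //; case: (mnP i) => ->;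
    rewrite orbT.
have imE : mn' @: [set: I] = y |: t.
  apply/setP => x; apply/imsetP/idP => [[i _ ->]//|xt].
  have /forallP/(_ x)/existsP[i /forall_inP H] := domy.
  by exists i => //; apply: (@rk_inj i); apply/eqP; rewrite eqn_leq H // mn'P.
have inj' : injective mn'.
  have /imset_injP inj' : #|mn' @: [set: I]| == #|[set: I]|.
    by rewrite imE cardsU1 yt add1n cardt cardsT.
  by move=> i j; apply: inj'; rewrite inE.
have key c d : c != d -> mn c = mn d -> rk c y < rk c (mn c) ->
    y \in above t c /\ forall z, z \in above t c -> rk c z <= rk c y.
  move=> cd mcd yc; have mc : mn' c = y by rewrite /mn' yc.
  have ny i : i != c -> rk i (mn i) < rk i y.
    move=> ic; have := inj' i c; rewrite mc /mn';
      case: ltngtP => // [lt /(_ erefl) E|E /(_ (rk_inj (esym E))) E2].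
      by rewrite E eqxx in ic.
    by rewrite E2 eqxx in ic.
  split; first exact/aboveP.
  move=> z /aboveP za; have /forallP/(_ z)/existsP[i /forall_inP H] := domy.
  have [<-|ic] := eqVneq i c; first by apply: H; rewrite !inE eqxx.
  by have := za _ ic; rewrite ltnNge H // !inE; case: (mnP i) => ->;
    rewrite orbT.
have : mn' a != mn' b by rewrite (inj_eq inj').
rewrite {1 2}/mn'; case: (ltnP (rk a y)) => [ya _|]; first by left;
  apply: (key a b).
move=> _; case: (ltnP (rk b y)) => [yb _|]; last by rewrite mab eqxx.
by right; apply: (key b a) => //; rewrite eq_sym.
Qed.

Let rooms_at a := [set y in above t a | [forall z in above t a, rk a z
  <= rk a y]].

Let card_rooms_at a : #|rooms_at a| = (above t a != finset.set0).
Proof.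
have [E|/set0Pn[y0 y0a]] := eqVneq (above t a) finset.set0.
  by apply/eqP; rewrite cards_eq0 /rooms_at E; apply/eqP/setP => y;
    rewrite !inE.
pose y1 := [arg max_(y > y0 in above t a) rk a y].
have [y1a y1max] : y1 \in above t a /\ forall y, y \in above t a ->
  rk a y <= rk a y1.
  by rewrite /y1; case: arg_maxnP => // x xa H; split.
rewrite (_ : rooms_at a = [set y1]) ?cards1 //; apply/setP => y;
  rewrite finset.in_set1 inE.
apply/andP/eqP => [[ya /forall_inP ymax]|->].
  by apply: (@rk_inj a); apply/eqP; rewrite eqn_leq ymax // y1max.
by split=> //; apply/forall_inP.
Qed.

(** In a room every point is the minimum of exactly one order, so the new point must take over the
    shared minimum in one of the twin orders [a], [b]. It is then the greatest point of [above t a]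
    or of [above t b]: at most one room on each side. *)
Lemma card_rooms : exists a b, [/\ a != b,
  #|rooms t| = (above t a != finset.set0) + (above t b != finset.set0) &
  exists2 x, x \in t & forall y, y \in t ->
    rk a x <= rk a y /\ rk b x <= rk b y].
Proof.
have [a [b [ab mab]]] := twin_mins; exists a, b; split=> //; last first.
  exists (mn a) => [|y yt]; first by case: (mnP a).
  split; first by case: (mnP a) => _; apply.
  by rewrite mab; case: (mnP b) => _; apply.
rewrite -!card_rooms_at; have -> : rooms t = rooms_at a :|: rooms_at b.
  apply/setP => y; rewrite finset.in_setU; apply/idP/orP.
    move=> /(above_room ab mab)[] [yc ymax]; [left|right];
    by rewrite inE yc; apply/forall_inP.
  move=> [] /setIdP[yc /forall_inP ymax]; first exact: (room_above ab mab).
  by apply: (@room_above b a) => //; rewrite eq_sym.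
rewrite cardsU (_ : _ :&: _ = finset.set0) ?cards0 ?subn0 //.
apply/setP => y; rewrite finset.in_setI [RHS]inE; apply/negbTE/negP.
move=> /andP[/setIdP[/aboveP ya _] /setIdP[/aboveP yb _]].
have /forallP/(_ y)/existsP[i /forall_inP H] := domt.
have {}H : rk i y <= rk i (mn i) by apply: H; case: (mnP i).
have [ia|ia] := eqVneq i a; last by have := ya _ ia; rewrite ltnNge H.
by have := yb i; rewrite ia ab ltnNge -ia H => /(_ isT).
Qed.

End Door.
End Rooms.

Section Scarf.
Import fintype finset.
Local Open Scope set_scope.
Local Open Scope nat_scope.
Variables (I T : finType) (rk : I -> T -> nat) (c : T -> I) (x0 : T).
Hypothesis rk_inj : forall i, injective (rk i).
Hypothesis I_gt1 : 1 < #|I|.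

(* The slack point [inr l] is the least one in order [l] and exceeds all of [T]
   in the other orders; it allows only full-dimensional cells to be considered. *)
Let srk (i : I) (u : T + I) : nat :=
  match u with
  | inl x => (rk i x).+1
  | inr l => if l == i then 0 else (\max_x rk i x).+2 + enum_rank l
  end.

Let sc (u : T + I) : I := match u with inl x => c x | inr l => l end.

Let srk_max i x l : l != i -> srk i (inl x) < srk i (inr l).
Proof.
by move=> li /=; rewrite (negbTE li) addSn ltnS (leq_trans _ (leq_addr _ _)) //
  ltnS leq_bigmax.
Qed.

Let srk_inj i : injective (srk i).
Proof.
case=> [x|l] [y|l'] //.
- by move=> /= /succn_inj/rk_inj->.
- have [->|li] := eqVneq l' i; first by rewrite /= eqxx.
  by move=> E; have := srk_max x li; rewrite E ltnn.
- have [->|li] := eqVneq l i; first by rewrite /= eqxx.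
  by move=> E; have := srk_max y li; rewrite E ltnn.
- rewrite /=; case: eqVneq => [->|li]; case: eqVneq => [->|l'i] //.
  by move=> /addnI/val_inj/enum_rank_inj->.
Qed.

Let i0 := c x0.

(** Doors of a Sperner-type parity argument. Every door but [slacks] has zero or two rooms, and a
    dominating set that misses a color has zero or two doors, so counting incidences forces a fully
    colored dominating set. *)
Let door (t : {set T + I}) := (sc @: t == [set~ i0]) && (#|t|.+1 == #|I|).

Let slacks : {set T + I} := inr @: [set~ i0].

Let slacksP u : reflect (exists2 l, l != i0 & u = inr l) (u \in slacks).
Proof.
apply: (iffP imsetP) => [[l]|[l li ->]]; first by rewrite !inE => li ->;
  exists l.
by exists l; rewrite ?inE.
Qed.

Let inr_inj : injective (inr : I -> T + I). Proof. by move=> x y []. Qed.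

Let door_slacks : door slacks.
Proof.
apply/andP; split; last first.
  by rewrite card_imset // cardsC1; apply/eqP; lia.
apply/eqP/setP => i; apply/imsetP/idP => [[u /slacksP[l li ->] ->]|].
  by rewrite !inE.
by rewrite !inE => ii; exists (inr i) => //; apply/slacksP; exists i.
Qed.

Let dominating_slacks : dominating srk slacks.
Proof.
apply/forallP => -[x|l]; apply/existsP; last first.
  by exists l; apply/forall_inP => u _; rewrite /= eqxx.
exists i0; apply/forall_inP => u /slacksP[l li ->].
by apply: ltnW; apply: srk_max.
Qed.

Let rooms_dominating t : ~~ dominating srk t -> rooms srk t = finset.set0.
Proof.
move=> nd; apply/setP => y; rewrite !inE; apply/negbTE; rewrite negb_and.
apply/orP; right; apply: contra nd; apply: dominatingS; exact: finset.subsetUr.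
Qed.

(** Each [inr i] with [i != i0] is the minimum of [slacks] in order [i], so one twin order is [i0],
    here [a]. On that side [inl x0] is available. On the side of [b] nothing is: real points lie
    below every slack in order [i0], and each slack is minimal in some order other than [b]. So
    [slacks] is the boundary door. *)
Let above_slacks (a b : I) (x : T + I) : a != b -> x \in slacks ->
    (forall y, y \in slacks -> srk a x <= srk a y /\ srk b x <= srk b y) ->
    b != i0 ->
  above srk slacks a != finset.set0 /\ above srk slacks b = finset.set0.
Proof.
move=> ab xs xmin bi0; have own i : i != i0 -> inr i \in slacks.
  by move=> ii; apply/slacksP; exists i.
have xb : x = inr b.
  by apply: (@srk_inj b); apply/eqP;
    rewrite eqn_leq (xmin _ (own b bi0)).2 /= eqxx.
have ai0 : a = i0.
  apply/eqP; apply: contraNT ab => ai0; apply/eqP.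
  have : x = inr a; last by rewrite xb => -[].
  by apply: (@srk_inj a); apply/eqP;
    rewrite eqn_leq (xmin _ (own a ai0)).1 /= eqxx.
split; first apply/set0Pn.
  exists (inl x0); rewrite inE; apply/forall_inP => i; rewrite ai0 => ii.
  by apply/exists_inP; exists (inr i); rewrite ?own //= eqxx.
apply/setP => y; rewrite inE [RHS]inE; apply/negbTE/negP => /forall_inP H.
have /H/exists_inP[u us] : i0 != b by rewrite eq_sym.
case: y H => [y|l] H.
  by case/slacksP: us => l li ->; rewrite ltnNge ltnW // srk_max.
have [->|lb] := eqVneq l b; last first.
  by have /H/exists_inP[v _] := lb; rewrite /= eqxx ltn0.
by rewrite -xb ltnNge -ai0 (xmin _ us).1.
Qed.

Let card_rooms_slacks : #|rooms srk slacks| = 1.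
Proof.
have [l li] : exists l, l != i0.
  have : 0 < #|[set~ i0]| by rewrite cardsC1; lia.
  by move=> /card_gt0P[l]; rewrite !inE; exists l.
have ls : inr l \in slacks by apply/slacksP; exists l.
have /andP[_ /eqP cs] := door_slacks.
have [a [b [ab -> [x xs xmin]]]] := card_rooms srk_inj ls dominating_slacks cs.
have [bi0|bi0] := eqVneq b i0; last first.
  by have [-> ->] := above_slacks ab xs xmin bi0; rewrite eqxx.
have xmin' y : y \in slacks -> srk b x <= srk b y /\ srk a x
  <= srk a y by move=> /xmin[].
have ai0 : a != i0 by rewrite -bi0.
by rewrite eq_sym in ab; have [-> ->] := above_slacks ab xs xmin' ai0;
  rewrite eqxx.
Qed.

(** A door other than [slacks] contains a real point, which [inr a] exceeds in every order but [a];
    so neither side is empty. *)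
Let card_rooms_door t : door t -> t != slacks -> ~~ odd #|rooms srk t|.
Proof.
move=> dt ts; have [domt|/rooms_dominating->] := boolP (dominating srk t);
  last first.
  by rewrite cards0.
have [/eqP imt /eqP ct] := andP dt.
have [x xt] : exists x, inl x \in t.
  apply/existsP; apply: contraNT ts; rewrite negb_exists => /forallP nt.
  apply/eqP/setP => -[x|l].
    by rewrite (negbTE (nt x)); apply/esym/negbTE/negP => /slacksP[].
  apply/idP/slacksP => [lt|[l' li [->]]].
    by exists l => //; have := imset_f sc lt; rewrite imt !inE.
  have : l' \in sc @: t by rewrite imt !inE.
  by move=> /imsetP[[x|l''] lt] /= => [|->//]; rewrite (negbTE (nt x)) in lt.
have above_t a : above srk t a != finset.set0.
  apply/set0Pn; exists (inr a); rewrite inE; apply/forall_inP => i ia.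
  by apply/exists_inP; exists (inl x) => //; rewrite srk_max // eq_sym.
by have [a [b [_ -> _]]] := card_rooms srk_inj xt domt ct; rewrite !above_t.
Qed.

Let odd_doors : odd (\sum_(t | door t) #|rooms srk t|).
Proof.
rewrite (bigD1 slacks) //= card_rooms_slacks oddD /= -dvdn2.
by apply: dvdn_sum => t /andP[dt ts]; rewrite dvdn2 card_rooms_door.
Qed.

(** When a color is missing, [s :\ x] can be a door only if the color of [x] recurs at some [x'];
    then [s :\ x] and [s :\ x'] are the only doors. *)
Let even_doors (s : {set T + I}) : sc @: s != [set: I] ->
  ~~ odd #|[set x in s | door (s :\ x)]|.
Proof.
move=> nc; have [->|/set0Pn[x]] :=
  eqVneq [set x in s | door (s :\ x)] finset.set0.
  by rewrite cards0.
rewrite inE => /andP[xs dx]; have [/eqP imx /eqP cardx] := andP dx.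
have sE : s = x |: (s :\ x) by rewrite finset.setD1K.
have xi : sc x != i0.
  apply: contra nc => /eqP xi; rewrite sE imsetU1 imx xi; apply/eqP/setP => i.
  by rewrite !inE orbN.
have : sc x \in sc @: (s :\ x) by rewrite imx !inE.
move=> /imsetP[x']; rewrite !inE => /andP[x'x x's] xx'.
suff -> : [set x in s | door (s :\ x)] = [set x; x'].
  by rewrite cards2 eq_sym x'x.
have im_s y y' : y \in s -> y' \in s -> y != y' -> sc y = sc y' ->
  sc @: (s :\ y) = sc @: s.
  move=> ys y's yy E; rewrite -{2}(finset.setD1K ys) imsetU1;
    apply/esym/finset.setUidPr.
  by rewrite finset.sub1set E imset_f // !inE eq_sym yy.
apply/setP => z; rewrite inE finset.in_set2; apply/andP/orP; last first.
  move=> [] /eqP->; split => //; apply/andP; split.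
  - by rewrite (im_s x' x) // -(im_s x x') ?imx // eq_sym.
  - by rewrite -cardx; have := cardsD1 x s; rewrite (cardsD1 x' s) xs x's => E;
    rewrite eqSS; move/eqP: E; rewrite !add1n eqSS.
move=> [zs /andP[/eqP imz /eqP cardz]].
have [zx|zx] := boolP (z == x); first by left.
have [zx'|zx'] := boolP (z == x'); first by right.
have /imset_injP inj : #|sc @: (s :\ z)| == #|s :\ z|.
  by rewrite imz cardsC1 -cardz.
have := inj x x'; rewrite !inE !(eq_sym _ z) zx zx' xs x's =>
  /(_ isT isT xx') E.
by rewrite E eqxx in x'x.
Qed.

Let sum_doors : \sum_(t | door t) #|rooms srk t| =
  \sum_(s | dominating srk s) #|[set x in s | door (s :\ x)]|.
Proof.
under eq_bigr do rewrite -sum1_card.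
under [RHS]eq_bigr do rewrite -sum1_card.
rewrite (exchange_big_dep xpredT) //= [RHS](exchange_big_dep xpredT) //=.
apply: eq_bigr => x _.
rewrite (reindex_onto (fun s => s :\ x) (fun t => x |: t)) /=; last first.
  by move=> t /andP[_]; rewrite !inE => /andP[xt _]; rewrite finset.setU1K.
apply: eq_bigl => s; rewrite !inE eqxx /=.
have [xs|xs] := boolP (x \in s); first by rewrite finset.setD1K // eqxx;
  case: (door _); case: (dominating _ _).
rewrite [RHS]andbF; apply/negbTE; rewrite negb_and; apply/orP; right.
by apply: contra xs => /eqP <-; rewrite setU11.
Qed.

Lemma scarf : exists (s : {set T}) (C : {set I}), [/\ s != finset.set0,
  forall i, i \in C -> exists2 x, x \in s & c x = i &
  forall y, exists2 i, i \in C & forall x, x \in s -> rk i y <= rk i x].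
Proof.
have [s doms ims] : exists2 s, dominating srk s & sc @: s = [set: I].
  have [s /andP[doms /eqP ims]|nex] :=
    pickP (fun s => dominating srk s && (sc @: s == [set: I])).
    by exists s.
  have := odd_doors; rewrite sum_doors -[odd _]negbK -dvdn2 dvdn_sum // =>
    s doms.
  by rewrite dvdn2 even_doors //; have := nex s; rewrite doms /= => ->.
(* An order whose slack lies in [s] cannot dominate a real point, since [inr i] has rank 0 in order
   [i]; and a color whose slack is absent must come from a real point. *)
pose C := [set i | inr i \notin s]; pose s' := [set x | inl x \in s].
have inC i : i \in C -> exists2 x, x \in s' & c x = i.
  rewrite inE => is_; have : i \in sc @: s by rewrite ims.
  move=> /imsetP[[x|l] us /= E]; first by exists x; rewrite ?inE.
  by rewrite E us in is_.
have dom y : exists2 i, i \in C & forall x, x \in s' -> rk i y <= rk i x.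
  have /forallP/(_ (inl y))/existsP[i /forall_inP H] := doms.
  exists i; last by move=> x; rewrite inE => /H; rewrite ltnS.
  by rewrite inE; apply/negP => /H; rewrite /= eqxx ltn0.
exists s', C; split=> //; have [i /inC[x xs _] _] := dom x0.
by apply/set0Pn; exists x.
Qed.

End Scarf.

(** * A Sperner lemma on the integer points of a simplex *)

Section Grid.
Import fintype finset.
Local Open Scope set_scope.
Local Open Scope nat_scope.

(* The degenerate alternative [x0 i <= m] covers the facet [x i = 0]. *)
Lemma sperner_grid (m N : nat) (c : ('I_m.+1 -> nat) -> 'I_m.+1) : 0 < m ->
  exists x0 : 'I_m.+1 -> nat, \sum_i x0 i = N /\
  forall i, x0 i <= m \/
    exists2 x, c x = i & forall l, x l <= x0 l + m /\ x0 l <= x l + m.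
Proof.
move=> m_gt0; pose T : finType :=
  {x : {ffun 'I_m.+1 -> 'I_N.+1} | \sum_i x i == N}.
pose coord (x : T) i : nat := val x i.
have coord_sum x : \sum_i coord x i = N by apply/eqP; exact: (valP x).
have mkT (f : 'I_m.+1 -> nat) : \sum_i f i = N -> exists x, coord x =1 f.
  move=> fN; have fle i : f i < N.+1 by rewrite ltnS -fN (bigD1 i) //= leq_addr.
  pose g : {ffun 'I_m.+1 -> 'I_N.+1} := [ffun i => inord (f i)].
  have gf i : g i = f i :> nat by rewrite ffunE inordK.
  have gN : \sum_i g i == N by under eq_bigr do rewrite gf; rewrite fN.
  by exists (exist _ g gN) => i; rewrite /coord /= gf.
have [t0 _] : exists x : T, coord x =1 fun i => (i == ord0) * N.
  by apply: mkT; rewrite (bigD1 ord0) //= big1 ?addn0 ?mul1n // => i /negbTE->.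
pose rk i (x : T) := coord x i * #|T| + enum_rank x.
have rk_inj i : injective (rk i).
  move=> x y E; apply/enum_rank_inj/val_inj => /=.
  have := congr1 (modn^~ #|T|) E; rewrite /rk !modnMDl !modn_small //;
    exact: ltn_ord.
have rk_lt i x y : coord x i < coord y i -> rk i x < rk i y.
  move=> lt; apply: leq_trans (_ : (coord x i).+1 * #|T| <= _).
    by rewrite /rk mulSn addnC -addSn leq_add2r; exact: ltn_ord.
  by apply: leq_trans (leq_addr _ _); rewrite leq_mul2r lt orbT.
have I_gt1 : 1 < #|'I_m.+1| by rewrite card_ord.
have [s [C [/set0Pn[x1 x1s] colors dom]]] :=
  scarf (fun x => c (coord x)) t0 rk_inj I_gt1.
pose mu i := coord [arg min_(x < x1 in s) coord x i] i.
have muP i : (forall x, x \in s -> mu i <= coord x i) /\ exists2 x, x \in s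
  & coord x i = mu i.
  by rewrite /mu; case: arg_minnP => // x xs H; split => //; exists x.
(* Otherwise some grid point would exceed [mu i] in every coordinate of [C], the surplus being put
   on [iC], and no order of [C] would dominate it. *)
have mu_large : N < \sum_(i in C) (mu i).+1.
  rewrite ltnNge; apply/negP => le; have [iC iC_C _] := dom x1.
  pose f i := if i \in C then (mu i).+1 + (i == iC)
    * (N - \sum_(i in C) (mu i).+1) else 0.
  have /mkT[y yf] : \sum_i f i = N.
    rewrite /f -big_mkcond /= big_split /= [X in _ + X](bigD1 iC) //=.
    rewrite [X in _ + (_ + X)]big1 ?eqxx; last by move=> i /andP[_ /negbTE->].
    by rewrite mul1n addn0 subnKC.
  have [i iin H] := dom y; have [_ [x xs xmu]] := muP i.
  have := H x xs; rewrite leqNgt rk_lt // xmu yf /f iin; lia.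
exists (coord x1); split=> [//|i0].
have le_s x : x \in s -> forall i, (if i \in C then mu i else 0) <= coord x i.
  by move=> xs j; case: ifP => // _; case: (muP j) => H _; apply: H.
have cardC : #|C| <= m.+1 by apply: leq_trans (max_card _) _; rewrite card_ord.
(* The points of [s] lie above the corner given by [mu] on [C] and 0 elsewhere, and their sum [N]
   exceeds that of the corner by at most [m]; this confines each coordinate to a window of width
   [m]. *)
have up x j : x \in s -> coord x j < (if j \in C then mu j else 0) + m.+1.
  move=> xs; suff : coord x j + \sum_(i in C | i != j) mu i
    < (\sum_(i in C) mu i) + m.+1.
    rewrite [X in _ < X + _ -> _]big_mkcond [X in _ < X + _ -> _](bigD1 j) //=.
    rewrite -[X in _ < _ + X + _ -> _]big_mkcondr /=.
    under [X in _ < _ + X + _ -> _]eq_bigl do rewrite andbC.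
    lia.
  apply: leq_ltn_trans (_ : N < _).
    rewrite -(coord_sum x) [X in _ <= X](bigD1 j) //= leq_add2l.
    rewrite [X in X <= _]big_mkcondl [X in X <= _](eq_bigl (fun i => i != j))
      //.
    by apply: leq_sum => i _; apply: le_s.
  apply: leq_trans mu_large _; under eq_bigr do rewrite -addn1.
  by rewrite big_split /= sum1_card leq_add2l.
have [iC|iC] := boolP (i0 \in C); last first.
  by left; have := up x1 i0 x1s; rewrite (negbTE iC).
right; have [x xs cx] := colors i0 iC; exists (coord x) => // l.
have := up x l xs; have := up x1 l x1s; have := le_s x xs l;
  have := le_s x1 x1s l.
by case: ifP => _; split; lia.
Qed.

End Grid.

(** * Sequential runs and noisy choice rules *)

Local Open Scope ring_scope.

Section Runs.
Import fintype finset.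
Local Open Scope set_scope.
Variables n m : nat.
Implicit Types (ge : 'I_n -> rel {set 'I_m}) (M : {set 'I_m}) (t : nat).

(** The default value makes runs meaningful for arbitrary relations, where [best] may be empty; the
    growth bound runs markets on relations read off from a set. *)
Definition pick_set (DD : {set {set 'I_m}}) : {set 'I_m} :=
  odflt finset.set0 [pick B in DD].

Definition best (g : rel {set 'I_m}) M : {set {set 'I_m}} :=
  [set B in powerset M | [forall B' in powerset M, g B B']].

Definition sel g M := pick_set (best g M).

Fixpoint left_over ge t : {set 'I_m} :=
  if t is t'.+1 then
    if insub t' is Some i then left_over ge t' :\: sel (ge i) (left_over ge t')
    else left_over ge t'
  else [set: 'I_m].

Definition run ge : {ffun 'I_n -> {set 'I_m}} :=
  [ffun i : 'I_n => sel (ge i) (left_over ge i)].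

Definition allocated ge (j : 'I_m) := [exists i, j \in run ge i].

Let left_overE ge (x : {ffun 'I_n -> {set 'I_m}}) t : (t <= n)%N ->
  (forall i : 'I_n, (i < t)%N -> x i = run ge i) ->
  [set j | [forall l : 'I_n, (l < t)%N ==> (j \notin x l)]] = left_over ge t.
Proof.
elim: t => [_ _|t IH tn xE]; first by apply/setP => j; rewrite !inE;
  apply/forallP.
rewrite /=; case: insubP => [i ti Ei|]; last by rewrite tn.
rewrite -[X in X :\: _]IH 1?ltnW //; last by move=> l lt; apply: xE;
  rewrite ltnW.
apply/setP => j; rewrite !inE; apply/forallP/andP => [H|[ji /forallP H] l].
  split; first by have := H i; rewrite xE /= ?ffunE Ei ltnSn.
  by apply/forallP => l; apply/implyP => lt; have := H l; rewrite ltnW.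
apply/implyP; rewrite ltnS leq_eqVlt => /orP[/eqP E|]; last exact/implyP.
have -> : l = i by apply: val_inj; rewrite /= E.
by rewrite xE ?ffunE /= ?Ei.
Qed.

Lemma remaining_run ge i : remaining (run ge) i = left_over ge i.
Proof. by rewrite -(@left_overE ge (run ge) i) // ltnW. Qed.

(** Expresses the recursively defined run by a separate condition for each agent, the form in which
    a product over agents detects it. *)
Lemma eq_runP ge (x : {ffun 'I_n -> {set 'I_m}}) :
  reflect (forall i, sel (ge i) (remaining x i) = x i) (x == run ge).
Proof.
apply: (iffP eqP) => [-> i|H]; first by rewrite remaining_run ffunE.
apply/ffunP => -[i lt_i]; elim/ltn_ind: i lt_i => i IH lt_i.
rewrite -H ffunE; congr sel; rewrite -(@left_overE ge x i) // 1?ltnW //.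
by move=> [l ll] /= li; apply: IH.
Qed.

Lemma eq_run ge ge' : (forall i M, sel (ge i) M = sel (ge' i) M) ->
  run ge = run ge'.
Proof.
move=> E; apply/eqP/eq_runP => i.
by rewrite -E remaining_run [RHS]ffunE.
Qed.

Lemma eq_sel g g' M : g =2 g' -> sel g M = sel g' M.
Proof.
move=> E; congr pick_set; apply/setP => B; rewrite !inE.
by under eq_forallb do rewrite E.
Qed.

Lemma pick_setP DD : DD != finset.set0 -> pick_set DD \in DD.
Proof.
by move=> /set0Pn[B BD]; rewrite /pick_set; case: pickP => //= /(_ B);
  rewrite BD.
Qed.

End Runs.

Section NoiseRule.
Import fintype finset.
Local Open Scope set_scope.
Variables (R : realType) (n m L : nat).
Implicit Types (w : 'I_m -> R) (DD : {set {set 'I_m}}) (M B : {set 'I_m}).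

Definition noise := {ffun 'I_m -> 'I_L.+1}.
Implicit Types (xi : noise).

(** The successor keeps the noise at least 1, so that an item priced below [eta] is always worth
    taking in the perturbed market. *)
Definition score w xi B : R := \sum_(j in B) ((xi j).+1%:R - w j).

Definition maximizers (s : {set 'I_m} -> R) DD :=
  [set B in DD | [forall B' in DD, s B' <= s B]].

Definition lex_ge (u s : {set 'I_m} -> R) : rel {set 'I_m} := fun B B' =>
  (u B' < u B) || ((u B' == u B) && (s B' <= s B)).

Lemma maximizers_neq0 s DD : DD != finset.set0 ->
  maximizers s DD != finset.set0.
Proof.
move=> /set0Pn[B0 B0D]; apply/set0Pn.
case: (@arg_maxP _ R _ B0 (mem DD) s B0D) => B BD Bmax; exists B.
by rewrite inE [B \in _]BD; apply/forall_inP => B' /Bmax.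
Qed.

Let chosen w xi DD := pick_set (maximizers (score w xi) DD).

Let chosen_in w xi DD : DD != finset.set0 -> chosen w xi DD \in DD.
Proof. by move=> /(maximizers_neq0 (score w xi))/pick_setP;
  rewrite inE => /andP[]. Qed.

Let noise_prob w DD B : R := (\sum_xi (chosen w xi DD == B)%:R) /
  #|{: noise}|%:R.

Let card_noise_neq0 : #|{: noise}|%:R != 0 :> R.
Proof. by rewrite pnatr_eq0 -lt0n card_ffun card_ord expn_gt0. Qed.

Let noise_prob_ge0 w DD B : DD != finset.set0 -> 0 <= noise_prob w DD B.
Proof. by move=> _; rewrite divr_ge0 // sumr_ge0. Qed.

Let noise_prob_sum1 w DD : DD != finset.set0 ->
  \sum_(B in DD) noise_prob w DD B = 1.
Proof.
move=> D0; rewrite -mulr_suml exchange_big /= (eq_bigr (fun=> 1)) => [|xi _].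
  by rewrite sumr_const -[X in X / _](mulr_natl 1) mulr1 divff.
rewrite (bigD1 (chosen w xi DD)) ?chosen_in //= eqxx big1 ?addr0 // => B.
by rewrite eq_sym => /andP[_ /negbTE->].
Qed.

Let noise_prob_supp w DD B : DD != finset.set0 -> B \notin DD ->
  noise_prob w DD B = 0.
Proof.
move=> D0 BD; rewrite /noise_prob big1 ?mul0r // => xi _.
by case: eqP => // E; rewrite -E chosen_in in BD.
Qed.

Definition noise_rule w : choice_rule R m :=
  ChoiceRule (noise_prob_ge0 w) (noise_prob_sum1 w) (noise_prob_supp w).

Lemma best_lex (v : valuation R m) (p : prices R m) s M :
  best (lex_ge (utility v p) s) M = maximizers s (demand v p M).
Proof.
apply/setP => B; rewrite !inE -!(powersetE _ M);
  apply/andP/andP => -[BM /forall_inP H].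
  split.
    rewrite BM; apply/forall_inP => B' B'M.
    by have /orP[/ltW//|/andP[/eqP-> _]] := H B' B'M.
  apply/forall_inP => B'; rewrite !inE -!(powersetE _ M) =>
    /andP[B'M /forall_inP H'].
  have /orP[lt|/andP[_ ->]//] := H B' B'M.
  by have := H' B BM; rewrite leNgt lt.
have [BM' /forall_inP H'] := andP BM; split=> //; apply/forall_inP => B' B'M.
have := H' B' B'M; rewrite le_eqVlt /lex_ge => /orP[/eqP E|->//].
rewrite E eqxx H ?orbT // !inE -!(powersetE _ M) B'M E.
exact/forall_inP.
Qed.

Definition lex_market (v : 'I_n -> valuation R m) (p : prices R m) w
    (xi : 'I_n -> noise) : 'I_n -> rel {set 'I_m} :=
  fun i => lex_ge (utility (v i) p) (score w (xi i)).

(** Expanding the product of the agents' averages gives one average over joint noise of the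
    indicator of a deterministic run. Allocation probabilities thereby become frequencies of a set
    of runs, to which counting arguments apply. *)
Lemma alloc_prob_noise (v : 'I_n -> valuation R m) (p : prices R m) w j :
  alloc_prob v p (fun=> noise_rule w) j =
  (\sum_(xi : {ffun 'I_n -> noise}) (allocated (lex_market v p w xi) j)%:R)
  / #|{: {ffun 'I_n -> noise}}|%:R.
Proof.
rewrite /alloc_prob /outcome_prob /=.
have outcomeE (x : {ffun 'I_n -> {set 'I_m}}) :
    \prod_(i < n) noise_prob w (demand (v i) p (remaining x i)) (x i) =
    \sum_(xi : {ffun 'I_n -> noise})
      (x == run (lex_market v p w xi))%:R / #|{: {ffun 'I_n -> noise}}|%:R.
  rewrite /noise_prob big_split /= prodr_const card_ord -mulr_suml.
  have -> : #|{: {ffun 'I_n -> noise}}|%:R = #|{: noise}|%:R ^+ n :> R.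
    by rewrite -natrX card_ffun card_ord.
  rewrite exprVn; congr (_ / _).
  rewrite bigA_distr_bigA /=; apply: eq_bigr => xi _; rewrite -natr_prod;
    congr _%:R.
  have selE i : (chosen w (xi i) (demand (v i) p (remaining x i)) == x i) =
      (sel (lex_market v p w xi i) (remaining x i) == x i).
    by rewrite /sel best_lex.
  under eq_bigr do rewrite selE; apply/eqP.
  case: eq_runP => H.
    by rewrite big1 // => i _; rewrite H eqxx.
  have /existsP[i Hi] : [exists i,
    sel (lex_market v p w xi i) (remaining x i) != x i].
    rewrite -negb_forall; apply/negP => /forallP H'; apply: H => i; exact/eqP.
  by rewrite (bigD1 i) //= (negbTE Hi) mul0n.
rewrite (eq_bigr _ (fun x _ => outcomeE x)) exchange_big /= mulr_suml.
apply: eq_bigr => xi _; rewrite -mulr_suml; congr (_ / _).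
rewrite big_mkcond (bigD1 (run (lex_market v p w xi))) //= eqxx big1 ?addr0.
  by rewrite /allocated; case: ifP.
by move=> x /negbTE->; case: ifP.
Qed.

End NoiseRule.

(** * Median prices of a sample *)

Lemma card_exists_le (I T : finType) (P : I -> pred T) :
  (#|[set x | [exists i, P i x]]%SET| <= \sum_i #|[set x | P i x]%SET|)%N.
Proof.
rewrite -sum1_card (eq_bigr (fun i => \sum_x (P i x : nat))%N); last first.
  by move=> i _; rewrite -sum1_card [LHS]big_mkcond /=; apply: eq_bigr => x _;
    rewrite inE; case: (P i x).
rewrite exchange_big big_mkcond /=; apply: leq_sum => x _; rewrite inE.
by case: ifP => // /existsP[i Pix]; rewrite (bigD1 i) //= Pix.
Qed.

Lemma ler_sum_const (R : numDomainType) (I : finType) (A : {pred I}) (f : I ->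
  R) (c : R) (N : nat) :
  0 <= c -> (#|A| <= N)%N -> (forall i, i \in A -> `|f i| <= c) ->
    `|\sum_(i in A) f i| <= N%:R * c.
Proof.
move=> c0 AN H; apply: le_trans (ler_norm_sum _ _ _) _.
apply: le_trans (ler_sum _ H) _;
  rewrite sumr_const -[leLHS]mulr_natl ler_wpM2r //.
by rewrite ler_nat.
Qed.

Lemma card_set_ord m : #|{: {set 'I_m}}| = (2 ^ m)%N.
Proof. by rewrite -finset.cardsT -powersetT card_powerset finset.cardsT
  card_ord. Qed.

(** * Perturbed utilities and near ties *)

Section Perturbed.
Import fintype finset.
Local Open Scope set_scope.
Variables (R : realType) (n m L : nat).
Implicit Types (p q : 'I_m -> R) (B M : {set 'I_m}).

Definition perturbed_utility (v : {set 'I_m} ->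
  R) (eta : R) (xi : noise m L) p B : R :=
  v B + eta * (\sum_(j in B) (xi j).+1%:R) - \sum_(j in B) p j.

Definition util_ge (u : {set 'I_m} -> R) : rel {set 'I_m} := fun B B' =>
  u B' <= u B.

Definition perturbed_market (v : 'I_n -> valuation R m) (eta : R) p
    (xi : 'I_n -> noise m L) : 'I_n -> rel {set 'I_m} :=
  fun i => util_ge (perturbed_utility (v i) eta (xi i) p).

Lemma sel_max (u : {set 'I_m} -> R) M : sel (util_ge u) M \subset M /\
  forall B, B \subset M -> u B <= u (sel (util_ge u) M).
Proof.
have : best (util_ge u) M != finset.set0.
  have M0 : M \in powerset M by rewrite powersetE.
  apply/set0Pn; case: (@arg_maxP _ R _ M (mem (powerset M)) u M0).
  move=> B BM max_B; exists B; rewrite inE [B \in _]BM /=.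
  by apply/forall_inP => B' /max_B.
move=> /pick_setP; rewrite inE powersetE => /andP[sM /forall_inP H];
  split => // B BM.
by apply: H; rewrite powersetE.
Qed.

Section Sample.
Variables (v : 'I_n -> valuation R m) (eta : R).
Hypothesis eta_gt0 : 0 < eta.

Lemma perturbed_low_price (xi : 'I_n -> noise m L) p j : (0 < n)%N ->
  p j < eta ->
  allocated (perturbed_market v eta p xi) j.
Proof.
move=> n_gt0 pj; apply/existsP; exists (Ordinal n_gt0); rewrite ffunE /=.
pose u := perturbed_utility (v (Ordinal n_gt0)) eta (xi (Ordinal n_gt0)) p.
have [_ smax] := sel_max u [set: 'I_m].
rewrite -[sel _ _]/(sel (util_ge u) [set: 'I_m]); set S := sel _ _ in smax *.
apply/negPn/negP => jS; have := smax (j |: S) (finset.subsetT _).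
rewrite /u /perturbed_utility !big_setU1 //= => H.
have := value_mono (v (Ordinal n_gt0)) (finset.subsetUr [set j] S).
have : eta <= eta * (xi (Ordinal n_gt0) j).+1%:R by rewrite ler_peMr ?ler1n //
  ltW.
rewrite mulrDr in H; lra.
Qed.

Lemma perturbed_high_price (xi : 'I_n -> noise m L) p j : eta <= 1 ->
  (forall i, v i [set: 'I_m] + L.+1%:R < p j) ->
  ~~ allocated (perturbed_market v eta p xi) j.
Proof.
move=> eta_le1 pj; apply/existsPn => i; rewrite ffunE.
pose u := perturbed_utility (v i) eta (xi i) p.
set M := left_over _ _; rewrite -[sel _ _]/(sel (util_ge u) M).
have [sM smax] := sel_max u M; set S := sel _ _ in sM smax *; apply/negP => jS.
have := smax (S :\ j) (fintype.subset_trans (finset.subD1set _ _) sM).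
rewrite /u /perturbed_utility !(big_setD1 j jS) /= => H.
have := value_mono (v i) (finset.subsetT S).
have : eta * (xi i j).+1%:R <= L.+1%:R.
  apply: le_trans (_ : 1 * (xi i j).+1%:R <= _); first by rewrite ler_wpM2r.
  by rewrite mul1r ler_nat ltn_ord.
have := pj i; have := value_ge0 (v i) (S :\ j); rewrite mulrDr in H; lra.
Qed.

Definition market_noise := {ffun 'I_n -> noise m L}.

Let near_tie p (c : R) (t : 'I_n * {set 'I_m} * {set 'I_m}) (xi : market_noise)
  :=
  (t.1.2 != t.2) &&
  (0 <= perturbed_utility (v t.1.1) eta (xi t.1.1) p t.1.2 -
        perturbed_utility (v t.1.1) eta (xi t.1.1) p t.2 <= c).

(** With all other noise coordinates fixed, a unit change of the noise on an item in exactly one of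
    the two bundles moves the utility difference by [eta > c]. So at most one of the [L + 1] values
    gives a near tie; [upd] resamples that coordinate injectively. *)
Let card_near_tie p c t : c < eta ->
  (#|[set xi | near_tie p c t xi]| * L.+1 <= #|{: market_noise}|)%N.
Proof.
move: t => [[i B] B'] ceta; rewrite /near_tie /=.
have [->|BB'] /= := eqVneq B B';
  first by rewrite (_ : [set _ | _] = finset.set0) ?cards0 //; apply/setP => x;
  rewrite !inE.
have [j jBB'] : exists j, (j \in B) != (j \in B').
  apply/existsP; apply: contraNT BB' => /existsPn H; apply/eqP/setP => j.
  by apply/eqP; rewrite -[_ == _]negbK H.
set E := [set _ | _].
pose upd (z : market_noise * 'I_L.+1) : market_noise :=
  [ffun i' => if i' == i then
  [ffun j' => if j' == j then z.2 else z.1 i j'] else z.1 i'].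
rewrite -[X in (_ * X)%N]card_ord -cardsT -cardsX.
rewrite -(card_in_imset (f := upd)) ?max_card // => -[xi t] [xi' t'].
rewrite !inE /= !andbT => /andP[lo hi] /andP[lo' hi'] E'.
have off i' j' : (i' != i) || (j' != j) -> xi i' j' = xi' i' j'.
  move=> ne; have := congr1 (fun f : market_noise => f i' j') E';
    rewrite !ffunE /=.
  by case: eqVneq ne => [->|] //= ne; rewrite !ffunE (negbTE ne).
have tt' : t = t'.
  by have := congr1 (fun f : market_noise => f i j) E';
    rewrite !ffunE !eqxx !ffunE eqxx.
have sumE (S : {set 'I_m}) : \sum_(l in S) (xi i l).+1%:R =
    \sum_(l in S) (xi' i l).+1%:R + (j \in S)%:R
      * ((xi i j)%:R - (xi' i j)%:R) :> R.
  have [jS|jS] := boolP (j \in S); last first.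
    rewrite mul0r addr0; apply: eq_bigr => l lS; rewrite off //.
    by apply/orP; right; apply: contraNneq jS => <-.
  rewrite !(bigD1 j jS) /= (eq_bigr (fun l => (xi' i l).+1%:R)) =>
    [|l /andP[_ lj]]; last by rewrite off // lj orbT.
  by rewrite -!natr1; ring.
have xij : xi i j = xi' i j.
  apply/val_inj/eqP; rewrite /= -(eqr_nat R) -subr_eq0.
  apply: contraTT isT => ne; have ge1 : 1 <= `|(xi i j)%:R - (xi' i j)%:R : R|.
    rewrite subr_eq0 eqr_nat in ne.
    case: (ltngtP (xi i j) (xi' i j)) ne => // lt _.
      by rewrite distrC ger0_norm ?subr_ge0 ?ler_nat 1?ltnW // lerBrDr addrC
        natr1 ler_nat.
    by rewrite ger0_norm ?subr_ge0 ?ler_nat 1?ltnW // lerBrDr addrC natr1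
      ler_nat.
  move: lo hi lo' hi'; rewrite /perturbed_utility !sumE.
  set a := \sum_(_ in B) (_).+1%:R; set b := \sum_(_ in B') (_).+1%:R.
  set d := (_ - _ : R) in ge1 *.
  have : eta <= `|eta * d| by rewrite normrM gtr0_norm // ler_peMr // ltW.
  by move: jBB'; case: (j \in B); case: (j \in B') => //= _;
    rewrite ler_normr => /orP[]; lra.
congr pair => //; apply/ffunP => i'; apply/ffunP => j'.
have [->|/negbTE ii] := eqVneq i' i; last by apply: off; rewrite ii.
by have [->//|jj] := eqVneq j' j; apply: off; rewrite jj orbT.
Qed.

(** If the runs differ, some agent facing some [M] selects [S] at [p] and [S'] at [q]. Optimality of
    each puts the utility difference at [p] between 0 and [2 * (m * rho)], a near tie. The union
    bound runs over agents and pairs of bundles. *)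
Lemma card_perturbed_diff p q (rho : R) j :
  (forall l, `|p l - q l| <= rho) -> 2 * (m%:R * rho) < eta ->
  (#|[set xi : market_noise | allocated (perturbed_market v eta p xi) j
        != allocated (perturbed_market v eta q xi) j]| * L.+1
    <= n * (2 ^ m * 2 ^ m) * #|{: market_noise}|)%N.
Proof.
move=> pq small; pose c := 2 * (m%:R * rho).
have sub : [set xi : market_noise | allocated (perturbed_market v eta p xi) j
        != allocated (perturbed_market v eta q xi) j] \subset
    [set xi | [exists t, near_tie p c t xi]].
  apply/fintype.subsetP => xi; rewrite !inE; apply: contraR => /existsPn H.
  rewrite /allocated (@eq_run _ _ _ (perturbed_market v eta q xi)) // => i M.
  pose up := perturbed_utility (v i) eta (xi i) p;
    pose uq := perturbed_utility (v i) eta (xi i) q.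
  have [sM smax] := sel_max up M; have [sM' smax'] := sel_max uq M.
  rewrite -[LHS]/(sel (util_ge up) M) -[RHS]/(sel (util_ge uq) M).
  set S := sel _ _ in sM smax *; set S' := sel _ _ in sM' smax' *.
  apply/eqP; have := H (i, S, S'); rewrite /near_tie /=; apply: contraR => ->.
  have dpq (B : {set 'I_m}) : `|\sum_(l in B) p l - \sum_(l in B) q l|
    <= m%:R * rho.
    rewrite -sumrB; apply: ler_sum_const => [|| l _]; last exact: pq.
      exact: le_trans (normr_ge0 _) (pq j).
    by apply: leq_trans (max_card _) _; rewrite card_ord.
  have := (smax S' sM', smax' S sM, dpq S, dpq S').
  rewrite /up /uq /c /perturbed_utility !ler_norml =>
    -[[[h1 h2] /andP[h3 h4]] /andP[h5 h6]].
  by apply/andP; split; lra.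
have le1 := leq_trans (subset_leq_card sub) (card_exists_le _).
have le2 : (\sum_t #|[set xi | near_tie p c t xi]| * L.+1 <=
    n * (2 ^ m * 2 ^ m) * #|{: market_noise}|)%N.
  apply: leq_trans (leq_sum _ _) _; first by move=> t _;
    apply: card_near_tie small.
  by rewrite sum_nat_const !card_prod !card_set_ord !card_ord mulnA.
by apply: leq_trans le2; rewrite -big_distrl leq_mul2r le1 orbT.
Qed.

End Sample.
End Perturbed.

Section PerturbedMedian.
Import fintype finset.
Local Open Scope set_scope.
Variables (R : realType) (k n m L : nat) (v : 'I_k -> 'I_n -> valuation R m).
Hypotheses (k_gt0 : (0 < k)%N) (n_gt0 : (0 < n)%N) (m_gt0 : (0 < m)%N).

Definition perturbed_freq (eta : R) (p : 'I_m -> R) (j : 'I_m) : R :=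
  (\sum_(a < k) \sum_(xi : market_noise n m L)
     (allocated (perturbed_market (v a) eta p xi) j)%:R)
  / (k%:R * #|{: market_noise n m L}|%:R).

Definition tie_weight : R := (n * (2 ^ m * 2 ^ m))%:R / L.+1%:R.

Definition price_bound : R :=
  \sum_(a < k) \sum_(i < n) v a i [set: 'I_m] + L.+2%:R.

Let noise_gt0 : 0 < #|{: market_noise n m L}|%:R :> R.
Proof. by rewrite ltr0n !card_ffun !card_ord !expn_gt0. Qed.

Let kR_gt0 : 0 < k%:R :> R. Proof. by rewrite ltr0n. Qed.

Lemma perturbed_freq_lipschitz eta (p q : 'I_m -> R) rho j : 0 < eta ->
  (forall l, `|p l - q l| <= rho) -> 2 * (m%:R * rho) < eta ->
  `|perturbed_freq eta p j - perturbed_freq eta q j| <= tie_weight.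
Proof.
move=> eta_gt0 pq small; rewrite /perturbed_freq -mulrBl normrM -sumrB.
rewrite [X in _ * X]gtr0_norm; last by rewrite invr_gt0 mulr_gt0.
rewrite ler_pdivrMr ?mulr_gt0 // mulrCA.
rewrite -[k in leRHS]card_ord; apply: ler_sum_const => // [|a _].
  by rewrite mulr_ge0 // /tie_weight divr_ge0.
rewrite -sumrB; apply: le_trans (ler_norm_sum _ _ _) _.
set D := [set xi : market_noise n m L | allocated
  (perturbed_market (v a) eta p xi) j
  != allocated (perturbed_market (v a) eta q xi) j].
rewrite [leLHS](_ : _ = #|D|%:R).
  rewrite /tie_weight mulrAC ler_pdivlMr // -!natrM ler_nat.
  exact: card_perturbed_diff pq small.
rewrite -sum1_card natr_sum [RHS]big_mkcond; apply: eq_bigr => xi _;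
  rewrite inE.
by do 2 case: (allocated _ _);
  rewrite ?subrr ?subr0 ?sub0r ?normrN ?normr0 ?normr1.
Qed.

Lemma exists_perturbed_median eta : 0 < eta <= 1 -> tie_weight < 1 / 2 ->
  exists p : 'I_m -> R, (forall j, 0 <= p j <= price_bound) /\
    forall j, `|perturbed_freq eta p j - 1 / 2| <= tie_weight.
Proof.
move=> /andP[eta_gt0 eta_le1] small.
have mR_gt0 : 0 < m%:R :> R by rewrite ltr0n.
have mR_ge1 : 1 <= m%:R :> R by rewrite ler1n.
(* Nearby grid points differ by at most [m] steps in each coordinate; with [rho = m * tau] the
   Lipschitz condition reads [eta / 2 < eta]. *)
pose tau : R := eta / (4 * (m%:R * m%:R)).
have tau_gt0 : 0 < tau by rewrite divr_gt0 // !mulr_gt0.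
have mmtau : m%:R * (m%:R * tau) = eta / 4 by rewrite /tau; field;
  rewrite gt_eqF.
have mtau : m%:R * tau < eta.
  have : 1 * (m%:R * tau) <= m%:R
    * (m%:R * tau) by rewrite ler_wpM2r // ltW // mulr_gt0.
  by rewrite mmtau; lra.
have pb_ge0 : 0 <= price_bound.
  by rewrite /price_bound addr_ge0 //; do 2 apply: sumr_ge0 => ? _;
    apply: value_ge0.
(* Coordinate [ord0] is the part of the total that is not spent on prices; with this [N] it can be
   at most [m] only if some price exceeds [price_bound]. *)
pose N := (Num.bound ((m%:R * price_bound + m%:R * tau) / tau)).+1.
have N_large : m%:R * price_bound + m%:R * tau < N%:R * tau.
  rewrite -ltr_pdivrMr // (lt_le_trans (archi_boundP _)) ?ler_nat //.
  by rewrite divr_ge0 ?(ltW tau_gt0) // addr_ge0 // mulr_ge0 // ltW.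
pose pr (x : 'I_m.+1 -> nat) (j : 'I_m) : R := (x (lift ord0 j))%:R * tau.
pose c (x : 'I_m.+1 -> nat) : 'I_m.+1 :=
  if [pick j | 1 / 2 < perturbed_freq eta (pr x) j] is Some j then lift ord0 j
    else ord0.
have [x0 [x0N H]] := sperner_grid N c m_gt0; exists (pr x0).
have near (x : 'I_m.+1 -> nat) j :
  (forall l, (x l <= x0 l + m /\ x0 l <= x l + m)%N) ->
    `|perturbed_freq eta (pr x) j - perturbed_freq eta (pr x0) j| <= tie_weight.
  move=> xx0; apply: (@perturbed_freq_lipschitz _ _ _ (m%:R * tau)) => // [l|];
    last by rewrite mmtau; lra.
  rewrite /pr -mulrBl normrM (gtr0_norm tau_gt0) ler_wpM2r ?(ltW tau_gt0) //.
  have [] := xx0 (lift ord0 l); rewrite -!(ler_nat R) !natrD ler_norml => h1 h2.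
  by apply/andP; split; lra.
have freq1 (p : 'I_m -> R) j : p j < eta -> perturbed_freq eta p j = 1.
  move=> pj; rewrite /perturbed_freq
    (eq_bigr (fun=> #|{: market_noise n m L}|%:R)).
    by rewrite sumr_const card_ord -[X in X / _]mulr_natl divff // mulf_neq0 //
      gt_eqF.
  move=> a _; rewrite (eq_bigr (fun=> 1)) ?sumr_const // => xi _.
  by rewrite perturbed_low_price.
(* Near the facet of [j] the price is below [eta], so the item is always taken; elsewhere a nearby
   point carries the label of [j]. *)
have lower j : 1 / 2 - tie_weight <= perturbed_freq eta (pr x0) j.
  have [le_m|[x cx xx0]] := H (lift ord0 j).
    rewrite freq1; last first.
      by apply: le_lt_trans mtau; rewrite /pr ler_wpM2r ?ler_nat // ltW.
    have : 0 <= tie_weight by rewrite /tie_weight divr_ge0.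
    by lra.
  move: cx; rewrite /c; case: pickP => // j' gt /lift_inj E; rewrite -E.
  by have := near x j' xx0; rewrite ler_norml => /andP[]; lra.
(* Above the bound the item would never be taken, against the positive lower bound on its
   frequency. *)
have upper_price j : pr x0 j <= price_bound.
  rewrite leNgt; apply/negP => gt; have := lower j.
  rewrite {1}/perturbed_freq big1 ?mul0r; first by lra.
  move=> a _; rewrite big1 // => xi _.
  rewrite (negbTE (perturbed_high_price _ _ _)) // => i; apply: le_lt_trans gt.
  rewrite /price_bound; apply: lerD; last by rewrite ler_nat.
  rewrite (bigD1 a) //= (bigD1 i) //= -addrA lerDl addr_ge0 //.
    by apply: sumr_ge0 => ? _; apply: value_ge0.
  by do 2 apply: sumr_ge0 => ? _; apply: value_ge0.
split=> j; first by rewrite upper_price mulr_ge0 // ltW.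
have := lower j; have [le_m|[x cx xx0]] := H ord0.
  have : N%:R * tau <= m%:R * price_bound + m%:R * tau.
    rewrite -x0N big_ord_recl natrD mulrDl addrC natr_sum mulr_suml;
      apply: lerD.
      apply: le_trans (ler_norm _) _; rewrite -[X in X%:R * _]card_ord.
      apply: ler_sum_const => // l _; rewrite ger0_norm;
        first exact: upper_price.
      by rewrite mulr_ge0 // ltW.
    by rewrite ler_wpM2r ?ler_nat // ltW.
  by rewrite leNgt N_large.
move: cx; rewrite /c; case: pickP => // /(_ j) /negbT; rewrite -leNgt => le _.
by have := near x j xx0; rewrite !ler_norml => /andP[h1 h2] h3; apply/andP;
  split; lra.
Qed.

End PerturbedMedian.

Lemma finite_gap (R : realFieldType) (I : finType) (f : I -> R) :
  exists2 g : R, 0 < g & forall i, f i != 0 -> g <= `|f i|.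
Proof.
exists (\big[Order.min/1]_(i | f i != 0) `|f i|) => [|i fi].
  by apply: (big_ind (fun x => 0 < x)) => // [x y x0 y0|i fi];
    rewrite ?lt_min ?x0 ?normr_gt0.
by rewrite (bigD1 i) //= ge_min lexx.
Qed.

Lemma box_cluster_point (R : realType) (m : nat) (f : nat -> 'I_m ->
  R) (H : R) :
  (forall q j, 0 <= f q j <= H) ->
  exists p : 'I_m -> R, (forall j, 0 <= p j) /\
    forall rho, 0 < rho -> forall N, exists2 q, (N <= q)%N
      & forall j, `|f q j - p j| < rho.
Proof.
move=> fH; have K : @compact (matrix R 1 m) [set v :
  'rV[R]_m | forall i, `[0, H]%classic (v ord0 i)]%classic.
  by apply: (@rV_compact R m (fun=> `[0, H]%classic)) => i;
    exact: segment_compact.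
pose F := ((fun q => \row_j f q j) @ \oo)%classic.
have [|p [pK pc]] := K F _.
  by exists 0%N => // q _ i; rewrite /= mxE in_itv /= fH.
exists (p ord0); split=> [j|rho rho0 N]; first by have := pK j;
  rewrite /= in_itv /= => /andP[].
have [|_ [[q Nq <-] qp]] := pc
  [set \row_j f q j | q in [set q | (N <= q)%N]]%classic (ball p rho) _
  (nbhsx_ballx p rho rho0).
  by exists N => // q Nq; exists q.
exists q => // j; have [_ /(_ ord0 j)] := qp.
by rewrite mxE distrC.
Qed.

Section LexLimit.
Import fintype finset.
Local Open Scope set_scope.
Variables (R : realType) (k n m L : nat) (v : 'I_k -> 'I_n -> valuation R m).
Hypotheses (k_gt0 : (0 < k)%N) (n_gt0 : (0 < n)%N) (m_gt0 : (0 < m)%N).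

(* [p + eta w] with a small enough [eta] breaks ties at [p] as [w] does. *)
Lemma exists_lex_median : tie_weight R n m L < 1 / 2 ->
  exists (p : prices R m) (w : 'I_m -> R), forall j : 'I_m,
    `|(\sum_(a < k) alloc_prob (v a) p (fun=> noise_rule L w) j) / k%:R - 1 / 2|
      <= tie_weight R n m L.
Proof.
move=> small.
have eta01 q : 0 < (q.+1%:R^-1 : R)
  <= 1 by rewrite invr_gt0 ltr0n /= invf_le1 ?ltr0n // ler1n.
have ex q := exists_perturbed_median v k_gt0 n_gt0 m_gt0 (eta01 q) small.
have [x xP] := choice ex.
have [p0 [p0_ge0 p0c]] := box_cluster_point (fun q => (xP q).1).
pose p := Prices p0_ge0.
have [g g_gt0 gP] := finite_gap (fun t :
  'I_k * 'I_n * {set 'I_m} * {set 'I_m} =>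
  utility (v t.1.1.1 t.1.1.2) p t.1.2 - utility (v t.1.1.1 t.1.1.2) p t.2).
have mL_gt0 : 0 < m%:R * L.+1%:R :> R by rewrite -natrM ltr0n muln_gt0 m_gt0.
have mR_gt0 : 0 < m%:R :> R by rewrite ltr0n.
pose rho := g / (8 * m%:R); pose N := Num.bound (8 * (m%:R * L.+1%:R) / g).
have rho_gt0 : 0 < rho by rewrite divr_gt0 // mulr_gt0.
have [q Nq xq] := p0c rho rho_gt0 N.
pose eta : R := q.+1%:R^-1; have /andP[eta_gt0 _] := eta01 q.
have eta_small : eta * (m%:R * L.+1%:R) <= g / 8.
  rewrite /eta mulrC ler_pdivrMr ?ltr0n // mulrAC ler_pdivlMr // -ler_pdivrMl
    //.
  rewrite mulrC [X in X / _]mulrC; apply: ltW;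
    apply: lt_le_trans (archi_boundP _) _.
    by rewrite divr_ge0 ?mulr_ge0 ?ltW.
  by rewrite ler_nat ltnW.
(* Only the prices have to converge: [w] is the rescaled offset at a single late index [q], and no
   limit of it is taken. Scores contribute at most [g / 4] each, so they cannot reverse a utility
   gap of at least [g]. *)
pose w j : R := (x q j - p0 j) / eta; exists p, w => j.
have perturbE a i (xi : noise m L) B :
  perturbed_utility (v a i) eta xi (x q) B =
    utility (v a i) p B + eta * score w xi B.
  rewrite /perturbed_utility /utility /score sumrB mulrBr
    -[\sum_(_ in _) w _]mulr_suml.
  by rewrite sumrB; field; rewrite gt_eqF.
have score_small (xi : noise m L) B : `|eta * score w xi B| <= g / 4.
  rewrite /score sumrB mulrBr; apply: le_trans (ler_normB _ _) _.
  have -> : g / 4 = g / 8 + m%:R * rho by rewrite /rho; field; rewrite gt_eqF.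
  have cardB : (#|B| <= m)%N by apply: leq_trans (max_card _) _;
    rewrite card_ord.
  apply: lerD.
    apply: le_trans eta_small; rewrite normrM gtr0_norm // ler_wpM2l
      ?(ltW eta_gt0) //.
    by apply: ler_sum_const => // l _; rewrite ger0_norm // ler_nat ltn_ord.
  rewrite mulr_sumr; apply: ler_sum_const => //; first exact: ltW.
  by move=> l _; rewrite /w mulrC mulfVK ?gt_eqF // ltW.
have sameE a i (xi : noise m L) :
  util_ge (perturbed_utility (v a i) eta xi (x q)) =2
    lex_ge (utility (v a i) p) (score w xi).
  move=> B B'; rewrite /util_ge !perturbE /lex_ge.
  have := score_small xi B; have := score_small xi B';
    rewrite !ler_norml => /andP[h1 h2] /andP[h3 h4].
  have := gP (a, i, B, B'); rewrite /= subr_eq0 => gap.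
  case: (ltgtP (utility (v a i) p B') (utility (v a i) p B)) gap => [lt|lt|->].
  - by rewrite ger0_norm ?subr_ge0 ?(ltW lt) //= => /(_ isT) ?; apply/idP; lra.
  - by rewrite distrC ger0_norm ?subr_ge0 ?(ltW lt) //= => /(_ isT) ?;
    apply/negbTE; rewrite -ltNge; lra.
  - by move=> _ /=; rewrite lerD2l ler_pM2l.
have <- : perturbed_freq L v eta (x q) j =
    (\sum_(a < k) alloc_prob (v a) p (fun=> noise_rule L w) j) / k%:R.
  rewrite /perturbed_freq invfM mulrA mulrAC; congr (_ / _); rewrite mulr_suml.
  apply: eq_bigr => a _; rewrite alloc_prob_noise; congr (_ / _).
  apply: eq_bigr => xi _; rewrite /allocated
    (@eq_run _ _ _ (lex_market (v a) p w xi)) // => i M.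
  exact/eq_sel/sameE.
exact: (xP q).2.
Qed.

End LexLimit.

(** * Sign patterns realized by rationally parametrized solutions *)

Section RationalRepresentative.
Variables (R : realType) (m N : nat) (E : 'M[R]_(m, N)).

Definition kept (K : {set 'I_N}) : 'M[R]_N := diag_mx (\row_t (t \in K)%:R).

(** A particular solution of the equations indexed by [K] plus an element of the kernel. For fixed
    [K] and [z] it is affine in [a], hence measurable. *)
Definition solution (K : {set 'I_N}) (z : 'rV[rat]_m) (a : 'rV[R]_N) :
  'rV[R]_m :=
  a *m kept K *m pinvmx (E *m kept K) + map_mx ratr z *m kermx (E *m kept K).

(** Let [K] collect the equations that [p] satisfies; then [p] is a solution with a real kernel
    parameter [Z]. A rational [z] close to [Z] keeps these equations exactly and moves the others by
    less than their least distance from zero. *)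
Lemma solution_sign (a : 'rV[R]_N) (p : 'rV[R]_m) : exists K z, forall t,
  Num.sg ((solution K z a *m E) 0 t - a 0 t) = Num.sg ((p *m E) 0 t - a 0 t).
Proof.
pose K : {set 'I_N} := [set t | (p *m E) 0 t == a 0 t]%SET; exists K.
have mul_kept (b : 'rV[R]_N) t : (b *m kept K) 0 t = b 0 t * (t \in K)%:R.
  by rewrite /kept mul_mx_diag !mxE.
have keptE (b : 'rV[R]_N) t : t \in K -> (b *m kept K) 0 t = b 0 t.
  by move=> tK; rewrite mul_kept tK mulr1.
have pEK : p *m (E *m kept K) = a *m kept K.
  apply/rowP => t; rewrite mulmxA !mul_kept inE.
  by case: eqP => [->//|_]; rewrite !mulr0.
have asub : (a *m kept K <= E *m kept K)%MS by rewrite -pEK submxMl.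
pose p0 := a *m kept K *m pinvmx (E *m kept K).
have /submxP[Z ZE] : (p - p0 <= kermx (E *m kept K))%MS.
  by apply/sub_kermxP; rewrite mulmxBl pEK mulmxKpV // subrr.
set kE := kermx (E *m kept K) in ZE *.
have [g g_gt0 gP] := finite_gap (fun t => (p *m E) 0 t - a 0 t).
pose T := \sum_t \sum_l `|(kE *m E) l t|.
have T_ge0 : 0 <= T by do 2 apply: sumr_ge0 => ? _.
pose rho := g / (T + 1).
have rho_gt0 : 0 < rho by rewrite divr_gt0 // ltr_wpDl.
have [z zZ] : exists z : 'rV[rat]_m, forall l, `|ratr (z 0 l) - Z 0 l| <= rho.
  have rat_near (r : R) : exists y : rat, `|ratr y - r| <= rho.
    have [|y] := @rat_in_itvoo R (r - rho) (r + rho); first by lra.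
    by rewrite in_itv /= => /andP[h1 h2]; exists y; rewrite ler_norml;
      apply/andP; split; lra.
  have [f fP] := choice (fun l => rat_near (Z 0 l)).
  by exists (\row_l f l) => l; rewrite mxE.
exists z => t; set p' := solution _ _ _.
have p'E : p' = p + (map_mx ratr z - Z) *m kE.
  by rewrite mulmxBl -ZE opprB addrCA [p + (p0 - p)]addrC subrK addrC.
have [tK|tK] := boolP (t \in K).
  have key : p' *m (E *m kept K) = p *m (E *m kept K).
    by rewrite p'E mulmxDl -(mulmxA _ kE) /kE mulmx_ker mulmx0 addr0.
  by rewrite -(keptE (p' *m E) t tK) -(keptE (p *m E) t tK) -2!mulmxA key.
have small : `|((p' *m E) 0 t - a 0 t) - ((p *m E) 0 t - a 0 t)| < g.
  rewrite opprB addrA subrK p'E mulmxDl mxE addrC addKr -mulmxA mxE.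
  apply: le_lt_trans (ler_norm_sum _ _ _) _.
  apply: le_lt_trans (_ : rho * T < _); last first.
    by rewrite /rho mulrAC ltr_pdivrMr ?ltr_wpDl // ltr_pM2l // ltrDl.
  rewrite /T (bigD1 t) //= mulrDr;
    apply: le_trans (_ : rho * (\sum_l `|(kE *m E) l t|) <= _).
    rewrite mulr_sumr; apply: ler_sum => l _; rewrite normrM ler_wpM2r //.
    by rewrite !mxE; exact: zZ.
  by rewrite lerDl mulr_ge0 ?(ltW rho_gt0) //; do 2 apply: sumr_ge0 => ? _.
have ne : (p *m E) 0 t - a 0 t != 0 by rewrite subr_eq0; rewrite inE in tK.
have := gP t ne; move: small; set y := _ - a 0 t; set y' := _ - a 0 t.
rewrite -/y' in ne; rewrite ltr_norml => /andP[h1 h2].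
case: (ltgtP y' 0) ne => [lt|lt|->]; rewrite ?eqxx // => _.
  by rewrite ltr0_norm // => h3; rewrite !ltr0_sg //; lra.
by rewrite gtr0_norm // => h3; rewrite !gtr0_sg //; lra.
Qed.

End RationalRepresentative.

(** * Countably many candidates *)

Section Candidates.
Import fintype finset.
Local Open Scope set_scope.
Variables (R : realType) (k n m L : nat).
Implicit Types (v : 'I_k -> 'I_n -> valuation R m) (w : 'I_m -> R).

(** The summand ['I_m] records the sign of each price, so that a representative with equal signs is
    again nonnegative. *)
Definition tie_index : finType :=
  (('I_k * 'I_n * {set 'I_m} * {set 'I_m}) + 'I_m)%type.

Definition tie_matrix : 'M[R]_(m, #|tie_index|) :=
  \matrix_(j < m, t < #|tie_index|)
  match (enum_val t : tie_index) with
  | inl abb => (j \in abb.1.2)%:R - (j \in abb.2)%:R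
  | inr l => (j == l)%:R
  end.

Definition tie_values v : 'rV[R]_#|tie_index| := \row_(t < #|tie_index|)
  match (enum_val t : tie_index) with
  | inl abb => v abb.1.1.1 abb.1.1.2 abb.1.2 - v abb.1.1.1 abb.1.1.2 abb.2
  | inr _ => 0
  end.

(** A noise rule depends on [w] only through its score comparisons, so finitely many codes stand for
    all real [w]. *)
Definition rule_code : finType :=
  {ffun noise m L * {set 'I_m} * {set 'I_m} -> bool}.

Definition code_of w : rule_code :=
  [ffun t => score w t.1.1 t.2 <= score w t.1.1 t.1.2].

Definition rep_code (c : rule_code) : 'I_m -> R :=
  xget (fun=> 0) [set w | code_of w = c]%classic.

Lemma score_rep_code w xi B B' :
  (score (rep_code (code_of w)) xi B' <= score (rep_code (code_of w)) xi B) =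
  (score w (xi : noise m L) B' <= score w xi B).
Proof.
have E : code_of (rep_code (code_of w)) = code_of w.
  exact: (@xgetPex _ (fun=> 0) [set w' | code_of w' = code_of w]%classic
    (ex_intro _ w erefl)).
by have := congr1 (fun c : rule_code => c (xi, B, B')) E; rewrite !ffunE.
Qed.

Definition candidate_index :=
  ({set 'I_#|tie_index|} * 'rV[rat]_m * rule_code)%type.

(* The kernel parameter is rational, which makes the candidates countable. *)
Definition candidate_price (q : candidate_index) v (j : 'I_m) : R :=
  Num.max 0 (solution tie_matrix q.1.1 q.1.2 (tie_values v) 0 j).

Lemma candidate_price_ge0 q v j : 0 <= candidate_price q v j.
Proof. by rewrite le_max lexx. Qed.

Definition candidate (q : candidate_index) v :
    prices R m * ('I_n -> choice_rule R m) :=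
  (Prices (candidate_price_ge0 q v), fun=> noise_rule L (rep_code q.2)).

Lemma candidate_complete v : (0 < k)%N -> (0 < n)%N -> (0 < m)%N ->
  tie_weight R n m L < 1 / 2 -> exists q, forall j,
  `|(\sum_a alloc_prob (v a) (candidate q v).1 (candidate q v).2 j) / k%:R
    - 1 / 2|
    <= tie_weight R n m L.
Proof.
move=> k_gt0 n_gt0 m_gt0 small.
have [p [w pw]] := exists_lex_median v k_gt0 n_gt0 m_gt0 small.
have [K [z Kz]] := solution_sign tie_matrix (tie_values v) (\row_j p j).
pose q : candidate_index := (K, z, code_of w); exists q => j.
set sol := solution _ _ _ _ in Kz.
have tieE (r : 'rV[R]_m) (t : tie_index) : (r *m tie_matrix) 0 (enum_rank t) =
    match t with
    | inl abb => \sum_(l in abb.1.2) r 0 l - \sum_(l in abb.2) r 0 l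
    | inr l => r 0 l
    end.
  rewrite mxE; under eq_bigr do rewrite mxE enum_rankK.
  case: t => [[[ai B] B']|l] /=.
    under eq_bigr do rewrite mulrBr; rewrite sumrB.
    by congr (_ - _); rewrite [RHS]big_mkcond; apply: eq_bigr => l _;
      case: (_ \in _); rewrite ?mulr1 ?mulr0.
  by rewrite (bigD1 l) //= eqxx mulr1 big1 ?addr0 // => i /negbTE->;
    rewrite mulr0.
have sol_ge0 l : 0 <= sol 0 l.
  have := Kz (enum_rank (inr l : tie_index));
    rewrite !tieE !mxE enum_rankK !subr0.
  by move=> E; rewrite -sgr_ge0 E sgr_ge0 price_ge0.
have priceE l : candidate_price q v l = sol 0 l by apply/max_idPr;
  exact: sol_ge0.
have sgE a i B B' : Num.sg (utility (v a i) (candidate q v).1 B'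
  - utility (v a i) (candidate q v).1 B)
    = Num.sg (utility (v a i) p B' - utility (v a i) p B).
  have diffE (r : prices R m) : utility (v a i) r B' - utility (v a i) r B =
      \sum_(l in B) r l - \sum_(l in B') r l - (v a i B - v a i B').
    by rewrite /utility; move: (v a i B) (v a i B') => x y; ring.
  have sumE (S : {set 'I_m}) (r : prices R m) (s : 'rV[R]_m) :
      (forall l, r l = s 0 l) -> \sum_(l in S) r l = \sum_(l in S) s 0 l.
    by move=> rs; apply: eq_bigr => l _; exact: rs.
  have := Kz (enum_rank (inl (a, i, B, B') : tie_index)).
  rewrite !tieE [tie_values v 0 _]mxE enum_rankK /= => E.
  have pE l : p l = (\row_l p l) 0 l by rewrite mxE.
  rewrite !diffE (sumE B (candidate q v).1 sol priceE)
    (sumE B' (candidate q v).1 sol priceE) E.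
  by rewrite (sumE B p _ pE) (sumE B' p _ pE).
suff allocE a : alloc_prob (v a) (candidate q v).1 (candidate q v).2 j =
    alloc_prob (v a) p (fun=> noise_rule L w) j.
  by under eq_bigr do rewrite allocE; exact: pw.
rewrite /= !alloc_prob_noise; congr (_ / _); apply: eq_bigr => xi _.
rewrite /allocated (@eq_run _ _ _ (lex_market (v a) p w xi)) // => i M.
apply: eq_sel => B B'; rewrite /lex_market /lex_ge score_rep_code.
have := sgE a i B B'; rewrite /=; set u := utility _ _;
  set u' := utility _ _ => E.
have ltE : (u B' < u B) = (u' B' < u' B).
  by rewrite -subr_lt0 -sgr_lt0 E sgr_lt0 subr_lt0.
have eqE : (u B' == u B) = (u' B' == u' B).
  by rewrite -subr_eq0 -sgr_eq0 E sgr_eq0 subr_eq0.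
by rewrite ltE eqE.
Qed.

End Candidates.

(** * Shattering and growth *)

Section Shattering.
Import fintype finset.
Local Open Scope set_scope.
Local Open Scope nat_scope.
Variable T : finType.
Implicit Types (F : {set {set T}}) (J K : {set T}).

Definition shatters F J :=
  [forall K in powerset J, [exists f in F, f :&: J == K]].

Lemma shattersP F J : reflect
  (forall K, K \subset J -> exists2 f, f \in F & f :&: J = K) (shatters F J).
Proof.
apply: (iffP forall_inP) => H K;
  first rewrite -powersetE => /H/exists_inP[f fF /eqP]; first by exists f.
by rewrite powersetE => /H[f fF fK]; apply/exists_inP; exists f => //;
  apply/eqP.
Qed.

Lemma shattersS F F' J : F \subset F' -> shatters F J -> shatters F' J.
Proof.
move=> /fintype.subsetP FF' /shattersP H; apply/shattersP => K /H[f fF fK].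
by exists f => //; apply: FF'.
Qed.

(* Pajor: a family of sets shatters at least as many sets as it has members. *)
Lemma pajor F : #|F| <= #|[set J | shatters F J]|.
Proof.
move: {2}#|F| (leqnn #|F|) => N; elim: N F => [|N IH] F cF.
  by rewrite (leq_trans cF).
have [/card_le1_eqP F1|] := leqP #|F| 1.
  have [->|/set0Pn[f fF]] := eqVneq F finset.set0; first by rewrite cards0.
  apply: (@leq_trans 1); first by rewrite leqNgt;
    apply/negP => /card_gt1P[a [b [aF bF]]]; rewrite (F1 a b) ?eqxx.
  apply/card_gt0P; exists finset.set0; rewrite inE; apply/shattersP => K.
  by rewrite finset.subset0 => /eqP->; exists f => //; rewrite finset.setI0.
move=> /card_gt1P[f [g [fF gF fg]]].
have [x xfg] : exists x, (x \in f) != (x \in g).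
  apply/existsP; apply: contraNT fg => /existsPn H; apply/eqP/setP => x.
  by apply/eqP; rewrite -[_ == _]negbK H.
pose F0 := [set h in F | x \notin h]; pose F1 := [set h in F | x \in h].
have F0F : F0 \subset F by apply/fintype.subsetP => h; rewrite inE => /andP[].
have F1F : F1 \subset F by apply/fintype.subsetP => h; rewrite inE => /andP[].
have cF01 : #|F| = #|F0| + #|F1|.
  rewrite -(cardsID [set h : {set T} | x \in h] F) addnC; congr (_ + _);
  by apply: eq_card => h; rewrite !inE // andbC.
have [F0_gt0 F1_gt0] : 0 < #|F0| /\ 0 < #|F1|.
  case xf: (x \in f) xfg; case xg: (x \in g) => //= _.
    by split; apply/card_gt0P; [exists g|exists f]; rewrite inE ?fF ?gF ?xf ?xg.
  by split; apply/card_gt0P; [exists f|exists g]; rewrite inE ?fF ?gF ?xf ?xg.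
have IH0 : #|F0| <= #|[set J | shatters F0 J]| by apply: IH; lia.
have IH1 : #|F1| <= #|[set J | shatters F1 J]| by apply: IH; lia.
set A := [set J | shatters F0 J] in IH0;
  set B := [set J | shatters F1 J] in IH1.
have xA J : J \in A -> x \notin J.
  rewrite inE => /shattersP H; apply/negP => xJ.
  have sJ : [set x] \subset J by rewrite finset.sub1set.
  have [h] := H _ sJ; rewrite inE => /andP[_ xh] E.
  by have := finset.set11 x; rewrite -E inE (negbTE xh).
have xB J : J \in B -> x \notin J.
  rewrite inE => /shattersP H; apply/negP => xJ.
  have [h] := H finset.set0 (finset.sub0set _); rewrite inE => /andP[_ xh] E.
  by have := finset.in_set0 x; rewrite -E inE xh xJ.
pose C := [set x |: J | J in A :&: B].
have cC : #|C| = #|A :&: B|.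
  rewrite card_in_imset // => J J'; rewrite !inE => /andP[JA _] /andP[JA' _] E.
  have {}JA : x \notin J by apply: xA; rewrite inE.
  have {}JA' : x \notin J' by apply: xA; rewrite inE.
  by rewrite -(finset.setU1K JA) -(finset.setU1K JA') E.
have disj : [disjoint A :|: B & C].
  apply/pred0P => J /=; apply/negP => /andP[JAB /imsetP[J' _ E]].
  have : x \in J by rewrite E finset.setU11.
  by apply/negP; move: JAB; rewrite finset.in_setU => /orP[/xA|/xB].
have sub : (A :|: B) :|: C \subset [set J | shatters F J].
  apply/fintype.subsetP => J; rewrite finset.in_setU => /orP[|/imsetP[J' + ->]].
    by rewrite !inE => /orP[]; apply: shattersS.
  rewrite !inE => /andP[/[dup] JA /shattersP H0 /shattersP H1].
  have xJ' : x \notin J' by apply: xA; rewrite inE.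
  apply/shattersP => K KxJ; have KJ :
    K :\ x \subset J' by rewrite finset.subDset.
  have [xK|xK] := boolP (x \in K).
    have [h hF1 E] := H1 _ KJ; exists h; first by apply: (fintype.subsetP F1F).
    apply/setP => y; have := congr1 (fun S : {set T} => y \in S) E;
      rewrite !inE.
    by case: eqVneq => [->|] //= _; rewrite xK andbT; move: hF1;
      rewrite inE => /andP[].
  have [h hF0 E] := H0 _ KJ; exists h; first by apply: (fintype.subsetP F0F).
  apply/setP => y; have := congr1 (fun S : {set T} => y \in S) E; rewrite !inE.
  by case: eqVneq => [->|] //= _; rewrite (negbTE xK); move: hF0;
    rewrite inE => /andP[_ /negbTE->].
apply: leq_trans (subset_leq_card sub).
by rewrite cardsU (disjoint_setI0 disj) cards0 subn0 cC cardsUI cF01 leq_add.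
Qed.

Lemma card_small_sets d : #|[set J : {set T} | #|J| <= d]| <= #|T|.+1 ^ d.
Proof.
pose g (f : {ffun 'I_d -> option T}) := [set x | [exists i, f i == Some x]].
have sub : [set J : {set T} | #|J| <= d] \subset g @:
  [set: {ffun 'I_d -> option T}].
  apply/fintype.subsetP => J; rewrite inE => Jd; apply/imsetP.
  exists [ffun i : 'I_d => nth None (map Some (enum J)) i] => //.
  apply/setP => x; rewrite inE; apply/idP/existsP => [xJ|[i]].
    have lt : index x (enum J) < size (enum J) by rewrite index_mem mem_enum.
    have ltd : index x (enum J) < d by apply: leq_trans lt _; rewrite -cardE.
    exists (Ordinal ltd); rewrite ffunE /= (nth_map x) // nth_index //.
    by rewrite mem_enum.
  rewrite ffunE; have [lt|ge] := ltnP i (size (enum J)).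
    by rewrite (nth_map x) // => /eqP[<-]; rewrite -mem_enum mem_nth.
  by rewrite nth_default // size_map.
apply: leq_trans (subset_leq_card sub) _;
  apply: leq_trans (leq_imset_card _ _) _.
by rewrite cardsT card_ffun card_option card_ord.
Qed.

Lemma sauer F d : (forall J, shatters F J -> #|J| <= d) -> #|F| <= #|T|.+1 ^ d.
Proof.
move=> H; apply: leq_trans (pajor F) _; apply: leq_trans (card_small_sets d).
by apply/subset_leq_card/fintype.subsetP => J; rewrite !inE; apply: H.
Qed.

End Shattering.

(** * Lexicographic comparisons and their dimension *)

Section LexOrder.
Variable R : realDomainType.
Implicit Types x y : R.

Definition lex_ge0 x y := (0 < x) || ((x == 0) && (0 <= y)).

Lemma lex_ge0D x1 y1 x2 y2 : lex_ge0 x1 y1 -> lex_ge0 x2 y2 ->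
  lex_ge0 (x1 + x2) (y1 + y2).
Proof.
rewrite /lex_ge0 => /orP[x1_gt0|/andP[/eqP-> y1_ge0]]
  /orP[x2_gt0|/andP[/eqP-> y2_ge0]].
- by rewrite addr_gt0.
- by rewrite addr0 x1_gt0.
- by rewrite add0r x2_gt0.
- by rewrite addr0 eqxx addr_ge0 ?orbT.
Qed.

Lemma lex_ge0_sum (I : finType) (P : pred I) (x y : I -> R) :
  (forall i, P i -> lex_ge0 (x i) (y i)) ->
  lex_ge0 (\sum_(i | P i) x i) (\sum_(i | P i) y i).
Proof.
move=> H; elim/big_ind2: _ => [|x1 x2 y1 y2|i /H//].
  by rewrite /lex_ge0 eqxx lexx orbT.
exact: lex_ge0D.
Qed.

Lemma lex_ge0_pmul u x y : 0 < u -> lex_ge0 (u * x) (u * y) = lex_ge0 x y.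
Proof. by move=> u0; rewrite /lex_ge0 pmulr_rgt0 // pmulr_rge0 // mulf_eq0
  gt_eqF. Qed.

Lemma lex_ge0_nmul u x y : u < 0 ->
  lex_ge0 (u * x) (u * y) = lex_ge0 (- x) (- y).
Proof. by move=> u0; rewrite -[RHS](@lex_ge0_pmul (- u)) ?oppr_gt0 // !mulrNN.
  Qed.

Lemma lex_ge0N x y : ~~ lex_ge0 x y -> lex_ge0 (- x) (- y).
Proof.
rewrite /lex_ge0 oppr_gt0 oppr_ge0 oppr_eq0 negb_or negb_and -leNgt -ltNge.
by rewrite le_eqVlt => /andP[/orP[->|->//]] /=; rewrite orbC => /ltW->.
Qed.

Lemma lex_ge0_anti x y : lex_ge0 x y -> lex_ge0 (- x) (- y) -> x = 0 /\ y = 0.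
Proof.
rewrite /lex_ge0 oppr_gt0 oppr_ge0 oppr_eq0.
case: (ltgtP x 0) => //= -> y0 y0'; split => //.
by apply/eqP; rewrite eq_le y0 y0'.
Qed.

End LexOrder.

Section LexShattering.
Import fintype finset.
Local Open Scope set_scope.
Variables (R : realType) (m : nat) (T : finType).
Variables (A B : T -> R) (c : T -> 'I_m -> R).

Definition lex_pattern (pw : ('I_m -> R) * ('I_m -> R)) : {set T} :=
  [set t | lex_ge0 (A t - \sum_j c t j * pw.1 j) (B t - \sum_j c t j * pw.2 j)].

(* A linear dependence among the vectors [c t] for [t] in [J] makes one
   combination of the lexicographic comparisons independent of [pw]; two opposite
   patterns would give it opposite strict and weak signs. *)
Lemma card_lex_shattered (F : {set {set T}}) (J : {set T}) :
  (forall f, f \in F -> exists pw, f = lex_pattern pw) ->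
  shatters F J -> (#|J| <= m)%N.
Proof.
move=> FP /shattersP shF; rewrite leqNgt; apply/negP => mJ.
pose Mx := \matrix_(i < #|J|, j < m) c (enum_val i) j.
have [u0 u0M u0_neq0] : exists2 u : 'rV[R]_#|J|, u *m Mx = 0 & u != 0.
  have : kermx Mx != 0.
    rewrite -mxrank_eq0 mxrank_ker -lt0n subn_gt0.
    exact: leq_ltn_trans (rank_leq_col _) mJ.
  by move=> /rowV0Pn[u /sub_kermxP uM un0]; exists u.
(* A negative coefficient is arranged because a failed comparison is strict whereas a satisfied one
   is weak. *)
have [u uM [i0 ui0]] : exists2 u : 'rV[R]_#|J|, u *m Mx = 0
  & exists i, u 0 i < 0.
  have [i ui] := rV0Pn _ u0_neq0.
  case: (ltgtP (u0 0 i) 0) => // [lt|gt|E]; last by rewrite E eqxx in ui.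
    by exists u0 => //; exists i.
  by exists (- u0); [rewrite mulNmx u0M oppr0|exists i; rewrite mxE oppr_lt0].
have sumu (q : 'I_m -> R) (D : T -> R) :
    \sum_i u 0 i * (D (enum_val i) - \sum_j c (enum_val i) j * q j)
      = \sum_i u 0 i * D (enum_val i).
  under eq_bigr do rewrite mulrBr;
    rewrite sumrB [X in _ - X](_ : _ = 0) ?subr0 //.
  under eq_bigr do rewrite mulr_sumr; rewrite exchange_big big1 //= => j _.
  transitivity ((u *m Mx) 0 j * q j); last by rewrite uM mxE mul0r.
  by rewrite mxE mulr_suml; apply: eq_bigr => i _; rewrite mxE mulrA.
(* [K false] holds the positive coefficients and [K true] the others. Realizing the first makes
   every term of the combination nonnegative, realizing the second makes every term nonpositive. *)
pose K (b : bool) : {set T} := [set enum_val i | i : 'I_#|J|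
  & (0 < u 0 i) (+) b].
have KJ b : K b \subset J by apply/fintype.subsetP => t /imsetP[i _ ->];
  apply: enum_valP.
have real b : exists pw, forall i : 'I_#|J|, lex_ge0
    (A (enum_val i) - \sum_j c (enum_val i) j * pw.1 j)
    (B (enum_val i) - \sum_j c (enum_val i) j * pw.2 j) = (0 < u 0 i) (+) b.
  have [f /FP[pw ->] E] := shF _ (KJ b); exists pw => i.
  have := congr1 (fun S : {set T} => enum_val i \in S) E;
    rewrite !inE enum_valP andbT => ->.
  apply/imsetP/idP => [[i' + /enum_val_inj->]|ib]; first by rewrite inE.
  by exists i; rewrite ?inE.
have [[p w] pwE] := real false; have [[p' w'] pwE'] := real true.
have neg b (x y : R) i : lex_ge0 x y = (0 < u 0 i) (+) b -> ~~ b ->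
    lex_ge0 (u 0 i * x) (u 0 i * y).
  move=> E /negbTE b0; rewrite b0 addbF in E.
  case: (ltgtP (u 0 i) 0) E => [lt|gt|->] E;
    last by rewrite !mul0r /lex_ge0 eqxx lexx orbT.
    by rewrite lex_ge0_nmul // lex_ge0N // E.
  by rewrite lex_ge0_pmul // E.
have pos (x y : R) i : lex_ge0 x y = ~~ (0 < u 0 i) ->
    lex_ge0 (- (u 0 i * x)) (- (u 0 i * y)).
  move=> E; rewrite -!mulNr.
  case: (ltgtP (u 0 i) 0) E => [lt|gt|->] E;
    last by rewrite oppr0 !mul0r /lex_ge0 eqxx lexx orbT.
    by rewrite lex_ge0_pmul ?oppr_gt0 // E.
  by rewrite lex_ge0_nmul ?oppr_lt0 // lex_ge0N // E.
have weak : lex_ge0 (- \sum_i u 0 i * A (enum_val i))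
  (- \sum_i u 0 i * B (enum_val i)).
  rewrite -(sumu p' A) -(sumu w' B) -!sumrN; apply: lex_ge0_sum => i _.
  by apply: pos; rewrite pwE' addbT.
have [sA sB] : \sum_i u 0 i * A (enum_val i)
  = 0 /\ \sum_i u 0 i * B (enum_val i) = 0.
  apply: lex_ge0_anti weak; rewrite -(sumu p A) -(sumu w B);
    apply: lex_ge0_sum => i _.
  by apply: (neg false) => //; rewrite pwE.
(* The combination is zero, so its term at [i0] is minus a sum of nonnegative terms. But the
   comparison at [i0] fails under [K false] while its coefficient is negative, which makes that term
   strictly positive. *)
have := pwE i0; rewrite addbF [RHS]ltNge (ltW ui0) /=.
set x := _ - _; set y := _ - _ => xy; suff : lex_ge0 x y by rewrite xy.
rewrite -[x]opprK -[y]opprK -(lex_ge0_nmul _ _ ui0) 2!mulrN.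
have rest D q : \sum_i u 0 i * D (enum_val i) = 0 -> 
   - (u 0 i0 * (D (enum_val i0) - \sum_j c (enum_val i0) j * q j)) =
   \sum_(i | i != i0) u 0 i * (D (enum_val i) - \sum_j c (enum_val i) j * q j).
  by rewrite -(sumu q) (bigD1 i0) //= => /eqP; rewrite addr_eq0 => /eqP->;
    rewrite opprK.
rewrite /x /y (rest _ _ sA) (rest _ _ sB); apply: lex_ge0_sum => i _.
by apply: (neg false) => //; rewrite pwE.
Qed.

End LexShattering.

Section Growth.
Import fintype finset.
Local Open Scope set_scope.
Variables (R : realType) (n m L s : nat).
Variables (v : 'I_s -> 'I_n -> valuation R m) (xi : 'I_s -> market_noise n m L).

Definition alloc_trace (p : prices R m) (w : 'I_m -> R) (j : 'I_m) :
  {set 'I_s} :=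
  [set u | allocated (lex_market (v u) p w (xi u)) j].

(** A run depends on [(p, w)] only through comparisons of pairs of bundles, [n * 4 ^ m] of them for
    each of the [s] runs. The noise sits in the constant [B], so [L] does not enter the bound. *)
Lemma card_alloc_traces j :
  (#|[set J : {set 'I_s} | `[< exists p w, J = alloc_trace p w j >]]|
    <= (s * (n * (2 ^ m * 2 ^ m))).+1 ^ m)%N.
Proof.
pose T : finType := ('I_s * 'I_n * {set 'I_m} * {set 'I_m})%type.
pose A (t : T) : R := v t.1.1.1 t.1.1.2 t.1.2 - v t.1.1.1 t.1.1.2 t.2.
pose N (u : 'I_s) (i : 'I_n) (S : {set 'I_m}) : R :=
  \sum_(l in S) (xi u i l).+1%:R.
pose B (t : T) : R := N t.1.1.1 t.1.1.2 t.1.2 - N t.1.1.1 t.1.1.2 t.2.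
pose c (t : T) (l : 'I_m) : R := (l \in t.1.2)%:R - (l \in t.2)%:R.
pose F := [set f : {set T} | `[< exists pw, f = lex_pattern A B c pw >]].
pose G (f : {set T}) := [set u : 'I_s |
  allocated (fun i S S' => ((u, i, S, S') : T) \in f) j].
have cE (t : T) (q : 'I_m -> R) : \sum_l c t l * q l
  = \sum_(l in t.1.2) q l - \sum_(l in t.2) q l.
  rewrite /c; under eq_bigr do rewrite mulrBl; rewrite sumrB.
  by congr (_ - _); rewrite [RHS]big_mkcond; apply: eq_bigr => l _;
    case: (_ \in _); rewrite ?mul1r ?mul0r.
have sub : [set J : {set 'I_s} | `[< exists p w, J = alloc_trace p w j >]]
  \subset G @: F.
  apply/fintype.subsetP => J; rewrite inE => /asboolP[p [w ->]]; apply/imsetP.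
  exists (lex_pattern A B c (p : 'I_m -> R, w)); first by rewrite inE;
    apply/asboolP; exists (p : 'I_m -> R, w).
  apply/setP => u; rewrite inE [RHS]inE /allocated.
  rewrite (@eq_run _ _ _ (fun i S S' => ((u, i, S, S') : T) \in
    lex_pattern A B c (p : 'I_m -> R, w))) // => i M.
  apply: eq_sel => S S'; rewrite inE !cE /lex_market /lex_ge /lex_ge0 /=.
  rewrite /utility /score /A /B /N /= !sumrB.
  congr (_ || _ && _); [apply/idP/idP|apply/eqP/eqP|apply/idP/idP]; lra.
apply: leq_trans (subset_leq_card sub) _;
  apply: leq_trans (leq_imset_card _ _) _.
have cardT : (s * (n * (2 ^ m * 2 ^ m)) = #|T|)%N.
  by rewrite !card_prod !card_ord !card_set_ord !mulnA.
rewrite cardT; apply: sauer => K.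
by apply: (@card_lex_shattered _ _ _ A B c) => f; rewrite inE => /asboolP.
Qed.

End Growth.

(** * Packing and chaining *)

Section Packing.
Import fintype finset.
Local Open Scope set_scope.
Variables (R : realType) (Z : finType) (z0 : Z) (H : {set {set Z}}) (m b : nat).
Hypotheses (m_gt0 : (0 < m)%N) (b_gt0 : (0 < b)%N).

Definition trace (s : nat) (t : {ffun 'I_s -> Z}) (f : {set Z}) : {set 'I_s} :=
  [set u | t u \in f].

Hypothesis growth : forall s (t : {ffun 'I_s -> Z}),
  (#|[set trace t f | f in H]| <= (s * b).+1 ^ m)%N.

Definition symdiff (f g : {set Z}) : {set Z} :=
  [set z | (z \in f) != (z \in g)].

Definition separated (r : R) (X : {set {set Z}}) :=
  [forall f in X, forall g in X,
    (f != g) ==> (r * #|Z|%:R <= #|symdiff f g|%:R)].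

Lemma card_avoid s (D : {set Z}) :
  #|[set t : {ffun 'I_s -> Z} | [forall u, t u \notin D]]|
    = ((#|Z| - #|D|) ^ s)%N.
Proof.
have -> : (#|Z| - #|D|)%N = #|~: D| by rewrite [RHS]cardsCs finset.setCK.
rewrite -[s in RHS]card_ord -card_ffun_on; apply: eq_card => t.
by rewrite !inE; apply/forallP/ffun_onP => h u; have := h u; rewrite inE.
Qed.

(* Uniformly random points separate a separated family with positive
   probability; the growth bound then controls its size. *)
Lemma card_separated (r : R) (X : {set {set Z}}) s : 0 < r <= 1 ->
  X \subset H -> separated r X ->
  #|X|%:R ^+ 2 * (1 - r) ^+ s < 1 -> (#|X| <= (s * b).+1 ^ m)%N.
Proof.
move=> /andP[r_gt0 r_le1] XH /forall_inP sepX small.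
suff [t tinj] : exists t : {ffun 'I_s -> Z}, {in X &, injective (trace t)}.
  rewrite -(card_in_imset tinj); apply: leq_trans (growth t).
  by apply/subset_leq_card/imsetS.
apply: contrapT => /forallNP ninj.
pose P (fg : {set Z} * {set Z}) (t : {ffun 'I_s -> Z}) :=
  [&& fg.1 \in X, fg.2 \in X, fg.1 != fg.2
    & [forall u, t u \notin symdiff fg.1 fg.2]].
have all_bad : [set: {ffun 'I_s -> Z}] \subset [set t | [exists fg, P fg t]].
  apply/fintype.subsetP => t _; rewrite inE;
    apply: contrapT => /negP/existsPn nP.
  apply: (ninj t) => f g fX gX E; apply/eqP; have := nP (f, g);
    rewrite /P /= fX gX /=.
  apply: contraR => -> /=; apply/forallP => u; rewrite inE negbK; apply/eqP.
  by have := congr1 (fun S : {set 'I_s} => u \in S) E; rewrite !inE.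
have Z_gt0 : 0 < #|Z|%:R :> R by rewrite ltr0n; apply/card_gt0P; exists z0.
suff : #|Z|%:R ^+ s <= #|X|%:R ^+ 2 * (1 - r) ^+ s * #|Z|%:R ^+ s :> R.
  by rewrite leNgt gtr_pMl ?exprn_gt0 // small.
have := leq_trans (subset_leq_card all_bad) (card_exists_le _).
rewrite cardsT card_ffun card_ord -(ler_nat R) natrX => /le_trans; apply.
rewrite natr_sum (bigID (fun fg => (fg.1 \in X) && (fg.2 \in X))) /=.
rewrite [X in _ + X]big1 ?addr0; last first.
  move=> fg nfg; rewrite (_ : [set t | P fg t] = finset.set0) ?cards0 //.
  by apply/setP => t; rewrite inE finset.in_set0 /P andbA (negbTE nfg).
apply: (@le_trans _ _ (\sum_(fg | (fg.1 \in X) && (fg.2 \in X))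
  ((1 - r) ^+ s * #|Z|%:R ^+ s))).
  apply: ler_sum => fg /andP[fX gX]; rewrite /P fX gX /=.
  have [_|fg_neq] /= := eqVneq fg.1 fg.2.
    rewrite (_ : [set t | _] = finset.set0); last by apply/setP => t;
      rewrite !inE.
    by rewrite cards0; apply: mulr_ge0; rewrite exprn_ge0 ?subr_ge0.
  rewrite card_avoid natrX -exprMn lerXn2r ?nnegrE ?mulr_ge0 ?subr_ge0 //.
  have /forall_inP/(_ _ gX)/implyP/(_ fg_neq) := sepX _ fX.
  by rewrite natrB ?max_card // mulrBl mul1r lerD2l lerN2.
rewrite sumr_const -[leLHS]mulr_natl mulrA ler_wpM2r ?exprn_ge0 //.
rewrite ler_wpM2r ?exprn_ge0 ?subr_ge0 // -natrX ler_nat expnS expn1.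
by rewrite -cardsX; apply/eq_leq/eq_card => -[f g]; rewrite !inE.
Qed.

(** Taking [s] just above [2 * ln #|X| / r] satisfies the previous lemma, but leaves [ln #|X|] on
    the right as well. Solving that inequality for [#|X|] doubles the exponent [m]. *)
Lemma card_separated_exp (r : R) (X : {set {set Z}}) : 0 < r <= 1 ->
  X \subset H -> separated r X ->
  #|X|%:R <= (4 * m%:R * b%:R / r) ^+ m.*2 :> R.
Proof.
move=> r01 XH sepX; have /andP[r_gt0 r_le1] := r01.
have m1 : 1 <= m%:R :> R by rewrite ler1n.
have b1 : 1 <= b%:R :> R by rewrite ler1n.
have [->|X_gt0] := posnP #|X|.
  by rewrite exprn_ge0 // divr_ge0 ?mulr_ge0 // ltW.
have XR_ge1 : 1 <= #|X|%:R :> R by rewrite ler1n.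
pose y : R := ln #|X|%:R.
have Xy : #|X|%:R = expR y by rewrite lnK // posrE (lt_le_trans ltr01).
have y_ge0 : 0 <= y by rewrite ln_ge0.
have [s s_lt s_le] : exists2 s : nat, 2 * y / r < s%:R & s%:R <= 2 * y / r + 1.
  have yr : 0 <= 2 * y / r by rewrite divr_ge0 ?mulr_ge0 // ltW.
  exists (Num.trunc (2 * y / r)).+1; first exact: truncnS_gt.
  by rewrite -natr1 lerD2r truncn_le.
have small : #|X|%:R ^+ 2 * (1 - r) ^+ s < 1.
  have : (1 - r) ^+ s <= expR (- r) ^+ s.
    by rewrite lerXn2r ?nnegrE ?subr_ge0 ?expR_ge0 // expR_ge1Dx.
  move=> le; apply: le_lt_trans (_ : expR y ^+ 2 * expR (- r) ^+ s < 1).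
    by rewrite Xy ler_wpM2l // exprn_ge0 // expR_ge0.
  rewrite -!expRM_natl -expRD -[ltRHS]expR0 ltr_expR.
  by rewrite mulrN subr_lt0 -ltr_pdivrMr.
have := card_separated r01 XH sepX small.
rewrite -(ler_nat R) natrX Xy -natr1 natrM.
(* Splitting off [expR t] from the base yields [expR y <= q ^+ m * expR (y / 2)]; half of [y]
   cancels and squaring gives the claim. *)
pose t := y / (2 * m%:R).
have tE : 2 * m%:R * t = y by rewrite /t; field;
  rewrite gt_eqF // (lt_le_trans ltr01).
set q := 4 * m%:R * b%:R / r.
have q_ge0 : 0 <= q by rewrite divr_ge0 ?mulr_ge0 // ltW.
have base : s%:R * b%:R + 1 <= q * expR t.
  have step1 : s%:R * b%:R + 1 <= 2 * b%:R / r * (y + 1).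
    rewrite -(ler_pM2r r_gt0) [leRHS](_ : _ = 2 * b%:R * (y + 1));
      last by field; rewrite gt_eqF.
    have : s%:R * r <= 2 * y + r.
      by have := ler_wpM2r (ltW r_gt0) s_le;
        rewrite mulrDl mul1r mulfVK // gt_eqF.
    move=> h; have := ler_wpM2l (le_trans ler01 b1) h; nra.
  apply: le_trans step1 _.
  rewrite /q [leRHS](_ : _ = 2 * b%:R / r * (2 * m%:R * expR t)); last by field;
    rewrite gt_eqF.
  rewrite ler_wpM2l ?divr_ge0 ?mulr_ge0 ?(ltW r_gt0) //.
  have := expR_ge1Dx t => h; rewrite -tE; nra.
move=> le; have {le} : expR y <= q ^+ m * expR (m%:R * t).
  apply: le_trans le _; rewrite expRM_natl -exprMn.
  apply: lerXn2r base; rewrite nnegrE; first by rewrite addr_ge0 // mulr_ge0.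
  by rewrite mulr_ge0 // expR_ge0.
have -> : y = m%:R * t + m%:R * t by rewrite -tE; ring.
rewrite expRD ler_pM2r ?expR_gt0 // => le;
  rewrite -addnn exprD ler_pM // expR_ge0 //.
Qed.

(** A separated family of maximal size is a net. *)
Lemma exists_net (r : R) : 0 < r <= 1 ->
  exists X : {set {set Z}}, [/\ X \subset H,
  #|X|%:R <= (4 * m%:R * b%:R / r) ^+ m.*2 :> R &
  forall f, f \in H -> exists2 g, g \in X & #|symdiff f g|%:R < r * #|Z|%:R].
Proof.
move=> r01; pose P (X : {set {set Z}}) := (X \subset H) && separated r X.
have P0 : P finset.set0.
  by rewrite /P finset.sub0set; apply/forall_inP => f; rewrite inE.
case: (@arg_maxnP _ finset.set0 P (fun X => #|X|) P0) => X /andP[XH sepX] Xmax.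
exists X; split => //; first exact: card_separated_exp.
move=> f fH; have r_gt0 : 0 < r by case/andP: r01.
have Z_gt0 : 0 < #|Z|%:R :> R by rewrite ltr0n; apply/card_gt0P; exists z0.
have [fX|fX] := boolP (f \in X).
  exists f => //; rewrite (_ : symdiff f f = finset.set0) ?cards0 ?mulr_gt0 //.
  by apply/setP => z; rewrite !inE eqxx.
apply: contrapT => /forall2NP nX; have : P (f |: X).
  have symC (g h : {set Z}) : symdiff g h = symdiff h g by apply/setP => z;
    rewrite !inE eq_sym.
  have far g : g \in X -> r * #|Z|%:R <= #|symdiff f g|%:R.
    by move=> gX; rewrite leNgt; apply/negP => lt; case: (nX g).
  rewrite /P finset.subUset finset.sub1set fH XH; apply/forall_inP => g;
    rewrite !inE.
  move=> gX; apply/forall_inP => h; rewrite !inE => hX; apply/implyP.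
  case/orP: gX => [/eqP->|gX]; case/orP: hX => [/eqP->|hX] gh.
  - by rewrite eqxx in gh.
  - exact: far.
  - by rewrite symC far.
  - by move/forall_inP/(_ _ gX)/forall_inP/(_ _ hX)/implyP: sepX => /(_ gh).
by move=> /Xmax; rewrite cardsU1 fX /=; lia.
Qed.

End Packing.

Section SignSums.
Import fintype finset.
Local Open Scope set_scope.
Variables (R : realType) (k : nat).
Implicit Types (a : 'I_k -> R) (sg : {ffun 'I_k -> bool}).

Definition sign_sum sg a : R := \sum_i (-1) ^+ sg i * a i.

(** Follows from [1 + x <= expR x] alone: this bounds both exponentials quadratically for
    [x <= 1 / 2], and beyond that [x <= 2 * x ^+ 2]. *)
Lemma expR_pair_le (x : R) : expR x + expR (- x) <= 2 * expR (2 * x ^+ 2).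
Proof.
wlog x_ge0 : x / 0 <= x.
  move=> H; have [/H//|/ltW x_le0] := leP 0 x.
  by have := H (- x); rewrite opprK sqrrN oppr_ge0 addrC; apply.
have [x_le|x_gt] := leP x (1 / 2); last first.
  have : expR (- x) <= expR x by rewrite ler_expR; lra.
  have : expR x <= expR (2 * x ^+ 2) by rewrite ler_expR expr2; nra.
  by lra.
have inv_le : expR x <= 1 + x + 2 * x ^+ 2.
  have := expR_ge1Dx (- x); rewrite expRN => H.
  have e0 := expR_gt0 x.
  have H1 : expR x * (1 - x) <= 1.
    by rewrite mulrC -ler_pdivlMr // mul1r.
  rewrite expr2; nra.
have invN_le : expR (- x) <= 1 - x + 2 * x ^+ 2.
  have := expR_ge1Dx x; rewrite expRN => H.
  have : (expR x)^-1 <= (1 + x)^-1 by rewrite lef_pV2 // posrE ?expR_gt0 //;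
    lra.
  move=> /le_trans; apply; rewrite -[leLHS]mul1r ler_pdivrMr; last lra.
  rewrite expr2; nra.
have := expR_ge1Dx (2 * x ^+ 2); lra.
Qed.

Lemma card_sign_sum_gt a (V t : R) : 0 < V -> 0 < t -> \sum_i a i ^+ 2 <= V ->
  (* Chernoff bound; [lam] minimizes [2 * lam ^+ 2 * V - lam * t]. *)
  #|[set sg | t < sign_sum sg a]|%:R <= 2 ^+ k * expR (- (t ^+ 2 / (8 * V))).
Proof.
move=> V_gt0 t_gt0 aV; pose lam := t / (4 * V).
have lam_gt0 : 0 < lam by rewrite divr_gt0 // mulr_gt0.
rewrite -(ler_pM2r (expR_gt0 (lam * t))) -[leRHS]mulrA -expRD.
apply: (@le_trans _ _ (\sum_sg expR (lam * sign_sum sg a))).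
  rewrite -sum1_card natr_sum mulr_suml big_mkcond; apply: ler_sum => sg _.
  rewrite inE; case: ifP => [lt|_]; last exact: expR_ge0.
  by rewrite mul1r ler_expR ler_pM2l // ltW.
apply: (@le_trans _ _ (\prod_(i < k) (2 * expR (2 * (lam * a i) ^+ 2)))).
  have -> : \sum_sg expR (lam * sign_sum sg a) =
      \prod_(i < k) \sum_(b : bool) expR (lam * ((-1) ^+ b * a i)).
    rewrite bigA_distr_bigA /=; apply: eq_bigr => sg _.
    by rewrite -expR_sum /sign_sum mulr_sumr.
  apply: ler_prod => i _; rewrite big_bool /= expr1 expr0 mulN1r mul1r mulrN
    addrC.
  by rewrite addr_ge0 ?expR_ge0 //= expR_pair_le.
rewrite big_split /= prodr_const card_ord ler_pM2l ?exprn_gt0 //.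
rewrite -expR_sum ler_expR.
have -> : \sum_i 2 * (lam * a i) ^+ 2 = 2 * lam ^+ 2 * \sum_i a i ^+ 2.
  by rewrite mulr_sumr; apply: eq_bigr => i _; rewrite exprMn mulrA.
apply: le_trans (_ : 2 * lam ^+ 2 * V <= _).
  by rewrite ler_wpM2l // mulr_ge0 // exprn_ge0 // ltW.
rewrite /lam le_eqVlt; apply/orP; left; apply/eqP; field; rewrite gt_eqF //.
Qed.

Lemma card_sign_sum_norm_gt a (V t : R) : 0 < V -> 0 < t ->
  \sum_i a i ^+ 2 <= V ->
  #|[set sg | t < `|sign_sum sg a|]|%:R
    <= 2 ^+ k * (2 * expR (- (t ^+ 2 / (8 * V)))).
Proof.
move=> V_gt0 t_gt0 aV; have sub : [set sg | t < `|sign_sum sg a|] \subset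
    [set sg | t < sign_sum sg a] :|:
      [set sg | t < sign_sum sg (fun i => - a i)].
  apply/fintype.subsetP => sg; rewrite !inE /sign_sum.
  under [X in _ || (t < X)]eq_bigr do rewrite mulrN; rewrite sumrN.
  by rewrite ltr_normr.
have aNV : \sum_i (- a i) ^+ 2 <= V by under eq_bigr do rewrite sqrrN.
have := leq_trans (subset_leq_card sub) (leq_card_setU _ _).1.
rewrite -(ler_nat R) natrD => /le_trans; apply.
rewrite mulrCA mulr2n mulrDl !mul1r.
by apply: lerD; apply: card_sign_sum_gt.
Qed.

End SignSums.

(** * Chaining under random swaps of two samples *)

Section Chaining.
Import fintype finset.
Local Open Scope set_scope.
Variables (R : realType) (k : nat) (Xi : finType) (xi0 : Xi).
Hypothesis k_gt0 : (0 < k)%N.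

Local Notation Z := ('I_k * bool * Xi)%type.
Implicit Types f g : {set Z}.

(** A point of [Z] is a slot, one of the two copies in it, and a noise. Averaging over the noise
    leaves the two probabilities in each slot that a swap exchanges. *)
Definition freq f (i : 'I_k) (c : bool) : R :=
  (\sum_(x : Xi) ((i, c, x) \in f)%:R) / #|Xi|%:R.

Definition gap f (i : 'I_k) : R := freq f i true - freq f i false.

Let Xi_gt0 : 0 < #|Xi|%:R :> R.
Proof. by rewrite ltr0n; apply/card_gt0P; exists xi0. Qed.

Let kR_gt0 : 0 < k%:R :> R. Proof. by rewrite ltr0n. Qed.

Lemma freq01 f i c : 0 <= freq f i c <= 1.
Proof.
rewrite /freq divr_ge0 ?sumr_ge0 //= ler_pdivrMr // mul1r -natr_sum ler_nat.
by rewrite -sum1_card; apply: leq_sum => x _; case: (_ \in _).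
Qed.

Lemma sum_gap_sqr f : \sum_i gap f i ^+ 2 <= k%:R.
Proof.
rewrite -[k in leRHS]card_ord -sumr_const; apply: ler_sum => i _.
have /andP[h1 h2] := freq01 f i true; have /andP[h3 h4] := freq01 f i false.
by rewrite /gap expr2; nra.
Qed.

(** In each slot the difference is at most some [s <= 2], hence its square at most [2 * s]: the
    variance of an increment is linear in the measure of the symmetric difference. *)
Lemma sum_gap_diff_sqr f g :
  \sum_i (gap f i - gap g i) ^+ 2 <= 2 * (#|symdiff f g|%:R / #|Xi|%:R).
Proof.
pose e i c : R := (\sum_(x : Xi) ((i, c, x) \in symdiff f g)%:R) / #|Xi|%:R.
have e01 i c : 0 <= e i c <= 1 by exact: freq01.
have eP i c : `|freq f i c - freq g i c| <= e i c.
  rewrite /freq -mulrBl normrM [X in _ * X]gtr0_norm ?invr_gt0 //.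
  rewrite ler_wpM2r ?invr_ge0 ?(ltW Xi_gt0) // -sumrB;
    apply: le_trans (ler_norm_sum _ _ _) _.
  apply: ler_sum => x _; rewrite inE.
  by do 2 case: (_ \in _); rewrite ?subrr ?subr0 ?sub0r ?normrN ?normr0 ?normr1.
have -> : #|symdiff f g|%:R / #|Xi|%:R = \sum_i (e i true + e i false).
  transitivity (\sum_(z : Z) (((z.1.1, z.1.2, z.2) : Z) \in symdiff f g)%:R /
    #|Xi|%:R : R).
    rewrite -sum1_card natr_sum big_mkcond mulr_suml.
    by apply: eq_bigr => -[[i c] x] _; case: ifP.
  rewrite -(pair_bigA _ (fun ic x =>
    (((ic.1, ic.2, x) : Z) \in symdiff f g)%:R / #|Xi|%:R)) /=.
  rewrite -(pair_bigA _ (fun i c =>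
    \sum_x (((i, c, x) : Z) \in symdiff f g)%:R / #|Xi|%:R)) /=.
  by apply: eq_bigr => i _; rewrite big_bool /= -!mulr_suml.
rewrite mulr_sumr; apply: ler_sum => i _.
have := (eP i true, eP i false);
  rewrite !ler_norml => -[/andP[h1 h2] /andP[h3 h4]].
have /andP[h5 h6] := e01 i true; have /andP[h7 h8] := e01 i false.
set s := e i true + e i false.
have : - s <= gap f i - gap g i <= s by rewrite /gap /s; apply/andP; split; lra.
have : 0 <= s <= 2 by rewrite /s; apply/andP; split; lra.
move: (gap f i - gap g i) s => x s /andP[s0 s2] /andP[xl xu]; rewrite expr2;
  nra.
Qed.

Variables (H : {set {set Z}}) (m b : nat).
Hypotheses (m_gt0 : (0 < m)%N) (b_gt0 : (0 < b)%N).
Hypothesis growth : forall s (t : {ffun 'I_s -> Z}),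
  (#|[set trace t f | f in H]| <= (s * b).+1 ^ m)%N.

(** Size of the net at scale [4 ^- l] times a two-sided tail with threshold
    [k * eps * (3/4) ^ l / 16] and variance [16 * k * 4 ^- l]. The square of 3/4 times 4 gives 9/4:
    allowances decay more slowly than standard deviations. *)
Definition chain_bound (eps : R) (l : nat) : R :=
  (4 * m%:R * b%:R * 4 ^+ l) ^+ m.*2 *
    (2 * expR (- (k%:R * eps ^+ 2 * (9 / 4) ^+ l / (8 * 16 ^+ 3)))).

(* Nets at the scales [4 ^- l]; the increment at level [l] is allowed to deviate
   by [eps (3/4) ^ l / 16], and these allowances sum to at most [eps / 4]. *)
Lemma chaining (eps : R) : 0 < eps -> exists M : nat,
  #|[set sg : {ffun 'I_k -> bool} |
      [exists f in H, k%:R * (eps / 4) < `|sign_sum sg (gap f)|]]|%:R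
  <= 2 ^+ k * \sum_(l < M) chain_bound eps l.
Proof.
move=> eps_gt0; pose r (l : nat) : R := 4^-1 ^+ l.
have r01 l : 0 < r l <= 1 by rewrite exprn_gt0 //= exprn_ile1 // invf_le1 //
  ler1n.
have z0 : Z := (Ordinal k_gt0, true, xi0).
have [N NP] := choice (fun l => exists_net z0 m_gt0 b_gt0 growth (r01 l)).
pose pi l f := odflt f [pick g in N l | #|symdiff f g|%:R < r l * #|{: Z}|%:R].
have piP l f : f \in H -> pi l f \in N l /\ #|symdiff f (pi l f)|%:R
  < r l * #|{: Z}|%:R.
  move=> fH; rewrite /pi; case: pickP => [g /andP[gN gr]|none] //=.
  by have [_ _ /(_ f fH)[g gN gr]] := NP l; have := none g; rewrite gN gr.
pose e (l : nat) : R := eps * (3 / 4) ^+ l / 16.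
have e_gt0 l : 0 < e l by rewrite divr_gt0 // mulr_gt0 // exprn_gt0.
pose prev l f (i : 'I_k) : R := if l is l'.+1 then gap (pi l' f) i else 0.
(* The predecessor of [f] in [N l] is a function of [f], so the union bound at level [l] runs over
   one net rather than over pairs from two nets. *)
pose bad l := [set sg | [exists f in N l, k%:R * e l
  < `|sign_sum sg (fun i => gap f i - prev l f i)|]].
have cardZ : #|{: Z}|%:R = 2 * k%:R * #|Xi|%:R :> R.
  by rewrite !card_prod card_bool card_ord !natrM; ring.
have card_bad l : #|bad l|%:R <= 2 ^+ k * chain_bound eps l.
  have [NH cN _] := NP l.
  (* At level [l + 1] the symmetric difference with the predecessor has relative size below [r l],
     which gives [4 * k * r l = V]; level 0 uses the crude bound [k]. *)
  pose V : R := 16 * k%:R * r l.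
  have V_gt0 : 0 < V by rewrite !mulr_gt0 //; case/andP: (r01 l).
  have small f : f \in N l -> \sum_i (gap f i - prev l f i) ^+ 2 <= V.
    move=> fN; have fH := fintype.subsetP NH f fN; rewrite /V /prev;
      case: l {cN V V_gt0 NH fN} => [|l].
      under eq_bigr do rewrite subr0.
      by apply: le_trans (sum_gap_sqr f) _; rewrite /r expr0; have := kR_gt0;
        lra.
    apply: le_trans (sum_gap_diff_sqr _ _) _.
    have [_ lt] := piP l f fH; rewrite /r exprS -/(r l).
    have : #|symdiff f (pi l f)|%:R / #|Xi|%:R <= 2 * k%:R * r l.
      by rewrite ler_pdivrMr // (le_trans (ltW lt)) // cardZ le_eqVlt;
        apply/orP; left; apply/eqP; ring.
    by lra.
  pose P f (sg : {ffun 'I_k -> bool}) := (f \in N l) &&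
    (k%:R * e l < `|sign_sum sg (fun i => gap f i - prev l f i)|).
  apply: (@le_trans _ _ (\sum_f #|[set sg | P f sg]|)%:R).
    by rewrite ler_nat; apply: card_exists_le.
  rewrite natr_sum (bigID (mem (N l))) /= [X in _ + X]big1 ?addr0; last first.
    move=> f fN; rewrite (_ : [set sg | P f sg] = finset.set0) ?cards0 //.
    by apply/setP => sg; rewrite inE finset.in_set0 /P (negbTE fN).
  pose tail := 2 ^+ k * (2 * expR
    (- (k%:R * eps ^+ 2 * (9 / 4) ^+ l / (8 * 16 ^+ 3))) : R).
  apply: (@le_trans _ _ (\sum_(f in N l) tail)).
    apply: ler_sum => f fN; rewrite /P fN /=.
    have ke_gt0 : 0 < k%:R * e l by rewrite mulr_gt0.
    apply: le_trans (card_sign_sum_norm_gt V_gt0 ke_gt0 (small f fN)) _.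
    rewrite /tail le_eqVlt; apply/orP; left; apply/eqP;
      congr (_ * (_ * expR (- _))).
    have -> : (9 / 4 : R) ^+ l = ((3 / 4) ^+ l) ^+ 2 / r l.
      by rewrite -exprM mulnC exprM /r -exprVn invrK -exprMn; congr (_ ^+ _);
        field.
    rewrite /e /V; have /andP[rl0 _] := r01 l;
      move: (r l) rl0 ((3 / 4) ^+ l) => x x0 y.
    by field; rewrite !gt_eqF.
  rewrite sumr_const -[leLHS]mulr_natl /tail /chain_bound mulrCA.
  rewrite ler_wpM2l ?exprn_ge0 // ler_wpM2r ?mulr_ge0 ?expR_ge0 //.
  by apply: le_trans cN _; rewrite /r -exprVn invrK.
(* At this scale a symmetric difference has fewer than one point, so the net contains every member
   of [H] and the chain ends exactly. *)
have [M M_large] : exists M, #|{: Z}|%:R * r M <= 1.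
  exists #|{: Z}|; rewrite /r exprVn ler_pdivrMr ?exprn_gt0 // mul1r -natrX
    ler_nat.
  by apply/ltnW/ltn_expl.
exists M.+1.
have card_union : #|[set sg | [exists l : 'I_M.+1, sg \in bad l]]|%:R <=
    2 ^+ k * \sum_(l < M.+1) chain_bound eps l.
  apply: (@le_trans _ _ (\sum_(l < M.+1) #|[set sg | sg \in bad l]|)%:R).
    by rewrite ler_nat; apply: card_exists_le.
  rewrite natr_sum mulr_sumr; apply: ler_sum => l _.
  by apply: le_trans (card_bad l); rewrite ler_nat subset_leq_card //;
    apply/fintype.subsetP => sg; rewrite inE.
apply: le_trans card_union; rewrite ler_nat;
  apply/subset_leq_card/fintype.subsetP => sg.
rewrite !inE; apply: contraTT => /existsPn good.
have chain l : (l <= M)%N -> forall f, f \in N l ->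
    `|sign_sum sg (gap f)| <= k%:R * \sum_(i < l.+1) e i.
  elim: l => [|l IH] lM f fN.
    have := good ord0; rewrite inE => /exists_inPn/(_ f fN);
      rewrite -leNgt big_ord1.
    by under eq_fun do rewrite subr0.
  have [NH _ _] := NP l.+1; have fH := fintype.subsetP NH f fN.
  have := good (Ordinal (lM : (l.+1 < M.+1)%N));
    rewrite inE => /exists_inPn/(_ f fN).
  rewrite -leNgt /= => step; rewrite big_ord_recr mulrDr /=.
  have [piN _] := piP l f fH; have := IH (ltnW lM) _ piN => prev_le.
  have -> : sign_sum sg (gap f) = sign_sum sg (gap (pi l f)) +
      sign_sum sg (fun i => gap f i - gap (pi l f) i).
    by rewrite /sign_sum -big_split; apply: eq_bigr => i _ /=; ring.
  by apply: le_trans (ler_normD _ _) _; apply: lerD.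
rewrite negb_exists; apply/forallP => f; rewrite negb_and -implybE;
  apply/implyP => fH.
rewrite -leNgt; have [piN lt] := piP M f fH.
have -> : f = pi M f.
  have d0 : #|symdiff f (pi M f)| = 0%N.
    by apply/eqP; rewrite -leqn0 -ltnS -(ltr_nat R) (lt_le_trans lt) // mulrC.
  by apply/setP => z; apply/eqP/negPn; have := card0_eq d0 z;
    rewrite !inE => ->.
apply: le_trans (chain M (leqnn _) _ piN) _; rewrite ler_pM2l //.
rewrite -mulr_suml -mulr_sumr.
have geo N' : \sum_(i < N') (3 / 4 : R) ^+ i <= 4 - 4 * (3 / 4) ^+ N'.
  elim: N' => [|N' IH]; first by rewrite big_ord0 expr0; lra.
  by rewrite big_ord_recr /= exprS; lra.
have := geo M.+1; have : 0 <= (3 / 4 : R) ^+ M.+1 by rewrite exprn_ge0.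
move: (\sum_(_ < _) _) (_ ^+ _) => x y y0 xy; nra.
Qed.

End Chaining.

(** * The sample size that makes the chaining bounds summable *)

Section ChainSum.
Variables (R : realType) (k n m : nat) (eps delta : R).
Hypotheses (n_gt0 : (0 < n)%N) (m_gt0 : (0 < m)%N) (delta01 : 0 < delta < 1).

Let lam : R := m%:R ^+ 2 + m%:R * ln n%:R + ln (1 / delta).

Hypothesis k_large : 16 * (8 * 16 ^+ 3) * lam <= k%:R * eps ^+ 2.

Let ln_n_ge0 : 0 <= ln n%:R :> R. Proof. by rewrite ln_ge0 // ler1n. Qed.

Let ln_delta_ge0 : 0 <= ln (1 / delta).
Proof.
case/andP: delta01 => d0 d1.
by rewrite ln_ge0 // ler_pdivlMr // mul1r ltW.
Qed.

Let m_ge1 : 1 <= m%:R :> R. Proof. by rewrite ler1n. Qed.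

Let lam_ge : m%:R + ln (1 / delta) <= lam.
Proof.
have : 0 <= m%:R * ln n%:R :> R by rewrite mulr_ge0.
have : m%:R <= m%:R ^+ 2 :> R by rewrite expr2 ler_peMr.
by rewrite /lam; lra.
Qed.

(** From [4 <= expR 2] and [m <= expR (m - 1)]: the exponent [2 * m * (ln n + 4 * m + 2 * l)] is
    absorbed by the terms [m ^ 2] and [m * ln n] of [lam]. *)
Let net_size_le l : (4 * m%:R * (n * (2 ^ m * 2 ^ m))%:R * 4 ^+ l) ^+ m.*2 <=
  expR (8 * lam * l.+1%:R) :> R.
Proof.
have e4 : 4 <= expR 2 :> R.
  by have := expR_ge1Dx (1 : R); rewrite (_ : 2 = 1 + 1 :> R) // expRD => h;
    nra.
have em : m%:R <= expR (m%:R - 1) :> R.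
  by have := expR_ge1Dx (m%:R - 1 : R); rewrite addrCA subrr addr0.
have nE : n%:R = expR (ln n%:R) :> R by rewrite lnK // posrE ltr0n.
have base : 4 * m%:R * (n * (2 ^ m * 2 ^ m))%:R * 4 ^+ l <=
    expR (ln n%:R + 4 * m%:R + 2 * l%:R) :> R.
  have -> : ln n%:R + 4 * m%:R + 2 * l%:R
    = 2 + (m%:R - 1) + (ln n%:R + m%:R * 2 + l%:R * 2)
    + (m%:R - 1) :> R by ring.
  have h1 : 1 <= expR (m%:R - 1) :> R by rewrite -[leLHS]expR0 ler_expR
    subr_ge0.
  move: (m%:R - 1) (2 : R) em h1 e4 => u c em h1 e4.
  rewrite -expnMn natrM natrX !expRD -nE !expRM_natl.
  have h4 p : 4 ^+ p <= expR c ^+ p :> R by apply: lerXn2r e4;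
    rewrite nnegrE ?expR_ge0.
  rewrite [leLHS](_ : _ = 4 * m%:R * (n%:R * 4 ^+ m * 4 ^+ l) * 1);
    last by ring.
  have p4 p : 0 <= 4 ^+ p :> R by rewrite exprn_ge0.
  have q0 : 0 <= n%:R * 4 ^+ m :> R by rewrite mulr_ge0.
  apply: ler_pM; [by rewrite !mulr_ge0|by []| |exact: h1].
  apply: ler_pM; [by rewrite mulr_ge0|by rewrite mulr_ge0|by apply: ler_pM e4
    em|].
  by apply: ler_pM => //; rewrite ler_wpM2l.
apply: (@le_trans _ _ (expR (ln n%:R + 4 * m%:R + 2 * l%:R) ^+ m.*2)).
  by apply: lerXn2r base; rewrite nnegrE ?expR_ge0 // !mulr_ge0 ?exprn_ge0.
rewrite -expRM_natl ler_expR -addnn natrD -[l.+1%:R]natr1.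
have l0 : 0 <= l%:R :> R by [].
move: lam_ge ln_delta_ge0 ln_n_ge0 m_ge1; rewrite /lam expr2.
move: (m%:R) (ln n%:R) (ln (1 / delta)) (l%:R) l0 => x y z t t0 _ z0 y0 x1.
have xy : 0 <= x * y by rewrite mulr_ge0 //; lra.
have xx : x <= x * x by rewrite ler_peMr //; lra.
have h : x * t <= x * x * t by rewrite ler_wpM2r.
have h2 : 0 <= x * y * t by rewrite mulr_ge0.
have h3 : 0 <= z * t by rewrite mulr_ge0.
have h4 : 0 <= x * x * t by rewrite !mulr_ge0 //; lra.
lra.
Qed.

(** The constant in [k_large] makes the tail exponent at least [16 * lam * (l + 1)], twice that of
    the net. What remains pays for [delta], for the union over items through [m * expR (- m) <= 1],
    and for a geometric series in [l]. *)
Lemma sum_chain_bound M :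
  m%:R * \sum_(l < M) chain_bound k m (n * (2 ^ m * 2 ^ m)) eps l <= delta / 2.
Proof.
have [d0 d1] := andP delta01.
have term l : chain_bound k m (n * (2 ^ m * 2 ^ m)) eps l <=
    2 * delta * expR (- m%:R) * (8^-1) ^+ l.+1.
  rewrite /chain_bound mulrCA.
  rewrite [leRHS](_ : _ = 2 * (delta * (expR (- m%:R) * 8^-1 ^+ l.+1)));
    last by ring.
  rewrite ler_wpM2l //.
  have growth : l.+1%:R <= (9 / 4 : R) ^+ l.
    elim: l => [|l IH]; first by rewrite expr0.
    have l1 : 1 <= l.+1%:R :> R by rewrite ler1n.
    by rewrite exprS -[l.+2%:R]natr1; lra.
  have lam_ge1 : 1 <= lam by have := (lam_ge, ln_delta_ge0, m_ge1) =>
    -[[? ?] ?]; lra.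
  have l1 : 1 <= l.+1%:R :> R by rewrite ler1n.
  apply: (@le_trans _ _ (expR (8 * lam * l.+1%:R)
    * expR (- (16 * lam * l.+1%:R)))).
    apply: ler_pM; [|exact: expR_ge0|exact: net_size_le|].
      by rewrite exprn_ge0 // !mulr_ge0 ?exprn_ge0.
    rewrite ler_expR lerN2 ler_pdivlMr //.
    have : 16 * (8 * 16 ^+ 3) * lam * l.+1%:R <= k%:R * eps ^+ 2 * (9 / 4) ^+ l.
      by apply: ler_pM => //; rewrite mulr_ge0 // (le_trans ler01).
    by lra.
  have -> : delta = expR (- ln (1 / delta)).
    by rewrite expRN lnK ?posrE ?divr_gt0 // invf_div divr1.
  have e8 : expR (- 7) <= 8^-1 :> R.
    rewrite expRN lef_pV2 ?posrE ?expR_gt0 //.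
    by have := expR_ge1Dx (7 : R); lra.
  apply: (@le_trans _ _ (expR (- ln (1 / delta))
    * (expR (- m%:R) * expR (- 7) ^+ l.+1))).
    rewrite -expRM_natl -!expRD ler_expR.
    have := lam_ge; have : lam <= lam * l.+1%:R by rewrite ler_peMr //; lra.
    have : l.+1%:R <= lam * l.+1%:R by rewrite ler_peMl.
    by lra.
  by rewrite !ler_wpM2l ?expR_ge0 // lerXn2r ?nnegrE ?expR_ge0.
apply: (@le_trans _ _ (m%:R * \sum_(l < M) 2 * delta * expR (- m%:R)
  * (8^-1) ^+ l.+1)).
  by rewrite ler_wpM2l // ler_sum.
rewrite -mulr_sumr.
have geo : \sum_(l < M) (8^-1 : R) ^+ l.+1 <= 1 / 4.
  suff : \sum_(l < M) (8^-1 : R) ^+ l.+1 <= 1 / 7 - 1 / 7 * 8^-1 ^+ M.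
    have : 0 <= (8^-1 : R) ^+ M by rewrite exprn_ge0.
    lra.
  elim: M => [|M' IH]; first by rewrite big_ord0 expr0; lra.
  by rewrite big_ord_recr /= exprS; lra.
have mexp : m%:R * expR (- m%:R) <= 1 :> R.
  rewrite expRN ler_pdivrMr ?expR_gt0 // mul1r.
  by have := expR_ge1Dx (m%:R : R); lra.
have mexp0 : 0 <= m%:R * expR (- m%:R) :> R by rewrite mulr_ge0 // expR_ge0.
have geo0 : 0 <= \sum_(l < M) (8^-1 : R) ^+ l.+1 by apply: sumr_ge0 => l _;
  rewrite exprn_ge0.
rewrite [leLHS](_ : _ = 2 * delta
  * ((m%:R * expR (- m%:R)) * \sum_(l < M) (8^-1) ^+ l.+1)); last by ring.
have : m%:R * expR (- m%:R) * (\sum_(l < M) (8^-1 : R) ^+ l.+1)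
  <= 1 * (1 / 4) by apply: ler_pM.
by move: (_ * _) => x ?; nra.
Qed.

End ChainSum.

Section MarketSigns.
Import fintype finset.
Local Open Scope set_scope.
Variables (R : realType) (k n m L : nat) (eps delta : R).
Hypotheses (k_gt0 : (0 < k)%N) (n_gt0 : (0 < n)%N) (m_gt0 : (0 < m)%N).
Hypotheses (eps_gt0 : 0 < eps) (delta01 : 0 < delta < 1).
Hypothesis k_large : 16 * (8 * 16 ^+ 3) *
  (m%:R ^+ 2 + m%:R * ln n%:R + ln (1 / delta)) <= k%:R * eps ^+ 2.

(** For a fixed double sample, each item has its own class of sets of runs, one set for each
    [(p, w)]; chaining applies to each class and the items are joined by a union bound. *)
Lemma card_market_signs (x : 'I_k -> bool -> 'I_n -> valuation R m) :
  #|[set sg : {ffun 'I_k -> bool} | `[< exists (p : prices R m) w j,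
      k%:R * (eps / 4) < `|sign_sum sg (fun i =>
        alloc_prob (x i true) p (fun=> noise_rule L w) j -
        alloc_prob (x i false) p (fun=> noise_rule L w) j)| >]]|%:R
  <= 2 ^+ k * (delta / 2).
Proof.
pose Z : finType := ('I_k * bool * market_noise n m L)%type.
pose runs (p : prices R m) w j : {set Z} :=
  [set z : Z | allocated (lex_market (x z.1.1 z.1.2) p w z.2) j].
pose H j := [set f : {set Z} | `[< exists p w, f = runs p w j >]].
have freqE p w j i c : freq R (runs p w j) i c =
    alloc_prob (x i c) p (fun=> noise_rule L w) j.
  rewrite alloc_prob_noise /freq; congr (_ / _); apply: eq_bigr => xi _.
  by rewrite inE.
pose b := (n * (2 ^ m * 2 ^ m))%N.
have b_gt0 : (0 < b)%N by rewrite !muln_gt0 n_gt0 !expn_gt0.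
have growth j s (t : {ffun 'I_s -> Z}) :
    (#|[set trace t f | f in H j]| <= (s * b).+1 ^ m)%N.
  apply: leq_trans (card_alloc_traces (fun u => x (t u).1.1 (t u).1.2) (fun u =>
    (t u).2) j).
  apply/subset_leq_card/fintype.subsetP => f /imsetP[g].
  rewrite inE => /asboolP[p [w ->]] ->; rewrite inE; apply/asboolP; exists p, w.
  by apply/setP => u; rewrite !inE.
pose xi0 : market_noise n m L := [ffun=> [ffun=> ord0]].
have ex j := chaining xi0 k_gt0 m_gt0 b_gt0 (growth j) eps_gt0.
pose bad j := [set sg : {ffun 'I_k -> bool} |
  [exists f in H j, k%:R * (eps / 4) < `|sign_sum sg (gap R f)|]].
apply: (@le_trans _ _ (\sum_j #|bad j|)%:R).
  rewrite ler_nat; apply: leq_trans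
    (leq_trans (card_exists_le (fun j => mem (bad j))) _).
    apply/subset_leq_card/fintype.subsetP => sg;
      rewrite inE => /asboolP[p [w [j lt]]].
    rewrite inE; apply/existsP; exists j; rewrite /= inE; apply/exists_inP.
    exists (runs p w j); first by rewrite inE; apply/asboolP; exists p, w.
    rewrite [sign_sum _ _](_ : _ = sign_sum sg (fun i =>
      alloc_prob (x i true) p (fun=> noise_rule L w) j -
      alloc_prob (x i false) p (fun=> noise_rule L w) j)) //.
    by apply: eq_bigr => i _; rewrite /gap !freqE.
  by apply: leq_sum => j _; apply/subset_leq_card/fintype.subsetP => sg;
    rewrite inE.
have m_gt0R : 0 < m%:R :> R by rewrite ltr0n.
have le1 j : #|bad j|%:R <= 2 ^+ k * (delta / 2) / m%:R.
  have [M le] := ex j; apply: le_trans le _;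
    rewrite -mulrA ler_wpM2l ?exprn_ge0 //.
  by rewrite ler_pdivlMr // mulrC; apply: sum_chain_bound.
rewrite natr_sum; apply: le_trans (ler_sum _ (fun j _ => le1 j)) _.
by rewrite sumr_const card_ord -[leLHS]mulr_natl mulrCA divff ?mulr1 // gt_eqF.
Qed.

End MarketSigns.

(** * The procedure *)

Local Open Scope classical_set_scope.
Local Open Scope ring_scope.

Lemma measurable_fun_coord (R : realType) (T : pointedType) (I : Type)
    (c : I -> T -> R) d (X : measurableType d)
    (f : X -> g_sigma_algebraType (coord_sets c)) :
  (forall i, measurable_fun [set: X] (fun x => c i (f x))) ->
    measurable_fun [set: X] f.
Proof.
move=> mf; apply: (@measurability _ _ X (g_sigma_algebraType (coord_sets c))
  setT f (coord_sets c) erefl) => _ [_ [i _ [B mB <-]] <-].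
exact: mf.
Qed.

Lemma measurable_first_choice d d'
    (X : measurableType d) (Y : measurableType d')
    (y : nat -> X -> Y) (g : nat -> X -> bool) :
  (forall t, measurable_fun [set: X] (y t)) ->
  (forall t, measurable [set x | g t x]) ->
  (forall x, exists t, g t x) ->
  exists2 f : X -> Y, measurable_fun [set: X] f &
    forall x, exists2 t, g t x & f x = y t x.
Proof.
move=> my mg ex; pose first x := ex_minn (ex x).
have firstP x : g (first x) x /\ forall t, g t x -> (first x <= t)%N.
  by rewrite /first; case: ex_minnP => t gt tmin; split.
exists (fun x => y (first x) x); last first.
  by move=> x; exists (first x); have [] := firstP x.
move=> _ B mB; rewrite setTI.
rewrite (_ : _ @^-1` _ = \bigcup_t ([set x | g t x] `&`
    \bigcap_(s in [set s | (s < t)%N]) ~` [set x | g s x] `&` (y t @^-1` B))).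
  apply: bigcupT_measurable => t; apply: measurableI.
    apply: measurableI; first exact: mg.
    by apply: bigcap_measurableType => s _; exact/measurableC/mg.
  by rewrite -[X in measurable X]setTI; exact: my.
apply/seteqP; split => x /=.
  move=> Bx; exists (first x) => //; have [gx xmin] := firstP x; split=> //;
    split=> // s /= s_lt gs.
  by have := xmin _ gs; rewrite leqNgt s_lt.
move=> [t _ [[gt nlt] Bt]]; suff -> : first x = t by [].
have [gx xmin] := firstP x; apply/eqP; rewrite eqn_leq xmin // leqNgt.
by apply/negP => lt; exact: (nlt _ lt).
Qed.

Section MeasurableCandidates.
Variables (R : realType) (k n m L : nat).

Local Notation sample := (k.-tuple (profileType R n m)).

Lemma measurable_candidate (q : candidate_index k n m L) :
  measurable_fun [set: sample]
  (fun S => candidate q (tnth S) : outputType R n m).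
Proof.
have mtie t : measurable_fun [set: sample] (fun S =>
  tie_values (tnth S : 'I_k -> 'I_n -> valuation R m) 0 t).
  rewrite (_ : (fun S => _) = (fun S : sample =>
    match (enum_val t : tie_index k n m) with
      | inl abb => (tnth S abb.1.1.1 : 'I_n ->
        valuation R m) abb.1.1.2 abb.1.2 -
                   (tnth S abb.1.1.1 : 'I_n -> valuation R m) abb.1.1.2 abb.2
      | inr _ => 0
      end)); last by apply/funext => S; rewrite mxE.
  case: (enum_val t) => [[[[a i] B] B']|l]; last exact: measurable_cst.
  have mv S : measurable_fun [set: sample] (fun x =>
    (tnth x a : 'I_n -> valuation R m) i S).
    exact: (measurableT_comp (measurable_coord (c :=
      @profile_coord R n m) (i, S)) (measurable_tnth a)).
  exact: measurable_funB.
apply: measurable_fun_pair; last first.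
  by apply: measurable_fun_coord => -[[i DD] B]; exact: measurable_cst.
apply: measurable_fun_coord => j; rewrite /price_coord /=.
apply: measurable_maxr; first exact: measurable_cst.
pose A := kept R q.1.1 *m pinvmx (tie_matrix R k n m *m kept R q.1.1).
pose b := map_mx ratr q.1.2 *m kermx (tie_matrix R k n m *m kept R q.1.1).
rewrite (_ : (fun S => _) = (fun S : sample =>
    (\sum_(t <- enum 'I_#|tie_index k n m|) tie_values (tnth S : 'I_k -> 'I_n ->
      valuation R m) 0 t * A t j) + b 0 j)); last first.
  by apply/funext => S; rewrite /solution mxE -mulmxA [X in X + _]mxE big_enum.
apply: measurable_funD; last exact: measurable_cst.
apply: measurable_sum => t; apply: measurable_funM;
  [exact: mtie|exact: measurable_cst].
Qed.

Definition empirical (S : sample) (y : outputType R n m) (j : 'I_m) : R :=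
  (\sum_a alloc_prob (tnth S a : 'I_n -> valuation R m) y.1 y.2 j) / k%:R.

Lemma measurable_empirical d (X : measurableType d) (S : X -> sample)
    (y : X -> outputType R n m) j :
  measurable_fun [set: X] S -> measurable_fun [set: X] y ->
  measurable_fun [set: X] (fun x => empirical (S x) (y x) j).
Proof.
move=> mS my; apply: measurable_funM; last exact: measurable_cst.
rewrite (_ : (fun x => _) = (fun x => \sum_(a <- enum 'I_k)
    alloc_prob (tnth (S x) a : 'I_n -> valuation R m) (y x).1 (y x).2 j));
      last first.
  by apply/funext => x; rewrite big_enum.
apply: measurable_sum => a.
exact: (measurableT_comp (measurable_alloc_prob j)
  (measurable_fun_pair my (measurableT_comp (measurable_tnth a) mS))).
Qed.

(** Outputs the first candidate in the enumeration that passes the empirical test. The form of the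
    rule is recorded because the deviation bound concerns noise rules. *)
Lemma exists_procedure (e : R) : (0 < k)%N -> (0 < n)%N -> (0 < m)%N ->
  tie_weight R n m L <= e -> tie_weight R n m L < 1 / 2 ->
  exists2 yhat : sample -> outputType R n m, measurable_fun [set: sample] yhat &
  forall S, (forall j, `|empirical S (yhat S) j - 1 / 2| <= e) /\
    exists w, (yhat S).2 = fun=> noise_rule L w.
Proof.
move=> k_gt0 n_gt0 m_gt0 le_e small.
pose Q := candidate_index k n m L.
pose y t (S : sample) : outputType R n m :=
  if unpickle t is Some q then candidate (q : Q) (tnth S) else point.
pose g t (S : sample) := (unpickle t != None :> option Q) &&
  [forall j, `|empirical S (y t S) j - 1 / 2| <= e].
have my t : measurable_fun [set: sample] (y t).
  rewrite /y; case: (unpickle t) => [q|];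
    [exact: measurable_candidate|exact: measurable_cst].
have mg t : measurable [set S | g t S].
  rewrite /g; case: (unpickle t) => [q|] /=; last first.
    by rewrite (_ : [set _ | _] = set0) //; apply/seteqP; split.
  rewrite (_ : [set _ | _] = [set S | forall j,
    `|empirical S (y t S) j - 1 / 2| <= e]); last first.
    by apply/seteqP; split => S /= /forallP.
  apply: measurable_forall => j.
  have mabs : measurable_fun [set: sample] (fun S =>
    `|empirical S (y t S) j - 1 / 2|).
    apply: measurableT_comp; first exact: normr_measurable.
    by apply: measurable_funB; [apply: measurable_empirical|exact:
      measurable_cst].
  by rewrite -[X in measurable X]setTI; apply: measurable_fun_le => //;
    exact: measurable_cst.
have ex S : exists t, g t S.
  have [q qP] := candidate_complete (tnth S : 'I_k -> 'I_n ->
    valuation R m) k_gt0 n_gt0 m_gt0 small.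
  exists (pickle q); rewrite /g /y pickleK /=; apply/forallP => j.
  exact: le_trans (qP j) le_e.
have [f mf fP] := measurable_first_choice my mg ex.
exists f => // S; have [t /andP[q_some /forallP gt] ->] := fP S; split => //.
rewrite /y; case: (unpickle t) q_some => // q _.
by exists (rep_code R q.2).
Qed.

End MeasurableCandidates.

(** * Ghost samples *)

Section IidDeviation.
Context (R : realType) d d' (Omega : measurableType d) (T : measurableType d').
Variables (P : probability Omega R) (D : probability T R) (k : nat).
Variables (X : 'I_k -> {RV P >-> T}) (f : T -> R).
Hypotheses (iidX : independent_samples D X) (mf : measurable_fun [set: T] f).
Hypothesis f01 : forall t, 0 <= f t <= 1.

Let f_ge0 t : 0 <= f t. Proof. by case/andP: (f01 t). Qed.

Let mX i : measurable_fun [set: Omega] (X i). Proof. exact: measurable_funPT.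
  Qed.

Let mfE : measurable_fun [set: T] (EFin \o f). Proof. exact/measurable_EFinP.
  Qed.

Let mfX i : measurable_fun [set: Omega] (fun w => f (X i w)).
Proof. exact: (measurableT_comp mf). Qed.

Definition mean : R := fine (\int[D]_t (f t)%:E).

Lemma integral01 d1 (S : measurableType d1) (Q : probability S R) (g : S -> R) :
  measurable_fun [set: S] g -> (forall s, 0 <= g s <= 1) ->
  exists2 r, 0 <= r <= 1 & (\int[Q]_s (g s)%:E = r%:E)%E.
Proof.
move=> mg g01; have I0 : (0 <= \int[Q]_s (g s)%:E)%E.
  by apply: integral_ge0 => s _; rewrite lee_fin; case/andP: (g01 s).
have I1 : (\int[Q]_s (g s)%:E <= 1)%E.
  have -> : 1%E = (\int[Q]_s (cst 1 s))%E.
    by rewrite integral_cst // mul1e; apply/esym; exact: probability_setT.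
  apply: ge0_le_integral => //; try by move=> s _; rewrite lee_fin;
    case/andP: (g01 s).
  exact/measurable_EFinP.
have Ifin : (\int[Q]_s (g s)%:E)%E \is a fin_num.
  by rewrite ge0_fin_numE // (le_lt_trans I1) // ltry.
exists (fine (\int[Q]_s (g s)%:E)); last by rewrite fineK.
by rewrite -!lee_fin fineK // I0 I1.
Qed.

Let meanE : (\int[D]_t (f t)%:E = mean%:E)%E.
Proof. by have [r _ E] := integral01 D mf f01; rewrite /mean E. Qed.

Lemma mean01 : 0 <= mean <= 1.
Proof. by have [r r01 E] := integral01 D mf f01; rewrite /mean E. Qed.

Let integral_one i : (\int[P]_w (f (X i w))%:E = mean%:E)%E.
Proof.
rewrite -meanE -[LHS](@ge0_integral_distribution _ _ _ _ _ P (X i) (EFin \o f))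
  //.
by apply: eq_measure_integral => A mA _; exact: iidX.1.
Qed.

Let integral_two i j : i != j ->
  (\int[P]_w (f (X i w) * f (X j w))%:E = (mean * mean)%:E)%E.
Proof.
move=> ij; pose phi w := (X i w, X j w).
have mphi : measurable_fun [set: Omega] phi by exact: measurable_fun_pair.
pose phim : {mfun Omega >-> (T * T)%type} :=
  HB.pack phi (isMeasurableFun.Build _ _ _ _ _ mphi).
have rect (A B : set T) : measurable A -> measurable B ->
    distribution P phim (A `*` B) = (D A * D B)%E.
  move=> mA mB; rewrite -(iidX.1 i A mA) -(iidX.1 j B mB).
  (* Filling the other coordinates with the full set extracts pairwise from joint independence. *)
  pose C l : set T := if l == i then A else if l == j then B else setT.
  have mC l : measurable (C l) by rewrite /C; case: ifP => // _; case: ifP.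
  have := iidX.2 C mC; rewrite (bigD1 i) //= (bigD1 j) 1?eq_sym //= big1 ?mule1.
    rewrite /C eqxx eq_sym (negbTE ij) eqxx => <-; congr (P _).
    apply/seteqP; split => w /=.
      by move=> [Aw Bw] l _ /=; case: eqVneq => [->//|_]; case: eqVneq => [->|].
    move=> H; split; first by have := H i I; rewrite /= eqxx.
    by have := H j I; rewrite /= eq_sym (negbTE ij) eqxx.
  by move=> l /andP[/negbTE li /negbTE lj];
    rewrite /C li lj preimage_setT probability_setT.
have law := product_measure_unique (m' := distribution P phim) rect.
pose g (z : T * T) := (f z.1 * f z.2)%:E.
have mg : measurable_fun [set: T * T] g.
  by apply/measurable_EFinP/measurable_funM; exact: measurableT_comp.
have g0 z : (0 <= g z)%E by rewrite lee_fin mulr_ge0.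
rewrite -[LHS](@ge0_integral_distribution _ _ _ _ _ P phim g) //.
rewrite (eq_measure_integral (D \x D)%E); last by move=> A mA _; apply/esym;
  exact: law.
rewrite fubini_tonelli1 //; have m01 := mean01;
  have m0 : 0 <= mean by case/andP: m01.
rewrite /fubini_F /g /=.
transitivity (\int[D]_x (mean%:E * (f x)%:E))%E.
  apply: eq_integral => x _.
  transitivity (\int[D]_y ((f x)%:E * (f y)%:E))%E; first exact: eq_integral.
  rewrite ge0_integralZl_EFin // ?meanE 1?muleC //.
  by move=> y _; rewrite lee_fin.
by rewrite ge0_integralZl_EFin // ?meanE // => x _; rewrite lee_fin.
Qed.

(** The variance of the sum is at most [k]: pairwise independence removes the cross terms, and
    [f ^ 2 <= f] bounds the diagonal. *)
Lemma iid_second_moment :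
  (\int[P]_w ((\sum_i f (X i w) - k%:R * mean) ^+ 2)%:E <= k%:R%:E)%E.
Proof.
have /andP[mu0 mu1] := mean01.
pose S w := \sum_i f (X i w).
have mS : measurable_fun [set: Omega] S.
  rewrite (_ : S = fun w => \sum_(i <- enum 'I_k) f (X i w));
    last by apply/funext => w; rewrite big_enum.
  by apply: measurable_sum => i; exact: mfX.
have S0 w : 0 <= S w by apply: sumr_ge0 => i _.
have intS : (\int[P]_w (S w)%:E = (k%:R * mean)%:E)%E.
  transitivity (\int[P]_w (\sum_(i <- enum 'I_k) (f (X i w))%:E))%E.
    by apply: eq_integral => w _; rewrite sumEFin big_enum.
  rewrite ge0_integral_sum //.
  - by under eq_bigr do rewrite integral_one;
    rewrite sumEFin big_enum /= sumr_const card_ord mulr_natl.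
  - by move=> i; apply/measurable_EFinP; exact: mfX.
  - by move=> i w _; rewrite lee_fin.
have term i j : (\int[P]_w (f (X i w) * f (X j w))%:E <=
    (mean ^+ 2 + (i == j)%:R * (mean - mean ^+ 2))%:E)%E.
  have [->|ij] := eqVneq i j; last by rewrite integral_two // mul0r addr0 expr2.
  rewrite mul1r addrC subrK -(integral_one j); apply: ge0_le_integral => //.
  - by move=> w _; rewrite lee_fin mulr_ge0.
  - by apply/measurable_EFinP; exact: measurable_funM.
  - by apply/measurable_EFinP; exact: mfX.
  - by move=> w _; rewrite lee_fin ler_piMl //; case/andP: (f01 (X j w)).
have intS2 : (\int[P]_w (S w ^+ 2)%:E <=
    ((k%:R * mean) ^+ 2 + k%:R * (mean - mean ^+ 2))%:E)%E.
  have -> : (\int[P]_w (S w ^+ 2)%:E =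
      \int[P]_w (\sum_(i <- enum 'I_k) \sum_(j <- enum 'I_k)
        (f (X i w) * f (X j w))%:E))%E.
    apply: eq_integral => w _; under eq_bigr do rewrite sumEFin.
    rewrite sumEFin big_enum /= expr2 /S mulr_suml; congr _%:E;
      apply: eq_bigr => i _.
    by rewrite big_enum mulr_sumr.
  have mff i j : measurable_fun [set: Omega] (fun w =>
    (f (X i w) * f (X j w))%:E).
    by apply/measurable_EFinP; exact: measurable_funM.
  rewrite ge0_integral_sum //; last 2 first.
  - by move=> i; apply: emeasurable_sum => j.
  - by move=> i w _; apply: sume_ge0 => j _; rewrite lee_fin mulr_ge0.
  apply: (@le_trans _ _ (\sum_(i <- enum 'I_k) \sum_(j <- enum 'I_k)
      (mean ^+ 2 + (i == j)%:R * (mean - mean ^+ 2))%:E)%E).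
    apply: lee_sum => i _; rewrite ge0_integral_sum //;
      first by apply: lee_sum => j _; exact: term.
    by move=> j w _; rewrite lee_fin mulr_ge0.
  under eq_bigr do rewrite sumEFin; rewrite sumEFin lee_fin big_enum /=.
  under eq_bigr do rewrite big_enum big_split /= sumr_const card_ord -mulr_suml.
  rewrite big_split /= sumr_const card_ord -mulr_suml.
  have -> : \sum_(i < k) \sum_(j < k) (i == j)%:R = k%:R :> R.
    rewrite -[k in RHS]card_ord -sumr_const; apply: eq_bigr => i _.
    by rewrite (bigD1 i) //= eqxx big1 ?addr0 // => j;
      rewrite eq_sym => /negbTE->.
  rewrite -[mean ^+ 2 *+ k]mulr_natl -[k%:R * _ *+ k]mulr_natl le_eqVlt.
  by apply/orP; left; apply/eqP; ring.
have c0 : 0 <= 2 * (k%:R * mean) by rewrite !mulr_ge0.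
(* The cross term of the square is moved to the other side, so that only nonnegative functions are
   integrated. *)
have expand : (\int[P]_w ((S w - k%:R * mean) ^+ 2)%:E
  + (2 * (k%:R * mean) * (k%:R * mean))%:E =
    \int[P]_w (S w ^+ 2)%:E + ((k%:R * mean) ^+ 2)%:E)%E.
  rewrite [X in (_ + X)%E](_ : _
    = \int[P]_w ((2 * (k%:R * mean))%:E * (S w)%:E))%E; last first.
    rewrite ge0_integralZl_EFin // ?intS //; first by move=> w _;
      rewrite lee_fin.
    exact/measurable_EFinP.
  rewrite [X in (_ = _ + X)%E](_ : _ = \int[P]_w (((k%:R * mean) ^+ 2)%:E))%E;
    last first.
    by rewrite integral_cst // [X in (_ * X)%E](_ : _ = 1%E) ?mule1 //;
      exact: probability_setT.
  rewrite -!ge0_integralD //.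
  - by apply: eq_integral => w _; rewrite -EFinM -!EFinD; congr _%:E; ring.
  - by move=> w _; rewrite lee_fin exprn_ge0.
  - by apply/measurable_EFinP; exact: measurable_funX.
  - by move=> w _; rewrite lee_fin exprn_ge0 // mulr_ge0.
  - by move=> w _; rewrite lee_fin sqr_ge0.
  - by apply/measurable_EFinP; apply: measurable_funX;
    apply: measurable_funB => //; exact: measurable_cst.
  - by move=> w _; rewrite -EFinM lee_fin mulr_ge0.
  - by apply/measurable_EFinP; apply: measurable_funM => //;
    exact: measurable_cst.
apply: (@le_trans _ _ (((k%:R * mean) ^+ 2 + k%:R * (mean - mean ^+ 2))
  + (k%:R * mean) ^+ 2
    - 2 * (k%:R * mean) * (k%:R * mean))%:E); last first.
  have k0 : 0 <= k%:R :> R by [].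
  have h : k%:R * (mean - mean ^+ 2) <= k%:R * 1 by rewrite ler_wpM2l //; nra.
  rewrite lee_fin; move: h; rewrite mulr1 => h.
  by apply: le_trans h; rewrite le_eqVlt; apply/orP; left; apply/eqP; ring.
rewrite EFinB leeBrDr // expand EFinD.
by apply: leeD.
Qed.

Lemma iid_deviation (t : R) : 0 < t -> 2 <= k%:R * t ^+ 2 ->
  (P [set w | (t < `|(\sum_i f (X i w)) / k%:R - mean|)%R] <= (1 / 2)%:E)%E.
Proof.
move=> t_gt0 kt.
have k_gt0 : 0 < k%:R :> R.
  by rewrite lt0r; apply/andP; split=> //; apply: contraTneq kt => ->;
    rewrite mul0r -ltNge.
set A := [set w | _].
have msum : measurable_fun [set: Omega] (fun w => \sum_i f (X i w)).
  rewrite (_ : (fun w => _) = fun w => \sum_(i <- enum 'I_k) f (X i w));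
    last by apply/funext => w; rewrite big_enum.
  by apply: measurable_sum => i; exact: mfX.
have mS : measurable_fun [set: Omega] (fun w => \sum_i f (X i w) - k%:R * mean).
  by apply: measurable_funB => //; exact: measurable_cst.
have mA : measurable A.
  rewrite (_ : A = ~` [set w | `|(\sum_i f (X i w)) / k%:R - mean| <= t]);
    last first.
    by apply/seteqP; split => w; rewrite /A /= ltNge => /negP.
  apply: measurableC; rewrite -[X in measurable X]setTI.
  apply: measurable_fun_le => //.
  apply: measurableT_comp; first exact: normr_measurable.
  apply: measurable_funB; last exact: measurable_cst.
  by apply: measurable_funM; last exact: measurable_cst.
have : (((k%:R * t) ^+ 2)%:E * P A <= k%:R%:E)%E.
  apply: le_trans iid_second_moment.
  have -> : (P A = \int[P]_w (\1_A w)%:E)%E by rewrite integral_indic // setIT.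
  rewrite -ge0_integralZl_EFin //; last 2 first.
  - by apply/measurable_EFinP; exact: measurable_indic.
  - by rewrite exprn_ge0 // mulr_ge0 // ltW.
  apply: ge0_le_integral => //.
  - by move=> w _; rewrite -EFinM lee_fin mulr_ge0 // exprn_ge0 // mulr_ge0 //
    ltW.
  - by apply/measurable_EFinP/measurable_funM;
    [exact: measurable_cst|exact: measurable_indic].
  - by apply/measurable_EFinP; exact: measurable_funX.
  move=> w _; rewrite -EFinM lee_fin indicE;
    have [/set_mem Aw|] := boolP (w \in A); last by rewrite mulr0 sqr_ge0.
  have kt_le : k%:R * t <= `|\sum_i f (X i w) - k%:R * mean|.
    have -> : \sum_i f (X i w) - k%:R * mean
      = k%:R * ((\sum_i f (X i w)) / k%:R - mean).
      by rewrite mulrBr mulrCA divff ?mulr1 // gt_eqF.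
    by rewrite normrM gtr0_norm // ler_pM2l // ltW.
  rewrite mulr1 -[leRHS]real_normK ?num_real //; apply: lerXn2r kt_le;
    rewrite nnegrE //.
  by rewrite mulr_ge0 // ltW.
have Afin : P A \is a fin_num by exact: fin_num_measure.
rewrite -(fineK Afin) -EFinM !lee_fin => H.
have P0 : 0 <= fine (P A) by exact: fine_ge0.
rewrite -(ler_pM2l k_gt0); apply: le_trans (_ :
  1 / 2 * ((k%:R * t) ^+ 2 * fine (P A)) <= _); last by lra.
have : k%:R * fine (P A) * 2
  <= k%:R * fine (P A) * (k%:R * t ^+ 2) by rewrite ler_wpM2l // mulr_ge0.
have -> : (k%:R * t) ^+ 2 * fine (P A)
  = k%:R * fine (P A) * (k%:R * t ^+ 2) by ring.
by lra.
Qed.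

End IidDeviation.

Section IidLaw.
Context (R : realType) d' (T : measurableType d') (D : probability T R) (N :
  nat).

Definition box (B : 'I_N -> set T) : set (N.-tuple T) :=
  \bigcap_(i in [set: 'I_N]) ((fun z => tnth z i) @^-1` B i).

Lemma measurable_tupleE : measurable =
  <<s [set M : set (N.-tuple T) | exists2 B, (forall i, measurable (B i)) & M
    = box B] >>.
Proof.
apply/seteqP; split.
  apply: smallest_sub; first exact: smallest_sigma_algebra.
  move=> M; rewrite -bigcup_seq => -[i _ [A mA <-]].
  apply: sub_sigma_algebra; exists (fun j => if j == i then A else setT).
    by move=> j; case: ifP.
  rewrite setTI; apply/seteqP; split => z /= H.
    by move=> j _ /=; case: eqVneq => [->|].
  by have := H i I; rewrite /= eqxx.
apply: smallest_sub; first exact: sigma_algebra_measurable.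
move=> _ [B mB ->]; apply: fin_bigcap_measurable => [|i _];
  first exact: finite_finset.
by rewrite -[X in measurable X]setTI; exact: measurable_tnth.
Qed.

Lemma measurable_mk_tuple d (Omega : measurableType d) (x : 'I_N -> Omega ->
  T) :
  (forall i, measurable_fun [set: Omega] (x i)) ->
  measurable_fun [set: Omega] (fun w => [tuple x i w | i < N]).
Proof.
move=> mx; apply/measurable_fun_tnthP => i.
by rewrite (_ : _ \o _ = x i) //; apply/funext => w; rewrite /= tnth_mktuple.
Qed.

(** Both laws agree on boxes, which are closed under intersection and generate the sigma-algebra.
    This is what allows swapping entries of the double sample. *)
Lemma iid_law d1 d2 (O1 : measurableType d1) (O2 : measurableType d2)
    (P1 : probability O1 R) (P2 : probability O2 R)
    (X1 : 'I_N -> {RV P1 >-> T}) (X2 : 'I_N ->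
      {RV P2 >-> T}) (M : set (N.-tuple T)) :
  independent_samples D X1 -> independent_samples D X2 -> measurable M ->
  P1 [set w | M [tuple X1 i w | i < N]] = P2 [set w | M [tuple X2 i w | i < N]].
Proof.
move=> iid1 iid2 mM.
have m1 : measurable_fun [set: O1] (fun w => [tuple X1 i w | i < N]).
  by apply: measurable_mk_tuple => i; exact: measurable_funPT.
have m2 : measurable_fun [set: O2] (fun w => [tuple X2 i w | i < N]).
  by apply: measurable_mk_tuple => i; exact: measurable_funPT.
pose Z1 : {mfun O1 >-> N.-tuple T} := HB.pack (fun w => [tuple X1 i w | i < N])
  (isMeasurableFun.Build _ _ _ _ _ m1).
pose Z2 : {mfun O2 >-> N.-tuple T} := HB.pack (fun w => [tuple X2 i w | i < N])
  (isMeasurableFun.Build _ _ _ _ _ m2).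
have lawE d (O : measurableType d) (P : probability O R) (X : 'I_N ->
  {RV P >-> T}) B :
    independent_samples D X -> (forall i, measurable (B i)) ->
    P [set w | box B [tuple X i w | i < N]] = (\prod_i D (B i))%E.
  move=> iidX mB; rewrite (_ : [set w | _]
    = \bigcap_(i in [set: 'I_N]) (X i @^-1` B i)).
    by rewrite iidX.2 //; apply: eq_bigr => i _; exact: iidX.1.
  by apply/seteqP; split => w /= H i _; have := H i I; rewrite /= tnth_mktuple.
apply: (@measure_unique _ _ _ _ (fun=> setT) measurable_tupleE _ _ _
  (distribution P1 Z1) (distribution P2 Z2)) => //.
- move=> _ _ [A mA ->] [B mB ->]; exists (fun i => A i `&` B i).
    by move=> i; exact: measurableI.
  apply/seteqP; split => z.
    by move=> [Az Bz] i _; split; [exact: (Az i I)|exact: (Bz i I)].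
  by move=> H; split => i _; case: (H i I).
- move=> _; exists (fun=> setT) => //; apply/seteqP; split => //.
- by apply/seteqP; split => // z _; exists 0%N.
- move=> _ [B mB ->]; rewrite /distribution /pushforward.
  by rewrite -[LHS]/(P1 [set w | box B [tuple X1 i w | i < N]])
    -[RHS]/(P2 [set w | box B [tuple X2 i w | i < N]]) !lawE.
- by move=> _; rewrite (le_lt_trans (probability_le1 _ _)) // ltry.
Qed.

End IidLaw.

Section DoubleSample.
Context (R : realType) d d' (Omega : measurableType d) (T : measurableType d').
Variables (P : probability Omega R) (D : probability T R) (k : nat).
Variable X : 'I_k -> {RV P >-> T}.
Hypothesis iidX : independent_samples D X.

Let PP : probability (Omega * Omega)%type R := (P \x P)%E.

Definition pair_entry (u : 'I_(k + k)) (w : Omega * Omega) : T :=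
  match fintype.split u with inl i => X i w.1 | inr i => X i w.2 end.

Definition swap_halves (sg : {ffun 'I_k -> bool}) (u : 'I_(k + k)) :
  'I_(k + k) :=
  match fintype.split u with
  | inl i => if sg i then rshift k i else lshift k i
  | inr i => if sg i then lshift k i else rshift k i
  end.

Let splitl i : fintype.split (lshift k i) = inl i :> 'I_k + 'I_k.
Proof. exact: (unsplitK (inl i)). Qed.

Let splitr i : fintype.split (rshift k i) = inr i :> 'I_k + 'I_k.
Proof. exact: (unsplitK (inr i)). Qed.

Lemma swap_halvesK sg : involutive (swap_halves sg).
Proof.
by move=> u; rewrite /swap_halves; case: (split_ordP u) => i ->;
  rewrite ?splitl ?splitr; case sgi: (sg i); rewrite ?splitl ?splitr sgi.
Qed.

Lemma pair_entry_swap sg i w :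
  pair_entry (swap_halves sg (lshift k i)) w
    = X i (if sg i then w.2 else w.1) /\
  pair_entry (swap_halves sg (rshift k i)) w = X i (if sg i then w.1 else w.2).
Proof.
by rewrite /pair_entry /swap_halves splitl splitr; case: (sg i);
  rewrite splitl splitr.
Qed.

Lemma measurable_pair_entry u :
  measurable_fun [set: Omega * Omega] (pair_entry u).
Proof.
rewrite /pair_entry; case: (fintype.split u) => i.
  exact: (measurableT_comp (measurable_funPT (X i)) measurable_fst).
exact: (measurableT_comp (measurable_funPT (X i)) measurable_snd).
Qed.

Definition pair_sample u : {RV PP >-> T} := HB.pack (pair_entry u)
  (isMeasurableFun.Build _ _ _ _ _ (measurable_pair_entry u)).

Let pair_law u B : measurable B -> PP (pair_sample u @^-1` B) = D B.
Proof.
move=> mB; rewrite -[X in PP X]/(pair_entry u @^-1` B) /pair_entry.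
have mX i : measurable (X i @^-1` B).
  by rewrite -[X in measurable X]setTI; exact: measurable_funPT.
case: (fintype.split u) => i; rewrite -(iidX.1 i B mB).
  rewrite (_ : _ @^-1` _ = (X i @^-1` B) `*` setT); last first.
    by apply/seteqP; split => w //= -[].
  rewrite -[LHS]/((P \x P)%E ((X i @^-1` B) `*` setT)) product_measure1E //.
  by rewrite [X in (_ * X)%E](_ : _ = 1%E) ?mule1 //; exact: probability_setT.
rewrite (_ : _ @^-1` _ = setT `*` (X i @^-1` B)); last first.
  by apply/seteqP; split => w //= -[].
rewrite -[LHS]/((P \x P)%E (setT `*` (X i @^-1` B))) product_measure1E //.
by rewrite [X in (X * _)%E](_ : _ = 1%E) ?mul1e //; exact: probability_setT.
Qed.

Lemma swapped_iid sg : independent_samples D (fun u =>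
  pair_sample (swap_halves sg u)).
Proof.
split=> [u B mB|B mB]; first exact: pair_law.
under eq_bigr do rewrite pair_law //.
have sB : \bigcap_(u in [set: 'I_(k + k)])
  (pair_sample (swap_halves sg u) @^-1` B u) =
    (\bigcap_(i in [set: 'I_k]) (X i @^-1` B (swap_halves sg (lshift k i)))) `*`
    (\bigcap_(i in [set: 'I_k]) (X i @^-1` B (swap_halves sg (rshift k i)))).
  apply/seteqP; split => w.
    move=> H; split=> i _ /=.
      by have := H (swap_halves sg (lshift k i)) I;
        rewrite /= swap_halvesK /pair_entry splitl.
    by have := H (swap_halves sg (rshift k i)) I;
      rewrite /= swap_halvesK /pair_entry splitr.
  move=> [H1 H2] u _; have := swap_halvesK sg u; rewrite /preimage /=.
  move: (swap_halves sg u) => u' <-; rewrite /pair_entry.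
  by case: (split_ordP u') => i ->; [exact: (H1 i I)|exact: (H2 i I)].
have mX (f : 'I_k -> 'I_(k + k)) :
  measurable (\bigcap_(i in [set: 'I_k]) (X i @^-1` B (f i))).
  apply: fin_bigcap_measurable => [|i _]; first exact: finite_finset.
  by rewrite -[X in measurable X]setTI; exact: measurable_funPT.
rewrite sB; transitivity
  (P (\bigcap_(i in [set: 'I_k]) (X i @^-1` B (swap_halves sg (lshift k i)))) *
   P (\bigcap_(i in [set: 'I_k])
     (X i @^-1` B (swap_halves sg (rshift k i)))))%E.
  exact: product_measure1E.
rewrite !iidX.2 //.
rewrite (reindex_inj (inv_inj (swap_halvesK sg))) /= big_split_ord /=.
by congr (_ * _)%E; apply: eq_bigr => i _; exact: iidX.1.
Qed.

End DoubleSample.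

(** * Symmetrization by swaps with a ghost sample *)

Section GhostSample.
Context (R : realType) d d1 d2 (Omega : measurableType d) (T :
  measurableType d1)
  (Y : measurableType d2).
Variables (P : probability Omega R) (D : probability T R) (k : nat).
Variable X : 'I_k -> {RV P >-> T}.
Hypothesis iidX : independent_samples D X.
Variables (J : finType) (F : J -> Y -> T -> R) (yhat : k.-tuple T ->
  Y) (eps delta : R).
Hypothesis mF : forall j, measurable_fun [set: Y * T] (fun w => F j w.1 w.2).
Hypothesis F_ge0 : forall j y t, 0 <= F j y t.
Hypothesis F_le1 : forall j S t, F j (yhat S) t <= 1.
Hypothesis myhat : measurable_fun [set: k.-tuple T] yhat.
Hypotheses (eps_gt0 : 0 < eps) (k_large : 32 <= k%:R * eps ^+ 2).
Hypothesis signs : forall x : 'I_k -> bool -> T,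
  #|[set sg : {ffun 'I_k -> bool} | `[< exists S j, k%:R * (eps / 4) <
      `|sign_sum sg (fun i => F j (yhat S) (x i true)
        - F j (yhat S) (x i false))| >]]%SET|%:R
  <= 2 ^+ k * (delta / 2).

Let avg j (y : Y) (z : k.-tuple T) : R := (\sum_i F j y (tnth z i)) / k%:R.

Let sample w := [tuple X i w | i < k].

Let bad : set Omega := [set w | exists j,
  eps / 2 < `|avg j (yhat (sample w)) (sample w)
    - mean D (F j (yhat (sample w)))|].

Let half1 (z : (k + k).-tuple T) := [tuple tnth z (lshift k i) | i < k].
Let half2 (z : (k + k).-tuple T) := [tuple tnth z (rshift k i) | i < k].

Let gapped : set ((k + k).-tuple T) := [set z | exists j,
  eps / 4 < `|avg j (yhat (half1 z)) (half1 z)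
    - avg j (yhat (half1 z)) (half2 z)|].

Let k_gt0 : 0 < k%:R :> R.
Proof.
rewrite lt0r; apply/andP; split=> //; apply: contraTneq k_large => ->.
by rewrite mul0r -ltNge.
Qed.

Let msample : measurable_fun [set: Omega] sample.
Proof. by apply: measurable_mk_tuple => i; exact: measurable_funPT. Qed.

Let mFy j y : measurable_fun [set: T] (F j y).
Proof.
have my : measurable_fun [set: T] (fun t =>
  (y, t)) by exact: measurable_fun_pair.
exact: (measurableT_comp (mF j) my).
Qed.

Let mavg d3 (S : measurableType d3) j (y : S -> Y) (z : S -> k.-tuple T) :
  measurable_fun [set: S] y -> measurable_fun [set: S] z ->
  measurable_fun [set: S] (fun s => avg j (y s) (z s)).
Proof.
move=> my mz; apply: measurable_funM; last exact: measurable_cst.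
rewrite (_ : (fun s => _) = (fun s =>
  \sum_(i <- enum 'I_k) F j (y s) (tnth (z s) i))).
  apply: measurable_sum => i.
  exact: (measurableT_comp (mF j)
    (measurable_fun_pair my (measurableT_comp (measurable_tnth i) mz))).
by apply/funext => s; rewrite big_enum.
Qed.

Let avg_sample j y w : avg j y (sample w) = (\sum_i F j y (X i w)) / k%:R.
Proof. by rewrite /avg; under eq_bigr do rewrite tnth_mktuple. Qed.

Let measurable_exists_gt d3 (S : measurableType d3) (c : R) (g : J -> S -> R) :
  (forall j, measurable_fun [set: S] (g j)) ->
    measurable [set s | exists j, c < `|g j s|].
Proof.
move=> mg; rewrite (_ : [set s | _] = ~` [set s | forall j, `|g j s| <= c]);
  last first.
  apply/seteqP; split => s /=.
    by move=> [j lt] /(_ j); rewrite leNgt lt.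
  by move=> /existsNP[j /negP]; rewrite -ltNge; exists j.
apply/measurableC/measurable_forall => j; rewrite -[X in measurable X]setTI.
apply: measurable_fun_le => //; apply: measurableT_comp => //.
Qed.

Let mhalf1 : measurable_fun [set: (k + k).-tuple T] half1.
Proof. by apply: measurable_mk_tuple => i; exact: measurable_tnth. Qed.

Let mhalf2 : measurable_fun [set: (k + k).-tuple T] half2.
Proof. by apply: measurable_mk_tuple => i; exact: measurable_tnth. Qed.

Let mgapped : measurable gapped.
Proof.
apply: (@measurable_exists_gt _ _ _ (fun j z =>
  avg j (yhat (half1 z)) (half1 z) - avg j (yhat (half1 z)) (half2 z))) => j.
by apply: measurable_funB; apply: mavg => //; apply: (measurableT_comp myhat).
Qed.

Lemma measurable_mean j : measurable_fun [set: Y] (fun y => mean D (F j y)).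
Proof.
rewrite /mean; apply: (measurableT_comp (fine_measurable measurableT)).
apply: (@measurable_fun_fubini_tonelli_F _ _ _ _ _ D (fun w =>
  (F j w.1 w.2)%:E)).
  by apply/measurable_EFinP; exact: mF.
by move=> w; rewrite lee_fin.
Qed.

Let mbad : measurable bad.
Proof.
apply: (@measurable_exists_gt _ _ _ (fun j w =>
  avg j (yhat (sample w)) (sample w) - mean D (F j (yhat (sample w))))) => j.
have mys : measurable_fun [set: Omega] (fun w =>
  yhat (sample w)) by exact: measurableT_comp.
apply: measurable_funB; first exact: mavg.
exact: (measurableT_comp (measurable_mean j)).
Qed.

Let PP : probability (Omega * Omega)%type R := (P \x P)%E.

Let swapped_event sg : set (Omega * Omega) :=
  [set w | gapped [tuple pair_sample X (swap_halves sg u) w | u < k + k]].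

Let mswapped sg : measurable (swapped_event sg).
Proof.
rewrite -[X in measurable X]setTI.
apply: (measurable_mk_tuple (x := fun u => pair_sample X (swap_halves sg u))) =>
  //.
Qed.

Let swapped_eventE sg w : swapped_event sg w <-> exists j,
  k%:R * (eps / 4) < `|sign_sum sg (fun i =>
    F j (yhat (half1 [tuple pair_sample X (swap_halves sg u) w | u < k + k]))
      (X i w.1) -
    F j (yhat (half1 [tuple pair_sample X (swap_halves sg u) w | u < k + k]))
      (X i w.2))|.
Proof.
rewrite /swapped_event /gapped /=; set z := [tuple pair_sample X _ w | _ < _].
have E j y : k%:R * (avg j y (half1 z) - avg j y (half2 z)) =
    sign_sum sg (fun i => F j y (X i w.1) - F j y (X i w.2)).
  rewrite /avg -mulrBl mulrCA divff ?gt_eqF // mulr1 -sumrB;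
    apply: eq_bigr => i _.
  rewrite !tnth_mktuple; have [El Er] := pair_entry_swap X sg i w.
  rewrite -[pair_sample X _ w]/(pair_entry X (swap_halves sg (lshift k i)) w)
    El.
  rewrite -[pair_sample X _ w]/(pair_entry X (swap_halves sg (rshift k i)) w)
    Er.
  by case: (sg i); rewrite ?expr1 ?expr0 ?mulN1r ?mul1r ?opprB.
split=> -[j lt]; exists j.
  by rewrite -E normrM gtr0_norm // ltr_pM2l.
by move: lt; rewrite -E normrM gtr0_norm // ltr_pM2l.
Qed.

(** All swaps give the event the same probability, so it equals its average over [sg], bounded
    pointwise by [signs]. The output of [yhat] changes with [sg], which is why [signs] ranges over
    every possible output. *)
Let swapped_le : (PP (swapped_event [ffun=> false]) <= (delta / 2)%:E)%E.
Proof.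
have same sg : PP (swapped_event sg) = PP (swapped_event [ffun=> false]).
  exact: (iid_law (swapped_iid iidX sg) (swapped_iid iidX _) mgapped).
have fin : PP (swapped_event [ffun=> false]) \is a fin_num by exact:
  fin_num_measure.
rewrite -(fineK fin) lee_fin; set r := fine _.
have sumE : ((2 ^+ k * r)%:E =
    \int[PP]_w (\sum_(sg <- enum {: {ffun 'I_k -> bool}})
      (\1_(swapped_event sg) w)%:E))%E.
  rewrite ge0_integral_sum //; last first.
    by move=> sg; apply/measurable_EFinP; exact: measurable_indic.
  rewrite (eq_bigr (fun=> r%:E)) => [|sg _]; last first.
    transitivity (PP (swapped_event sg)); last by rewrite same fineK.
    by rewrite integral_indic // setIT.
  by rewrite sumEFin big_enum /= sumr_const card_ffun card_bool card_ord -natrX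
    mulr_natl.
have pointwise w : \sum_(sg <- enum {: {ffun 'I_k -> bool}})
  (\1_(swapped_event sg) w : R)
    <= 2 ^+ k * (delta / 2).
  pose x (i : 'I_k) (c : bool) := if c then X i w.1 else X i w.2.
  apply: le_trans (signs x).
  rewrite big_enum /= -sum1_card natr_sum [leRHS]big_mkcond;
    apply: ler_sum => sg _.
  rewrite indicE inE; case: (boolP (w \in _)) =>
    [/set_mem/swapped_eventE[j lt]|]; last by case: ifP.
  by rewrite (_ : `[< _ >]) //; apply/asboolP; eexists; exists j; exact: lt.
have : ((2 ^+ k * r)%:E <= (2 ^+ k * (delta / 2))%:E)%E.
  rewrite sumE -[leRHS]mule1 -(@probability_setT _ _ _ PP) -integral_cst //.
  apply: ge0_le_integral => //.
  - by move=> w _; apply: sume_ge0 => sg _; rewrite lee_fin.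
  - by apply: emeasurable_sum => sg; apply/measurable_EFinP;
    exact: measurable_indic.
  - by move=> w _; rewrite sumEFin lee_fin.
by rewrite lee_fin ler_pM2l // exprn_gt0.
Qed.

Let ghost_half w : bad w -> ((1 / 2)%:E
  <= P (xsection (swapped_event [ffun=> false]) w))%E.
Proof.
move=> [j lt]; set y := yhat (sample w) in lt.
have F01 t : 0 <= F j y t <= 1 by rewrite F_ge0 F_le1.
have e4_gt0 : 0 < eps / 4 by rewrite divr_gt0.
(* The constant 32 is 2 times 16: the value 2 required for probability one half, at deviation
   [eps / 4]. *)
have e4_large : 2 <= k%:R * (eps / 4) ^+ 2.
  by have := k_large; rewrite !expr2; lra.
have dev := iid_deviation iidX (mFy j y) F01 e4_gt0 e4_large.
set far := [set _ | _] in dev.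
have mfar : measurable far.
  have mF1 : measurable_fun [set: Omega] (fun w' =>
    avg j y (sample w') - mean D (F j y)).
    by apply: measurable_funB => //; apply: mavg => //; exact: measurable_cst.
  rewrite (_ : far = [set w' | eps / 4
    < `|avg j y (sample w') - mean D (F j y)|]); last first.
    by apply/seteqP; split => w'; rewrite /far /= avg_sample.
  rewrite (_ : [set _ | _] = ~`
    [set w' | `|avg j y (sample w') - mean D (F j y)| <= eps / 4]); last first.
    by apply/seteqP; split => w' /=; rewrite ltNge => /negP.
  apply: measurableC; rewrite -[X in measurable X]setTI.
  by apply: measurable_fun_le => //; apply: measurableT_comp.
have half : ((1 / 2)%:E <= P (~` far))%E.
  rewrite probability_setC // leeBrDr; last exact: fin_num_measure.
  apply: le_trans (leeD (lexx _) dev) _.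
  by rewrite -EFinD lee_fin; lra.
apply: le_trans half _; apply: le_measure; rewrite ?inE.
- exact: measurableC.
- exact: measurable_xsection.
move=> w' /= /negP; rewrite -leNgt => near; apply/xsectionP/swapped_eventE;
  exists j.
have h1 : half1 [tuple pair_sample X (swap_halves [ffun=> false] u) (w, w') | u
  < k + k] = sample w.
  apply: eq_from_tnth => i; rewrite !tnth_mktuple.
  have [El _] := pair_entry_swap X [ffun=> false] i (w, w').
  by rewrite -[LHS]/(pair_entry X (swap_halves [ffun=> false] (lshift k i))
    (w, w')) El ffunE.
rewrite h1 -/y /sign_sum.
under eq_bigr do rewrite ffunE expr0 mul1r.
rewrite sumrB /=.
have sE : \sum_i F j y (X i w) = k%:R * avg j y (sample w).
  by rewrite avg_sample mulrCA divff ?mulr1 ?gt_eqF.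
have sE' : \sum_i F j y (X i w') = k%:R * ((\sum_i F j y (X i w')) / k%:R).
  by rewrite mulrCA divff ?mulr1 ?gt_eqF.
rewrite sE sE' -mulrBr normrM gtr0_norm // ltr_pM2l //.
move: near lt; set a := avg _ _ _; set b := _ / _; set c := mean _ _ => near lt.
by have := ler_distD b a c; lra.
Qed.

(* If the sample mean is off by more than [eps / 2], Chebyshev's inequality puts
   the ghost mean within [eps / 4] of the expectation with probability 1/2. *)
Lemma ghost_sample (A : set Omega) : measurable A ->
  (forall w, A w -> exists j, eps / 2 <
    `|(\sum_i F j (yhat [tuple X l w | l < k]) (X i w)) / k%:R
      - mean D (F j (yhat [tuple X l w | l < k]))|) ->
  (P A <= delta%:E)%E.
Proof.
move=> mA Abad; apply: (@le_trans _ _ (P bad)).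
  apply: le_measure; rewrite ?inE //.
  by move=> w /Abad[j lt]; exists j; rewrite avg_sample.
have le1 : ((1 / 2)%:E * P bad <= PP (swapped_event [ffun=> false]))%E.
  have -> : (P bad = \int[P]_w (\1_bad w)%:E)%E by rewrite integral_indic //
    setIT.
  rewrite -ge0_integralZl_EFin //; last by apply/measurable_EFinP;
    exact: measurable_indic.
  apply: ge0_le_integral => //.
  - by apply/measurable_EFinP/measurable_funM;
    [exact: measurable_cst|exact: measurable_indic].
  - exact: measurable_fun_xsection.
  move=> w _; rewrite indicE; have [/set_mem wb|_] := boolP (w \in bad).
    by rewrite mule1; exact: ghost_half.
  by rewrite mule0.
have := le_trans le1 swapped_le;
  have bfin : P bad \is a fin_num by exact: fin_num_measure.
by rewrite -(fineK bfin) -EFinM !lee_fin; lra.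
Qed.

End GhostSample.

(** * Empirical medians combined with uniform deviation *)

Theorem theorem4p14 (R : realType) :
  exists C : R, 0 < C /\
  forall (n m : nat) (eps delta : R) (k : nat),
    (1 <= n)%N -> (1 <= m)%N ->
    0 < eps < 1 / 2 -> 0 < delta < 1 ->
    C / eps ^+ 2 * (m%:R ^+ 2 + m%:R * ln n%:R + ln (1 / delta)) <= k%:R ->
    exists K : R.-pker (k.-tuple (profileType R n m)) ~> (outputType R n m),
    forall D : probability (profileType R n m) R,
    forall (d : measure_display) (Omega : measurableType d)
      (P : probability Omega R) (X : 'I_k -> {RV P >-> profileType R n m}),
      independent_samples D X ->
      ((1 - delta)%:E <=
       output_prob X K
         [set pA | median_prices (1 / 2 - eps) D pA.1 pA.2])%E.
Proof.
exists (16 * (8 * 16 ^+ 3)); split; first by rewrite !mulr_gt0 // exprn_gt0.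
move=> n m eps delta k n_gt0 m_gt0 /andP[eps_gt0 eps_lt] delta01.
have [delta_gt0 delta_lt1] := andP delta01.
rewrite mulrAC ler_pdivrMr ?exprn_gt0 // => k_large.
set lam := _ + ln (1 / delta) in k_large.
have m_ge1 : 1 <= m%:R :> R by rewrite ler1n.
have lam_ge1 : 1 <= lam.
  have h1 : 1 <= m%:R ^+ 2 :> R by rewrite expr2 -[leLHS]mulr1 ler_pM.
  have h2 : 0 <= m%:R * ln n%:R :> R by rewrite mulr_ge0 // ln_ge0 // ler1n.
  have h3 : 0 <= ln (1 / delta) by rewrite ln_ge0 // ler_pdivlMr // mul1r ltW.
  by rewrite /lam; lra.
have k32 : 32 <= k%:R * eps ^+ 2 by apply: le_trans k_large; lra.
have k_gt0 : (0 < k)%N.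
  by rewrite lt0n; apply: contraTneq k32 => ->; rewrite mul0r -ltNge.
(* The grid depends only on [n], [m] and [eps], so it is fixed before the distribution and the
   sample. *)
have [L L_large] : exists L, tie_weight R n m L <= eps / 2.
  pose N0 : R := (n * (2 ^ m * 2 ^ m))%:R.
  exists (Num.bound (2 * N0 / eps));
    rewrite /tie_weight -/N0 ler_pdivrMr ?ltr0n //.
  have := archi_boundP (_ : 0 <= 2 * N0 / eps);
    rewrite divr_ge0 ?mulr_ge0 ?(ltW eps_gt0) // => /(_ isT).
  rewrite ltr_pdivrMr // -[(Num.bound _).+1%:R]natr1;
    set b := (Num.bound _)%:R => lt.
  by lra.
have small : tie_weight R n m L < 1 / 2 by lra.
have [yhat myhat yP] := exists_procedure k_gt0 n_gt0 m_gt0 L_large small.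
(* The procedure is deterministic; randomness remains only inside the choice rules that it
   outputs. *)
exists (kdirac myhat) => D d Omega P X iidX.
pose E : set (outputType R n m) :=
  [set pA | median_prices (1 / 2 - eps) D pA.1 pA.2].
have mE : measurable E by exact: measurable_median_prices.
pose sample w := [tuple X i w | i < k].
have msample : measurable_fun [set: Omega] sample.
  by apply: measurable_mk_tuple => i; exact: measurable_funPT.
have mys : measurable_fun [set: Omega] (fun w =>
  yhat (sample w)) by exact: measurableT_comp.
pose good := (fun w => yhat (sample w)) @^-1` E.
have mgood : measurable good by rewrite -[X in measurable X]setTI; exact: mys.
have -> : output_prob X (kdirac myhat) E = P good.
  rewrite /output_prob /=; transitivity (\int[P]_w (\1_good w)%:E)%E.
    by apply: eq_integral => w _; rewrite /kdirac /= diracE indicE.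
  by rewrite integral_indic // setIT.
pose F (j : 'I_m) (y : outputType R n m) (v : profileType R n m) : R :=
  alloc_prob v y.1 y.2 j.
have F_ge0 j y v : 0 <= F j y v by exact: alloc_prob_ge0.
have F_le1 j S v : F j (yhat S) v <= 1.
  have [_ [w Ew]] := yP S; rewrite /F Ew alloc_prob_noise.
  have noise_gt0 : (0 < #|{: market_noise n m L}|)%N.
    by apply/card_gt0P; exists [ffun=> [ffun=> ord0]].
  rewrite ler_pdivrMr ?ltr0n // mul1r -natr_sum ler_nat.
  by rewrite -sum1_card; apply: leq_sum => xi _; case: allocated.
have mF j : measurable_fun [set: outputType R n m * profileType R n m] (fun w =>
  F j w.1 w.2).
  exact: measurable_alloc_prob.
have signs (x : 'I_k -> bool -> profileType R n m) :
  #|[set sg : {ffun 'I_k -> bool} | `[< exists S j, k%:R * (eps / 4) <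
      `|sign_sum sg (fun i => F j (yhat S) (x i true)
        - F j (yhat S) (x i false))| >]]%SET|%:R
    <= 2 ^+ k * (delta / 2).
  apply: le_trans (card_market_signs L k_gt0 n_gt0 m_gt0 eps_gt0 delta01 k_large
    x).
  rewrite ler_nat; apply/subset_leq_card/fintype.subsetP => sg.
  rewrite inE => /asboolP[S [j lt]]; rewrite inE; apply/asboolP;
    have [_ [w Ew]] := yP S.
  exists (yhat S).1; exists w; exists j.
  by move: lt; rewrite /F Ew.
have le_delta : (P (~` good) <= delta%:E)%E.
  apply: (ghost_sample iidX mF F_ge0 F_le1 myhat eps_gt0 k32 signs);
    first exact: measurableC.
  move=> w ngood; apply: contrapT => /forallNP near; apply: ngood => j.
  have [emp _] := yP (sample w).
  have {}emp : `|(\sum_i F j (yhat (sample w)) (X i w)) / k%:R - 1 / 2|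
    <= eps / 2.
    move: (emp j); rewrite /empirical; congr (`|_ / _ - _| <= _).
    by apply: eq_bigr => i _; rewrite tnth_mktuple.
  have /negP := near j; rewrite -leNgt => dev.
  have mFy : measurable_fun [set: profileType R n m] (F j (yhat (sample w))).
    have mpair : measurable_fun [set: profileType R n m] (fun v =>
      (yhat (sample w), v)).
      exact: measurable_fun_pair.
    exact: (measurableT_comp (mF j) mpair).
  have F01 v : 0 <= F j (yhat (sample w)) v <= 1 by rewrite F_ge0 F_le1.
  have [r _ Er] := integral01 D mFy F01.
  move: dev; rewrite /mean Er /= -/(sample w) => dev.
  rewrite !lee_fin.
  by move: emp dev; rewrite !ler_norml => /andP[? ?] /andP[? ?]; apply/andP;
    split; lra.
have gfin : P (~` good) \is a fin_num by apply: fin_num_measure;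
  exact: measurableC.
have -> : P good = (1 - P (~` good))%E by rewrite -probability_setC ?setCK //;
  exact: measurableC.
by rewrite EFinB leeB.
Qed.
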